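(* Let $G\in \mathcal{W}_+^{m\times p}$, and assume that $T_GT_G^*$ is strictly positive. Let $\Xi_0$, $\Theta_0$ (of size $p\times k$) and $Y$ be the matrices and the function associated with $G$ as defined in the context. Then the matrix function $Y$ belongs to the Wiener space $\mathcal{W}_+^{p\times p}$, $\det Y(z)\neq 0$ for each $|z|\leq 1$, and $$Y(z)^{-1}=I_p+zE_p^*T_G^*(T_GT_G^* )^{-1}H_G(I-zS_p)^{-1}E_p\quad (z\in\mathbb{D}).$$ In particular, $Y^{-1}$ is a Wiener function, and hence $Y$ is invertible outer. Furthermore: (i) $G(z)Y(z)=G_0$ for each $|z|\leq 1$; (ii) the function $\Theta(z)=Y(z)\Theta_0$ belongs to $\mathcal{W}_+^{p\times(p-m)}$ (in particular, $k=p-m$), and $\Theta$ is an inner function with $\operatorname{Im} T_\Theta=\operatorname{Ker} T_G$; (iii) the function $H(z):=(\Theta_0^*\Theta_0)^{-1}\Theta_0^*(I_p-\Xi_0G_0)Y(z)^{-1}$ belongs to the Wiener space $\mathcal{W}_+^{(p-m)\times p}$, and $$\det\begin{bmatrix} G(z)\\ H(z)\end{bmatrix}\neq 0 \quad\text{and}\quad \begin{bmatrix} G(z)\\ H(z)\end{bmatrix}^{-1}=Y(z)\begin{bmatrix}\Xi_0&\Theta_0\end{bmatrix}\quad (|z|\leq 1).$$ Furthermore, for any $V\in\mathcal{W}_+^{(p-m)\times m}$ the function $$X(z)=Y(z)\Xi_0+Y(z)\Theta_0V(z)\quad (|z|\leq 1)$$ is a solution to the Wiener-Bezout problem associated with $G$,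 and all solutions are obtained in this way. Moreover, with $X$ given by this formula we have $$\|X(\cdot)u\|^2_{H^2_p}=\|Y(\cdot)\Xi_0u\|^2_{H^2_p}+\|V(\cdot)u\|^2_{H^2_{p-m}}\quad (u\in\mathbb{C}^m).$$ In particular, the function $\Xi(z)=Y(z)\Xi_0$ is the least squares solution to the Wiener-Bezout problem associated with $G$.
   Context: $\mathbb{D}$ is the open unit disc, $\mathbb{T}$ the unit circle. $\mathcal{W}_+^{r\times s}$ is the space of $r\times s$ matrix functions $F(z)=\sum_{\nu\ge0}F_\nu z^\nu$ with $\sum_{\nu\ge 0}\|F_\nu\|<\infty$; such $F$ is analytic on $\mathbb{D}$ and continuous on $|z|\le1$. $H^\infty_{r\times s}$ and $H^2_{r\times s}$ are the spaces of $r\times s$ matrices with entries in $H^\infty$, respectively $H^2$, of $\mathbb{D}$; $H^2_r$ is the space of $\mathbb{C}^r$-valued $H^2$ functions, with norm the square root of the sum of squared norms of the Taylor coefficients. $\ell^2_+(\mathbb{C}^n)$ is the space of square summable sequences in $\mathbb{C}^n$ indexed by $0,1,2,\ldots$ For $F\in H^\infty_{r\times s}$ with Taylor coefficients $F_0,F_1,\ldots$ at zero, $T_F:\ell^2_+(\mathbb{C}^s)\to\ell^2_+(\mathbb{C}^r)$ is the analytic (block lower triangular) Toeplitz operator whose $(i,j)$ block entry ($i,j\ge0$) is $F_{i-j}$ if $i\ge j$ and $0$ otherwise, and $H_F:\ell^2_+(\mathbb{C}^s)\to\ell^2_+(\mathbb{C}^r)$ is the Hankel operator whose $(i,j)$ block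 entry is $F_{i+j+1}$. A selfadjoint operator is strictly positive if it is $\ge\delta I$ for some $\delta>0$. $F$ is inner if $T_F$ is an isometry (equivalently, $F(\zeta)^*F(\zeta)=I$ for a.e. $\zeta\in\mathbb{T}$). A square $F\in H^\infty_{r\times r}$ is invertible outer if $F^{-1}\in H^\infty_{r\times r}$. $S_n$ is the block forward shift on $\ell^2_+(\mathbb{C}^n)$, and $E_n=\begin{bmatrix}I_n&0&0&\cdots\end{bmatrix}^\top:\mathbb{C}^n\to\ell^2_+(\mathbb{C}^n)$ is the embedding onto the first coordinate space. Let $G$ be an $m\times p$ function in $H^\infty_{m\times p}$ (note $\mathcal{W}_+^{m\times p}\subset H^\infty_{m\times p}$), with Taylor coefficients $G_0,G_1,\ldots$, such that $T_GT_G^*$ is strictly positive. Define: - $\Xi_0=E_p^*T_G^*(T_GT_G^* )^{-1}E_m$, a $p\times m$ matrix; - $\Theta_0$, a $p\times k$ matrix with $\Theta_0\Theta_0^*=I_p-E_p^*T_G^*(T_GT_G^* )^{-1}T_GE_p$ and $\operatorname{Ker}\Theta_0=\{0\}$ (so $k$ is the rank of the right hand side; $\Theta_0$ is determined up to right multiplication by a unitary matrix, and any fixed choice is allowed); - $Y(z)=I_p-zE_p^*(I-zS_p^* )^{-1}T_G^*(T_GT_G^* )^{-1}H_GE_p$ for $z\in\mathbb{D}$, a $p\times p$ matrix function (extended continuously to $|z|\le 1$ when it is a Wiener function). The Wiener-Bezout problem associated with $G\in\mathcal{W}_+^{m\times p}$ is to find $X\in\mathcal{W}_+^{p\times m}$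 with $G(z)X(z)=I_m$ for all $z\in\mathbb{D}$; such $X$ is called a solution. The least squares solution is the solution $\Xi$ such that $\|\Xi(\cdot)u\|_{H^2_p}\le\|X(\cdot)u\|_{H^2_p}$ for every solution $X$ and every $u\in\mathbb{C}^m$. *)

(* Defs.v *)
From HB Require Import structures.
From mathcomp Require Import all_boot all_order all_algebra.
From mathcomp Require Import all_classical all_reals all_analysis.
From mathcomp Require Import complex.
Set Implicit Arguments.
Unset Strict Implicit.
Unset Printing Implicit Defensive.
Import Order.TTheory GRing.Theory Num.Theory numFieldNormedType.Exports.

Local Open Scope classical_set_scope.
Local Open Scope ring_scope.
Local Open Scope sesquilinear_scope.

(* Typing the complex numbers as a numClosedFieldType gives them, and matrices
   over them, the canonical topology of MathComp-Analysis. *)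
Definition C (R : realType) : numClosedFieldType := R[i]%C.

Section Definitions.
Context {R : realType}.
Local Notation C := (C R).

Definition disc : set C := [set z | `|z| < 1].
Definition cdisc : set C := [set z | `|z| <= 1].

(* Frobenius norm: it is the Euclidean norm on columns, and all norms on
   'M[C]_(r, s) define the same Wiener and H^oo spaces. *)
Definition fnorm r s (A : 'M[C]_(r, s)) : R :=
  Num.sqrt (\sum_i \sum_j (complex.Re (A i j) ^+ 2 + complex.Im (A i j) ^+ 2)).

Definition power_series r s (a : nat -> 'M[C]_(r, s)) (z : C) :
    nat -> 'M[C]_(r, s) :=
  series (fun n => z ^+ n *: a n).

Definition is_taylor r s (F : C -> 'M[C]_(r, s)) (a : nat -> 'M[C]_(r, s)) :=
  forall z, disc z -> power_series a z @ \oo --> F z.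

(* The Taylor coefficients at zero of a function that is analytic on the disc;
   zero if F is not analytic. *)
Definition taylor r s (F : C -> 'M[C]_(r, s)) : nat -> 'M[C]_(r, s) :=
  xget (fun=> 0) [set a | is_taylor F a].

(* Only the values of F on the closed disc matter. *)
Definition wiener r s (F : C -> 'M[C]_(r, s)) :=
  exists a : nat -> 'M[C]_(r, s),
    cvgn (series (fun n => fnorm (a n))) /\
    forall z, cdisc z -> power_series a z @ \oo --> F z.

Definition Hinf r s (F : C -> 'M[C]_(r, s)) :=
  (exists a, is_taylor F a) /\
  (exists M : R, forall z, disc z -> fnorm (F z) <= M).

Definition disc_ext r s (F : C -> 'M[C]_(r, s)) (z : C) : 'M[C]_(r, s) :=
  if `|z| < 1 then F z else lim (F w @[w --> within disc (nbhs z)]).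

(* Operators on l^2_+(C^n) are maps on all sequences, of which only the action
   on square summable sequences is meaningful. *)
Definition ell2 n : set (nat -> 'cV[C]_n) :=
  [set x | cvgn (series (fun i => fnorm (x i) ^+ 2))].

Definition l2norm n (x : nat -> 'cV[C]_n) : R :=
  Num.sqrt (limn (series (fun i => fnorm (x i) ^+ 2))).

Definition l2dot n (x y : nat -> 'cV[C]_n) : C :=
  limn (series (fun i => ((y i)^t* *m x i) 0 0)).

Definition adjop r s (T : (nat -> 'cV[C]_s) -> (nat -> 'cV[C]_r))
    (y : nat -> 'cV[C]_r) : nat -> 'cV[C]_s :=
  xget (fun=> 0)
    [set w | ell2 w /\ forall x, ell2 x -> l2dot (T x) y = l2dot x w].

(* Meaningful when T is a bijection of l^2_+(C^n). *)
Definition invop n (T : (nat -> 'cV[C]_n) -> (nat -> 'cV[C]_n))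
    (y : nat -> 'cV[C]_n) : nat -> 'cV[C]_n :=
  xget (fun=> 0) [set x | ell2 x /\ T x = y].

(* In the order of C, a <= b forces b - a to be real. *)
Definition strictly_positive n (T : (nat -> 'cV[C]_n) -> (nat -> 'cV[C]_n)) :=
  exists2 delta : R, 0 < delta &
    forall x, ell2 x ->
      (((delta * l2norm x ^+ 2)%:C)%C : C) <= l2dot (T x) x.

Definition blockop r s (A : nat -> nat -> 'M[C]_(r, s)) (x : nat -> 'cV[C]_s) :
    nat -> 'cV[C]_r :=
  fun i => limn (series (fun j => A i j *m x j)).

Definition toeplitz r s (F : C -> 'M[C]_(r, s)) :=
  blockop (fun i j => if (j <= i)%N then taylor F (i - j)%N else 0).

Definition hankel r s (F : C -> 'M[C]_(r, s)) :=
  blockop (fun i j => taylor F (i + j).+1).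

Definition shiftop n (x : nat -> 'cV[C]_n) : nat -> 'cV[C]_n :=
  fun i => if i is j.+1 then x j else 0.

Definition embed n (u : 'cV[C]_n) : nat -> 'cV[C]_n :=
  fun i => if i is 0%N then u else 0.

(* E_n^* = [I_n 0 0 ...] *)
Definition embed_adj n (x : nat -> 'cV[C]_n) : 'cV[C]_n := x 0%N.

(* The inverse of I - z T. *)
Definition resolvent n (T : (nat -> 'cV[C]_n) -> (nat -> 'cV[C]_n)) (z : C) :=
  invop (fun x i => x i - z *: T x i).

(* The matrix of a linear map acting on columns. *)
Definition mx_of r s (f : 'cV[C]_s -> 'cV[C]_r) : 'M[C]_(r, s) :=
  \matrix_(i, j) f (delta_mx j 0) i 0.

Definition inner r s (F : C -> 'M[C]_(r, s)) :=
  Hinf F /\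
  forall x, ell2 x -> ell2 (toeplitz F x) /\ l2norm (toeplitz F x) = l2norm x.

Definition invertible_outer r (F : C -> 'M[C]_r) :=
  [/\ Hinf F, forall z, disc z -> F z \in unitmx
    & Hinf (fun z => invmx (F z))].

Definition H2norm n (f : C -> 'cV[C]_n) : R := l2norm (taylor f).

Section Data.
Variables (m p : nat) (G : C -> 'M[C]_(m, p)).

(* T_G T_G^* *)
Definition TTadj (y : nat -> 'cV[C]_m) : nat -> 'cV[C]_m :=
  toeplitz G (adjop (toeplitz G) y).

(* T_G^* (T_G T_G^* )^-1 *)
Definition TGdag (y : nat -> 'cV[C]_m) : nat -> 'cV[C]_p :=
  adjop (toeplitz G) (invop TTadj y).

Definition Xi0 : 'M[C]_(p, m) := mx_of (fun u => embed_adj (TGdag (embed u))).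

(* E_p^* T_G^* (T_G T_G^* )^-1 T_G E_p *)
Definition corner_proj : 'M[C]_p :=
  mx_of (fun u => embed_adj (TGdag (toeplitz G (embed u)))).

Definition Ydisc (z : C) : 'M[C]_p :=
  1%:M - z *: mx_of (fun u =>
    embed_adj (resolvent (adjop (@shiftop p)) z (TGdag (hankel G (embed u))))).

Definition Yfun : C -> 'M[C]_p := disc_ext Ydisc.

Definition bezout_solution (X : C -> 'M[C]_(p, m)) :=
  wiener X /\ forall z, disc z -> G z *m X z = 1%:M.

Definition least_squares_solution (Xi : C -> 'M[C]_(p, m)) :=
  bezout_solution Xi /\
  forall X, bezout_solution X -> forall u : 'cV[C]_m,
    H2norm (fun z => Xi z *m u) <= H2norm (fun z => X z *m u).

End Data.
End Definitions.

(* Main.v *)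
Require Import Defs.
From HB Require Import structures.
From mathcomp Require Import all_boot all_order all_algebra.
From mathcomp Require Import all_classical all_reals all_analysis.
From mathcomp Require Import complex.
From mathcomp Require Import ring lra zify.
Set Implicit Arguments.
Unset Strict Implicit.
Unset Printing Implicit Defensive.
Import Order.TTheory GRing.Theory Num.Theory numFieldNormedType.Exports.
Local Open Scope classical_set_scope.
Local Open Scope ring_scope.
Local Open Scope sesquilinear_scope.

(** Write [T] for the Toeplitz operator of [G], [S] for the shifts, [E] for the
    embeddings of the first coordinate, [A = T T^* ] and [D = T^* A^-1], a right
    inverse of [T]. Since [T^*] commutes with the backward shift and [S^* T x]
    differs from [T S^* x] by the Hankel column [H_G E x_0], every square
    summable [b] satisfies [dagger_shift]:

      [S^* D b = D (S^* b - H_G E (D b)_0)].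

    The three algebraic facts behind the theorem are instances of it. The Taylor
    coefficients of [Y] are [I] followed by the entries of [- D H_G E]. For
    [b = E u] and [b = T E u] the sequence [S^* b] is [0] and [H_G E u], and the
    identity reads [Y Xi_0 = D E] and [Y Theta_0 Theta_0^* = (I - D T) E]
    ([Ycoef_Xi0m], [Ycoef_corner]). For [b = H_G (I - z S)^-1 E u] it becomes a
    resolvent equation for [D b], whose first entry shows that the proposed
    inverse [Z z] satisfies [Y z *m Z z = I] ([Ycoef_hres], [Ycoef_Zcoef]).
    Finally [T D = I] gives [G Y = G_0].

    The columns of [Y Xi_0] thus lie in the range of [T^*], while those of
    [Theta = Y Theta_0] lie in the kernel of [T] and differ from a column of [E]
    by an element of the range of [T^*]. Elements of the kernel of [T] are
    therefore tested against [Theta] through their first entry alone, which makes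
    [Theta] an isometry ([convol_Th_isometry]). As [Theta V u] lies in the kernel
    of [T], it is orthogonal to [Y Xi_0 u], which gives the Pythagorean formula;
    equality of the norms then forces [V u = 0]. An element [x] of the kernel is
    [Y w] with [G_0 w = 0], and the kernel of [G_0] is the range of [Theta_0]
    ([g0_ker], [ker_Th]). Then [G_0] and the constant factor of [H] form a two
    sided inverse of the row [Xi_0, Theta_0], so [m + k = p], and the remaining
    claims are matrix algebra.

    The analytic point is that [Y] and its inverse are Wiener functions, which
    amounts to [A^-1] preserving absolute summability ([gram_asum]). The proof
    localizes: sequences are multiplied by weights [lam ^+ `|i - k|] with centre
    [k]. If [lam] is close to 1, the commutators of [T] and [T^*] with the weights
    are small, so the lower bound for [A] controls the norm of the weighted
    solution by that of the weighted data and a small multiple of the same norms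
    at other centres. Summing over windows of centres and absorbing the small
    term bounds the sum of the local norms, which dominates the sum of the
    entries. *)

(** * Finite sums of squares and the Frobenius norm *)

Section RealSums.
Context {R : realType}.
Implicit Types (f g : nat -> R).

Lemma sum_sqr_ge0 (I : Type) (r : seq I) (P : pred I) (a : I -> R) :
  0 <= \sum_(i <- r | P i) a i ^+ 2.
Proof. by apply: sumr_ge0 => i _; exact: sqr_ge0. Qed.
Hint Resolve sum_sqr_ge0 : core.

(** By induction; the step is the planar case, where the two sides differ by the
    square of [u * t - v * s]. *)
Lemma cauchy_schwarz_sum (I : Type) (r : seq I) (P : pred I) (a b : I -> R) :
  \sum_(i <- r | P i) a i * b i <=
  Num.sqrt (\sum_(i <- r | P i) a i ^+ 2) *
  Num.sqrt (\sum_(i <- r | P i) b i ^+ 2).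
Proof.
have step (s t x u v : R) : x <= s * t ->
    u * v + x <= Num.sqrt (u ^+ 2 + s ^+ 2) * Num.sqrt (v ^+ 2 + t ^+ 2).
  move=> xst; rewrite -sqrtrM ?addr_ge0 ?sqr_ge0 //.
  apply: (@le_trans _ _ `|u * v + s * t|).
    by apply: le_trans (ler_norm _); rewrite lerD2l.
  rewrite -sqrtr_sqr ler_wsqrtr // -subr_ge0.
  rewrite (_ : _ - _ = (u * t - v * s) ^+ 2) ?sqr_ge0 //; ring.
elim: r => [|i r IH]; first by rewrite !big_nil sqrtr0 mulr0.
rewrite !big_cons; case: (P i) => //.
by have := step _ _ _ (a i) (b i) IH; rewrite !sqr_sqrtr.
Qed.

Lemma minkowski_sum (I : Type) (r : seq I) (P : pred I) (a b : I -> R) :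
  Num.sqrt (\sum_(i <- r | P i) (a i + b i) ^+ 2) <=
  Num.sqrt (\sum_(i <- r | P i) a i ^+ 2) +
  Num.sqrt (\sum_(i <- r | P i) b i ^+ 2).
Proof.
rewrite -[leRHS]ger0_norm ?addr_ge0 ?sqrtr_ge0 // -sqrtr_sqr ler_wsqrtr //.
have -> : \sum_(i <- r | P i) (a i + b i) ^+ 2 =
    \sum_(i <- r | P i) a i ^+ 2 + 2 * (\sum_(i <- r | P i) a i * b i) +
    \sum_(i <- r | P i) b i ^+ 2.
  rewrite mulr_sumr -!big_split /=; apply: eq_bigr => i _; ring.
rewrite sqrrD !sqr_sqrtr // lerD2r lerD2l -[leRHS]mulr_natl.
by rewrite ler_wpM2l // cauchy_schwarz_sum.
Qed.

Lemma ler_sqrt_sum (I : Type) (r : seq I) (P : pred I) (a b : I -> R) :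
  (forall i, P i -> 0 <= a i <= b i) ->
  Num.sqrt (\sum_(i <- r | P i) a i ^+ 2) <=
  Num.sqrt (\sum_(i <- r | P i) b i ^+ 2).
Proof.
move=> ab; rewrite ler_wsqrtr //; apply: ler_sum => i /ab /andP[a0 ab'].
by rewrite lerXn2r ?nnegrE // (le_trans a0).
Qed.

End RealSums.
#[export] Hint Resolve sum_sqr_ge0 : core.

Section Fnorm.
Context {R : realType}.
Local Notation C := (C R).

Definition cmod (z : C) : R := complex.Re `|z|.

Lemma cmodE z : cmod z = Num.sqrt (complex.Re z ^+ 2 + complex.Im z ^+ 2).
Proof. by rewrite /cmod complex.normc_def. Qed.

Lemma norm_cmod (z : C) : `|z| = ((cmod z)%:C)%C.
Proof. by rewrite cmodE complex.normc_def. Qed.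

Lemma cmod_ge0 z : 0 <= cmod z. Proof. by rewrite cmodE sqrtr_ge0. Qed.

Lemma cmodM z w : cmod (z * w) = cmod z * cmod w.
Proof.
have : `|z * w| = `|z| * `|w| by rewrite normrM.
by rewrite !norm_cmod -rmorphM => /= -[].
Qed.

Lemma cmodD z w : cmod (z + w) <= cmod z + cmod w.
Proof.
have : `|z + w| <= `|z| + `|w| by exact: ler_normD.
by rewrite !norm_cmod -rmorphD lecR.
Qed.

Lemma cmod0 : cmod 0 = 0.
Proof. by rewrite /cmod normr0. Qed.

Lemma cmod1 : cmod 1 = 1.
Proof. by rewrite /cmod normr1. Qed.

Lemma cmodX z n : cmod (z ^+ n) = cmod z ^+ n.
Proof. by elim: n => [|n IH]; rewrite ?expr0 ?cmod1 // !exprS cmodM IH. Qed.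

Lemma cmodN z : cmod (- z) = cmod z.
Proof. by rewrite /cmod normrN. Qed.

Lemma cmod_eq0 z : cmod z = 0 -> z = 0.
Proof. by move=> h; apply/eqP; rewrite -normr_eq0 norm_cmod h. Qed.

Lemma cmod_conj z : cmod (z^*) = cmod z.
Proof. by rewrite /cmod norm_conjC. Qed.

Lemma cmod_real (x : R) : cmod ((x%:C)%C : C) = `|x|.
Proof. by rewrite cmodE /= expr0n /= addr0 sqrtr_sqr. Qed.

Lemma Re_le_cmod (z : C) : `|complex.Re z| <= cmod z.
Proof. by rewrite cmodE -sqrtr_sqr ler_wsqrtr // lerDl sqr_ge0. Qed.

Lemma Im_le_cmod (z : C) : `|complex.Im z| <= cmod z.
Proof. by rewrite cmodE -sqrtr_sqr ler_wsqrtr // lerDr sqr_ge0. Qed.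

Lemma cmod_le_ReIm (z : C) : cmod z <= `|complex.Re z| + `|complex.Im z|.
Proof.
rewrite cmodE -[leRHS]ger0_norm ?addr_ge0 // -[leRHS]sqrtr_sqr ler_wsqrtr //.
by rewrite sqrrD !real_normK ?num_real // -addrA lerD2l lerDr mulrn_wge0 ?mulr_ge0.
Qed.

Lemma disc_cmod (z : C) : disc z <-> cmod z < 1.
Proof. by rewrite /disc /= norm_cmod ltcR. Qed.

Lemma cdisc_cmod (z : C) : cdisc z <-> cmod z <= 1.
Proof. by rewrite /cdisc /= norm_cmod lecR. Qed.

Lemma fnormE r s (A : 'M[C]_(r, s)) :
  fnorm A = Num.sqrt (\sum_(ij : 'I_r * 'I_s) cmod (A ij.1 ij.2) ^+ 2).
Proof.
rewrite /fnorm pair_bigA /=; congr Num.sqrt; apply: eq_bigr => ij _.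
by rewrite cmodE sqr_sqrtr // addr_ge0 // sqr_ge0.
Qed.

Lemma fnorm_ge0 r s (A : 'M[C]_(r, s)) : 0 <= fnorm A.
Proof. exact: sqrtr_ge0. Qed.

Lemma fnorm0 r s : fnorm (0 : 'M[C]_(r, s)) = 0.
Proof.
by rewrite fnormE big1 ?sqrtr0 // => ij _; rewrite mxE cmod0 expr0n.
Qed.

Lemma cmod_le_fnorm r s (A : 'M[C]_(r, s)) i j : cmod (A i j) <= fnorm A.
Proof.
rewrite fnormE -[leLHS]ger0_norm ?cmod_ge0 // -sqrtr_sqr ler_wsqrtr //.
by rewrite (bigD1 (i, j)) //= lerDl sum_sqr_ge0.
Qed.

Lemma fnorm_eq0 r s (A : 'M[C]_(r, s)) : fnorm A = 0 -> A = 0.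
Proof.
move=> A0; apply/matrixP => i j; rewrite mxE; apply: cmod_eq0.
by apply/le_anti/andP; rewrite cmod_ge0 -A0 cmod_le_fnorm.
Qed.

Lemma fnormD r s (A B : 'M[C]_(r, s)) : fnorm (A + B) <= fnorm A + fnorm B.
Proof.
rewrite !fnormE; apply: le_trans (minkowski_sum _ _ _ _).
by apply: ler_sqrt_sum => ij _; rewrite cmod_ge0 mxE cmodD.
Qed.

Lemma fnormN r s (A : 'M[C]_(r, s)) : fnorm (- A) = fnorm A.
Proof.
by rewrite !fnormE; congr Num.sqrt; apply: eq_bigr => ij _; rewrite mxE cmodN.
Qed.

Lemma fnormB r s (A B : 'M[C]_(r, s)) : fnorm (A - B) <= fnorm A + fnorm B.
Proof. by rewrite -(fnormN B) fnormD. Qed.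

Lemma fnormBC r s (A B : 'M[C]_(r, s)) : fnorm (A - B) = fnorm (B - A).
Proof. by rewrite -fnormN opprB. Qed.

Lemma fnormZ r s z (A : 'M[C]_(r, s)) : fnorm (z *: A) = cmod z * fnorm A.
Proof.
rewrite !fnormE -[cmod z in RHS]ger0_norm ?cmod_ge0 // -sqrtr_sqr.
rewrite -sqrtrM ?sqr_ge0 // mulr_sumr.
by congr Num.sqrt; apply: eq_bigr => ij _; rewrite mxE cmodM exprMn.
Qed.

Lemma fnorm_adj r s (A : 'M[C]_(r, s)) : fnorm (A^t*) = fnorm A.
Proof.
have sqE r' s' (D : 'M[C]_(r', s')) :
    fnorm D = Num.sqrt (\sum_i \sum_j cmod (D i j) ^+ 2).
  by rewrite fnormE pair_bigA.
rewrite !sqE exchange_big /=; congr Num.sqrt.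
by apply: eq_bigr => i _; apply: eq_bigr => j _; rewrite !mxE cmod_conj.
Qed.

Lemma fnorm_sum r s (I : Type) (l : seq I) (P : pred I) (F : I -> 'M[C]_(r, s)) :
  fnorm (\sum_(i <- l | P i) F i) <= \sum_(i <- l | P i) fnorm (F i).
Proof.
apply: (big_ind2 (fun A x => fnorm A <= x)) => [|A x B y hA hB|//].
  by rewrite fnorm0.
by apply: le_trans (fnormD _ _) _; rewrite lerD.
Qed.

Lemma cmod_sum (I : Type) (l : seq I) (P : pred I) (F : I -> C) :
  cmod (\sum_(i <- l | P i) F i) <= \sum_(i <- l | P i) cmod (F i).
Proof.
apply: (big_ind2 (fun A x => cmod A <= x)) => [|A x B y hA hB|//].
  by rewrite cmod0.
by apply: le_trans (cmodD _ _) _; rewrite lerD.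
Qed.

Lemma fnormM r s t (A : 'M[C]_(r, s)) (B : 'M[C]_(s, t)) :
  fnorm (A *m B) <= fnorm A * fnorm B.
Proof.
have sqE r' s' (D : 'M[C]_(r', s')) :
    fnorm D = Num.sqrt (\sum_i \sum_j cmod (D i j) ^+ 2).
  by rewrite fnormE pair_bigA.
rewrite (sqE _ _ A) (sqE _ _ B) (sqE _ _ (A *m B)) -sqrtrM; last first.
  by apply: sumr_ge0 => i _; exact: sum_sqr_ge0.
rewrite ler_wsqrtr // mulr_suml; apply: ler_sum => i _.
rewrite [X in _ <= _ * X]exchange_big mulr_sumr; apply: ler_sum => k _ /=.
rewrite mxE; set x := \sum_j _.
have : cmod x <= Num.sqrt (\sum_j cmod (A i j) ^+ 2) *
                 Num.sqrt (\sum_j cmod (B j k) ^+ 2).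
  apply: le_trans (cmod_sum _ _ _) (le_trans _ (cauchy_schwarz_sum _ _ _ _)).
  by apply: ler_sum => j _; rewrite cmodM.
move=> h; have {h} : cmod x ^+ 2 <= (Num.sqrt (\sum_j cmod (A i j) ^+ 2) *
                 Num.sqrt (\sum_j cmod (B j k) ^+ 2)) ^+ 2.
  by rewrite lerXn2r ?nnegrE ?cmod_ge0 ?mulr_ge0 ?sqrtr_ge0.
by rewrite exprMn !sqr_sqrtr ?sum_sqr_ge0.
Qed.

Lemma fnorm_le r s (A : 'M[C]_(r, s)) : fnorm A <= \sum_i \sum_j cmod (A i j).
Proof.
rewrite {1}(matrix_sum_delta A).
apply: le_trans (fnorm_sum _ _ _) _; apply: ler_sum => i _.
apply: le_trans (fnorm_sum _ _ _) _; apply: ler_sum => j _.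
rewrite fnormZ -[leRHS]mulr1 ler_wpM2l ?cmod_ge0 //.
rewrite fnormE (bigD1 (i, j)) //= big1 ?addr0 ?mxE ?eqxx /=.
  by rewrite cmod1 expr1n sqrtr1.
case=> i' j' /=; rewrite xpair_eqE mxE => /negbTE ->.
by rewrite cmod0 expr0n.
Qed.

Lemma fnorm_mx11 (A : 'M[C]_1) : fnorm A = cmod (A 0 0).
Proof.
rewrite fnormE (bigD1 (0, 0)) //= big1 ?addr0 ?sqrtr_sqr ?ger0_norm ?cmod_ge0 //.
by case=> i j; rewrite !ord1.
Qed.

Lemma fnorm_sqr_col n (x : 'cV[C]_n) :
  (((fnorm x ^+ 2)%:C)%C : C) = (x^t* *m x) 0 0.
Proof.
rewrite /fnorm sqr_sqrtr; last first.
  by apply: sumr_ge0 => i _; apply: sumr_ge0 => j _; rewrite addr_ge0 ?sqr_ge0.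
rewrite mxE rmorph_sum; apply: eq_bigr => i _; rewrite big_ord1 !mxE.
rewrite -[RHS]mulrC -normCK norm_cmod -rmorphXn; congr ((_)%:C)%C.
by rewrite cmodE sqr_sqrtr // addr_ge0 ?sqr_ge0.
Qed.

End Fnorm.

(** * Nonnegative series *)

Section RealSeries.
Context {R : realType}.
Implicit Types (f g b : nat -> R).

(** Estimates are phrased through bounds on all partial sums, so that they only
    involve finite sums; completeness of the reals enters through [bsum_cvg]. *)
Definition bsum f (M : R) := forall n, \sum_(i < n) f i <= M.

Lemma seriesE (V : zmodType) (f : nat -> V) n : series f n = \sum_(i < n) f i.
Proof. by rewrite /series /= big_mkord. Qed.

Lemma bsum_ge0 f M : bsum f M -> 0 <= M.
Proof. by move=> /(_ 0%N); rewrite big_ord0. Qed.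

Lemma bsum_le f g M : (forall i, f i <= g i) -> bsum g M -> bsum f M.
Proof. by move=> fg gM n; apply: le_trans (gM n); exact: ler_sum. Qed.

Lemma bsumD f g M N : bsum f M -> bsum g N -> bsum (fun i => f i + g i) (M + N).
Proof. by move=> fM gN n; rewrite big_split lerD. Qed.

Lemma bsumZ f M c : 0 <= c -> bsum f M -> bsum (fun i => c * f i) (c * M).
Proof. by move=> c0 fM n; rewrite -mulr_sumr ler_wpM2l. Qed.

Lemma bsum_elem f M i : (forall i, 0 <= f i) -> bsum f M -> f i <= M.
Proof.
move=> f0 /(_ i.+1); rewrite big_ord_recr /=; apply: le_trans.
by rewrite lerDr sumr_ge0.
Qed.

Lemma sum_addn (V : zmodType) (f : nat -> V) k n :
  \sum_(i < k + n) f i = \sum_(i < k) f i + \sum_(i < n) f (k + i)%N.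
Proof. by rewrite big_split_ord. Qed.

Lemma bsum_shift f M k : (forall i, 0 <= f i) -> bsum f M ->
  bsum (fun i => f (k + i)%N) M.
Proof.
move=> f0 fM n; apply: le_trans (fM (k + n)%N).
by rewrite sum_addn lerDr sumr_ge0.
Qed.

Lemma ler_sum_widen f n m : (forall i, 0 <= f i) -> (n <= m)%N ->
  \sum_(i < n) f i <= \sum_(i < m) f i.
Proof.
by move=> f0 /subnKC <-; rewrite sum_addn lerDl sumr_ge0.
Qed.

Lemma bsum_cvg f M : (forall i, 0 <= f i) -> bsum f M -> cvgn (series f).
Proof.
move=> f0 fM; apply: nondecreasing_is_cvgn.
  by move=> n m nm; rewrite !seriesE ler_sum_widen.
by exists M => _ [n _ <-]; rewrite seriesE.
Qed.

Lemma cvg_bsum f : (forall i, 0 <= f i) -> cvgn (series f) ->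
  bsum f (limn (series f)).
Proof.
move=> f0 cf n; rewrite -seriesE; apply: nondecreasing_cvgn_le => //.
by move=> k m km; rewrite !seriesE ler_sum_widen.
Qed.

Lemma bsum_lim f M : (forall i, 0 <= f i) -> bsum f M -> limn (series f) <= M.
Proof.
move=> f0 fM; apply: limr_le; first exact: bsum_cvg fM.
by apply: nearW => n; rewrite seriesE.
Qed.

Lemma bsum_tail b M e : (forall i, 0 <= b i) -> bsum b M -> 0 < e ->
  exists N, bsum (fun i => b (N + i)%N) e.
Proof.
move=> b0 bM e0; have cb := bsum_cvg b0 bM.
have /cvgrPdist_le /(_ _ e0) [N _ hN] := cb.
exists N => n; have := hN N (leqnn N); have := cvg_bsum b0 cb (N + n).
rewrite sum_addn seriesE => h1 h2.
have := le_trans (ler_norm _) h2; lra.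
Qed.

Lemma sum_geom_le (q : R) n : 0 <= q -> q < 1 ->
  \sum_(i < n) q ^+ i <= (1 - q)^-1.
Proof.
move=> q0 q1; rewrite -[leRHS]mul1r ler_pdivlMr ?subr_gt0 // mulrC.
have -> : (1 - q) * \sum_(i < n) q ^+ i = 1 - q ^+ n.
  by rewrite -opprB mulNr -subrX1 opprB.
by rewrite gerBl exprn_ge0.
Qed.

Lemma cvg_sumr (T I : Type) (F : set_system T) {FF : Filter F}
    (l : seq I) (P : pred I) (f : I -> T -> R) (a : I -> R) :
  (forall i, f i t @[t --> F] --> a i) ->
  \sum_(i <- l | P i) f i t @[t --> F] --> \sum_(i <- l | P i) a i.
Proof.
move=> fa; elim: l => [|i l IH].
  by rewrite big_nil; under eq_fun do rewrite big_nil; exact: cvg_cst.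
rewrite big_cons; under eq_fun do rewrite big_cons.
by case: (P i) => //; apply: cvgD.
Qed.

(** Dominated convergence: past a fixed index the dominating series bounds all
    partial sums at once, and the finitely many remaining terms tend to zero. *)
Lemma bsum_dominated (T : Type) (F : set_system T) {FF : Filter F}
    (f : T -> nat -> R) b M e :
  (forall i, 0 <= b i) -> bsum b M ->
  (\forall t \near F, forall i, 0 <= f t i <= b i) ->
  (forall i, f t i @[t --> F] --> 0) -> 0 < e ->
  \forall t \near F, bsum (f t) e.
Proof.
move=> b0 bM fb f0 e0; have e20 : 0 < e / 2 by rewrite divr_gt0.
have [N hN] := bsum_tail b0 bM e20.
have : \sum_(i < N) f t i @[t --> F] --> \sum_(i < N) (0 : R).
  by apply: cvg_sumr => i.
rewrite big1_eq => /cvgrPdist_le /(_ _ e20) h.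
near=> t; move=> n; have ht : `|0 - \sum_(i < N) f t i| <= e / 2.
  by near: t; exact: h.
have fbt : forall i, 0 <= f t i <= b i by near: t.
have ft0 i : 0 <= f t i by have /andP[] := fbt i.
apply: (@le_trans _ _ (\sum_(i < N + n) f t i)).
  by rewrite ler_sum_widen // leq_addl.
rewrite sum_addn; rewrite sub0r normrN ger0_norm ?sumr_ge0 // in ht.
rewrite [e]splitr lerD // (le_trans _ (hN n)) // ler_sum // => i _.
by have /andP[] := fbt (N + i)%N.
Unshelve. all: by end_near. Qed.

End RealSeries.

Section MatrixSeries.
Context {R : realType}.
Local Notation C := (C R).

(** All limits of matrices below are limits of real numbers through this
    equivalence; the factor [(r * s).+1] compares entries with the norm and
    stays positive for empty matrices. *)
Lemma cvg_fnorm (T : Type) (F : set_system T) {FF : Filter F} r s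
    (f : T -> 'M[C]_(r, s)) (l : 'M[C]_(r, s)) :
  f @ F --> l <-> fnorm (f t - l) @[t --> F] --> (0 : R).
Proof.
split=> [/cvg_ballP fl|/cvgrPdist_lt fl].
  apply/cvgrPdist_le => e e0.
  have d0 : 0 < e / ((r * s).+1%:R : R) by rewrite divr_gt0.
  set d := e / _ in d0.
  have dC : (0 : C) < (d%:C)%C by rewrite ltcR.
  apply: filterS (fl _ dC) => t [_ ht].
  rewrite sub0r normrN ger0_norm ?fnorm_ge0 //.
  apply: le_trans (fnorm_le _) _.
  apply: (@le_trans _ _ (\sum_(i < r) \sum_(j < s) d)).
    apply: ler_sum => i _; apply: ler_sum => j _.
    have := ht i j; rewrite /ball /= !mxE -normrN opprB norm_cmod ltcR.
    exact: ltW.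
  rewrite !sumr_const !card_ord -mulrnA /d -[_ *+ _]mulr_natr mulrAC.
  by rewrite ler_pdivrMr // ler_wpM2l ?(ltW e0) // ler_nat mulnC ltnW.
apply/cvg_ballP => e e0.
have eR : e = ((complex.Re e)%:C)%C.
  by rewrite complex.RRe_real // gtr0_real.
have {}e0 : 0 < complex.Re e by move: e0; rewrite eR ltcR.
rewrite eR; apply: filterS (fl _ e0) => t.
rewrite sub0r normrN ger0_norm ?fnorm_ge0 // => ht; split.
  by rewrite ltcR.
move=> i j; rewrite /ball /= -normrN opprB norm_cmod ltcR.
apply: le_lt_trans ht; have := cmod_le_fnorm (f t - l) i j.
by rewrite !mxE.
Qed.

End MatrixSeries.

(** * Convergent series of matrices *)

Section HasSum.
Context {R : realType}.
Local Notation C := (C R).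

Definition has_sum r s (a : nat -> 'M[C]_(r, s)) (l : 'M[C]_(r, s)) :=
  series a @ \oo --> l.

Definition asum r s (a : nat -> 'M[C]_(r, s)) :=
  exists M, bsum (fun i => fnorm (a i)) M.

Definition vsum r s (a : nat -> 'M[C]_(r, s)) : 'M[C]_(r, s) := limn (series a).

Lemma has_sumP r s (a : nat -> 'M[C]_(r, s)) l : has_sum a l <->
  fnorm (\sum_(i < n) a i - l) @[n --> \oo] --> (0 : R).
Proof.
rewrite /has_sum cvg_fnorm.
by under eq_fun do rewrite seriesE.
Qed.

Lemma asumP r s (a : nat -> 'M[C]_(r, s)) :
  cvgn (series (fun i => fnorm (a i))) <-> asum a.
Proof.
split=> [ca|[M]]; last by apply: bsum_cvg => i; exact: fnorm_ge0.
by eexists; apply: cvg_bsum ca => i; exact: fnorm_ge0.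
Qed.

Lemma cvg_fnorm_uniq (T : Type) (F : set_system T) {FF : ProperFilter F} r s
    (f : T -> 'M[C]_(r, s)) (l l' : 'M[C]_(r, s)) :
  f @ F --> l -> f @ F --> l' -> l = l'.
Proof.
move=> /cvg_fnorm fl /cvg_fnorm fl'; apply/eqP; rewrite -subr_eq0; apply/eqP.
apply: fnorm_eq0; apply/le_anti; rewrite fnorm_ge0 andbT.
apply/ler_addgt0Pl => e e0; rewrite addr0.
have e20 : 0 < e / 2 by rewrite divr_gt0.
move/cvgrPdist_le : fl => /(_ _ e20) fl.
move/cvgrPdist_le : fl' => /(_ _ e20) fl'.
near F => t.
have h1 : `|0 - fnorm (f t - l)| <= e / 2 by near: t.
have h2 : `|0 - fnorm (f t - l')| <= e / 2 by near: t.
move: h1 h2; rewrite !sub0r !normrN !ger0_norm ?fnorm_ge0 // => h1 h2.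
have -> : l - l' = (f t - l') - (f t - l).
  by apply/matrixP => i j; rewrite !mxE; ring.
by rewrite [e]splitr; apply: le_trans (fnormB _ _) _; rewrite lerD.
Unshelve. all: by end_near. Qed.

Lemma cvg_fnorm_lim (T : Type) (F : set_system T) {FF : ProperFilter F} r s
    (f : T -> 'M[C]_(r, s)) (l : 'M[C]_(r, s)) :
  f @ F --> l -> lim (f @ F) = l.
Proof.
move=> fl; have : cvg (f @ F) by apply/cvg_ex; exists l.
by move=> /cvg_fnorm_uniq /(_ fl).
Qed.

Lemma has_sum_uniq r s (a : nat -> 'M[C]_(r, s)) l l' :
  has_sum a l -> has_sum a l' -> l = l'.
Proof. exact: cvg_fnorm_uniq. Qed.

Lemma vsumE r s (a : nat -> 'M[C]_(r, s)) l : has_sum a l -> vsum a = l.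
Proof. exact: cvg_fnorm_lim. Qed.

(** Taking [N = 0] bounds a sum, taking [N] large bounds the error of a partial
    sum. *)
Lemma has_sum_bound_tail r s (a : nat -> 'M[C]_(r, s)) l M N : has_sum a l ->
  (forall n, \sum_(i < n) fnorm (a (N + i)%N) <= M) ->
  fnorm (l - \sum_(i < N) a i) <= M.
Proof.
move=> /has_sumP /cvgrPdist_le al aM; apply/ler_addgt0Pl => e e0.
have [K _ hK] := al _ e0.
have := hK (N + K)%N (leq_addl _ _).
rewrite sub0r normrN ger0_norm ?fnorm_ge0 // sum_addn => h.
have -> : l - \sum_(i < N) a i = (\sum_(i < K) a (N + i)%N) -
   (\sum_(i < N) a i + \sum_(i < K) a (N + i)%N - l).
  by apply/matrixP => i j; rewrite !mxE; ring.
apply: le_trans (fnormB _ _) _; rewrite addrC lerD //.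
exact: le_trans (fnorm_sum _ _ _) _.
Qed.

Lemma has_sum_bound r s (a : nat -> 'M[C]_(r, s)) l M : has_sum a l ->
  bsum (fun i => fnorm (a i)) M -> fnorm l <= M.
Proof.
move=> al aM; have := @has_sum_bound_tail _ _ a l M 0 al aM.
by rewrite big_ord0 subr0.
Qed.

(** Absolute convergence gives convergence of the real and imaginary parts
    separately. *)
Lemma complex_has_sum (a : nat -> C) M : bsum (fun i => cmod (a i)) M ->
  exists l, cmod (\sum_(i < n) a i - l) @[n --> \oo] --> (0 : R).
Proof.
move=> aM.
have re : cvgn (series (fun i => complex.Re (a i))).
  apply: normed_cvg; apply: (bsum_cvg (M := M)) => [i|]; first exact: normr_ge0.
  by apply: bsum_le aM => i; exact: Re_le_cmod.
have im : cvgn (series (fun i => complex.Im (a i))).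
  apply: normed_cvg; apply: (bsum_cvg (M := M)) => [i|]; first exact: normr_ge0.
  by apply: bsum_le aM => i; exact: Im_le_cmod.
move/cvgrPdist_le in re; move/cvgrPdist_le in im.
exists (complex.Complex (limn (series (fun i => complex.Re (a i))))
          (limn (series (fun i => complex.Im (a i))))).
apply/cvgrPdist_le => e e0; have e20 : 0 < e / 2 by rewrite divr_gt0.
apply: filterS2 (re _ e20) (im _ e20) => n; rewrite !seriesE => h1 h2.
rewrite sub0r normrN ger0_norm ?cmod_ge0 //.
apply: le_trans (cmod_le_ReIm _) _; rewrite [e]splitr lerD //.
  by rewrite raddfB /= raddf_sum distrC.
by rewrite raddfB /= raddf_sum distrC.
Qed.

Lemma asum_has_sum r s (a : nat -> 'M[C]_(r, s)) : asum a ->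
  has_sum a (vsum a).
Proof.
move=> [M aM]; suff [l al] : exists l, has_sum a l by rewrite (vsumE al).
have /choice [l hl] : forall ij : 'I_r * 'I_s, exists l,
    cmod (\sum_(i < n) a i ij.1 ij.2 - l) @[n --> \oo] --> (0 : R).
  move=> ij; apply: (@complex_has_sum (fun n => a n ij.1 ij.2) M).
  by apply: bsum_le aM => i; exact: cmod_le_fnorm.
exists (\matrix_(i, j) l (i, j)); apply/has_sumP.
have : \sum_(ij : 'I_r * 'I_s) cmod (\sum_(i < n) a i ij.1 ij.2 - l ij)
   @[n --> \oo] --> \sum_(ij : 'I_r * 'I_s) (0 : R).
  by apply: cvg_sumr.
rewrite big1_eq => h.
apply: squeeze_cvgr h; last exact: cvg_cst.
apply: nearW => n; rewrite fnorm_ge0 /=; apply: le_trans (fnorm_le _) _.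
rewrite pair_bigA; apply: ler_sum => -[i j] _ /=.
by rewrite !mxE summxE.
Qed.

(** The source of the compatibility of sums with matrix products, scalars and
    adjoints. *)
Lemma has_sum_map r s r' s' (phi : 'M[C]_(r, s) -> 'M[C]_(r', s')) K a l :
  {morph phi : x y / x - y} -> (forall x, fnorm (phi x) <= K * fnorm x) ->
  has_sum a l -> has_sum (phi \o a) (phi l).
Proof.
move=> phiB phiK /has_sumP al; apply/has_sumP.
have phi0 : phi 0 = 0 by rewrite -(subrr 0) phiB subrr.
have phiD x y : phi (x + y) = phi x + phi y.
  by rewrite -{1}[y]opprK phiB -[- y]sub0r phiB phi0 sub0r opprK.
have : K * fnorm (\sum_(i < n) a i - l) @[n --> \oo] --> K * 0.
  by apply: cvgMr.
rewrite mulr0; apply: squeeze_cvgr; last exact: cvg_cst.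
apply: nearW => n; rewrite fnorm_ge0 /= -(big_morph _ phiD phi0) -phiB.
exact: phiK.
Qed.

Lemma has_sumM r s t (A : 'M[C]_(r, s)) (a : nat -> 'M[C]_(s, t)) l :
  has_sum a l -> has_sum (fun n => A *m a n) (A *m l).
Proof.
apply: (@has_sum_map _ _ _ _ (mulmx A) (fnorm A)); first exact: mulmxBr.
exact: fnormM.
Qed.

Lemma has_sumMr r s t (A : 'M[C]_(s, t)) (a : nat -> 'M[C]_(r, s)) l :
  has_sum a l -> has_sum (fun n => a n *m A) (l *m A).
Proof.
apply: (@has_sum_map _ _ _ _ (mulmxr A) (fnorm A)) => [x y|x].
  exact: mulmxBl.
by rewrite mulrC fnormM.
Qed.

Lemma has_sumZ r s (z : C) (a : nat -> 'M[C]_(r, s)) l :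
  has_sum a l -> has_sum (fun n => z *: a n) (z *: l).
Proof.
apply: (@has_sum_map _ _ _ _ ( *:%R z) (cmod z)) => [x y|x].
  exact: scalerBr.
by rewrite fnormZ.
Qed.

Lemma has_sum_adj r s (a : nat -> 'M[C]_(r, s)) l :
  has_sum a l -> has_sum (fun n => (a n)^t*) (l^t*).
Proof.
apply: (@has_sum_map _ _ _ _ (fun x => x^t*) 1) => [x y|x].
  by rewrite linearB /= map_mxB.
by rewrite fnorm_adj mul1r.
Qed.

Lemma eq_has_sum r s (a b : nat -> 'M[C]_(r, s)) l :
  a =1 b -> has_sum a l -> has_sum b l.
Proof. by move=> /funext ->. Qed.

Lemma has_sumD r s (a b : nat -> 'M[C]_(r, s)) l m :
  has_sum a l -> has_sum b m -> has_sum (fun n => a n + b n) (l + m).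
Proof.
move=> /has_sumP al /has_sumP bm; apply/has_sumP.
have : fnorm (\sum_(i < n) a i - l) + fnorm (\sum_(i < n) b i - m)
    @[n --> \oo] --> (0 + 0 : R) by apply: cvgD.
rewrite addr0; apply: squeeze_cvgr; last exact: cvg_cst.
apply: nearW => n; rewrite fnorm_ge0 /= big_split /= opprD addrACA.
exact: fnormD.
Qed.

Lemma has_sumN r s (a : nat -> 'M[C]_(r, s)) l :
  has_sum a l -> has_sum (fun n => - a n) (- l).
Proof.
move=> /(has_sumZ (z := -1)); rewrite scaleN1r.
by apply: eq_has_sum => n; rewrite scaleN1r.
Qed.

Lemma has_sumB r s (a b : nat -> 'M[C]_(r, s)) l m :
  has_sum a l -> has_sum b m -> has_sum (fun n => a n - b n) (l - m).
Proof. by move=> al /has_sumN; exact: has_sumD. Qed.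

Lemma has_sum_fin r s (a : nat -> 'M[C]_(r, s)) n :
  (forall i, (n <= i)%N -> a i = 0) -> has_sum a (\sum_(i < n) a i).
Proof.
move=> a0; apply/has_sumP; apply: (cvg_near_cst _).
exists n => // k /= /subnKC <-; rewrite sum_addn.
by rewrite addrAC subrr add0r big1 ?fnorm0 // => i _; rewrite a0 // leq_addr.
Qed.

Lemma has_sum0 r s : has_sum (fun=> 0 : 'M[C]_(r, s)) 0.
Proof. by have := @has_sum_fin r s (fun=> 0) 0; rewrite big_ord0; apply. Qed.

Lemma has_sum_shift r s (a : nat -> 'M[C]_(r, s)) l :
  has_sum (fun n => a n.+1) l -> has_sum a (a 0%N + l).
Proof.
move=> /has_sumP al; apply/has_sumP.
rewrite -(cvg_shiftn 1) /=; apply: cvg_trans al; apply: near_eq_cvg.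
by apply: nearW => n; rewrite addn1 big_ord_recl opprD addrACA subrr add0r.
Qed.

Lemma has_sum_addn r s (a : nat -> 'M[C]_(r, s)) l k :
  has_sum (fun n => a (k + n)%N) l -> has_sum a (\sum_(i < k) a i + l).
Proof.
elim: k l => [|k IH] l hl; first by rewrite big_ord0 add0r.
rewrite big_ord_recr /= -addrA; apply: IH.
have := @has_sum_shift _ _ (fun n => a (k + n)%N) l; rewrite addn0; apply.
by apply: eq_has_sum hl => n; rewrite addnS.
Qed.

Lemma has_sum_sum r s k (a : 'I_k -> nat -> 'M[C]_(r, s)) l :
  (forall i, has_sum (a i) (l i)) ->
  has_sum (fun n => \sum_(i < k) a i n) (\sum_(i < k) l i).
Proof.
elim: k a l => [|k IH] a l al.
  rewrite big_ord0; have := @has_sum0 r s; apply: eq_has_sum => n.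
  by rewrite big_ord0.
rewrite big_ord_recr /=.
have h := has_sumD (IH (fun i => a (widen_ord (leqnSn k) i)) _ (fun i => al _))
  (al ord_max).
by apply: eq_has_sum h => n; rewrite big_ord_recr.
Qed.

End HasSum.
Arguments has_sumM {R r s t} A {a l}.
Arguments has_sumMr {R r s t} A {a l}.
Arguments has_sumZ {R r s} z {a l}.

(** * Double series, power series and Wiener functions *)

Section DoubleSeries.
Context {R : realType}.
Local Notation C := (C R).

(** Fubini for absolutely summable arrays. Truncating the inner index at [k]
    commits an error that is a sum over [i] of tails; each tail is at most [b i]
    and tends to zero, so dominated convergence applies. *)
Lemma has_sum_exchange r s (a : nat -> nat -> 'M[C]_(r, s)) al be l b M :
  (forall i, bsum (fun j => fnorm (a i j)) (b i)) -> bsum b M ->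
  (forall i, has_sum (a i) (al i)) -> (forall j, has_sum (a^~ j) (be j)) ->
  has_sum al l -> has_sum be l.
Proof.
move=> ab bM haal habe hal; apply/has_sumP/cvgrPdist_le => e e0.
have b0 i : 0 <= b i by exact: bsum_ge0 (ab i).
have h : \forall k \near \oo,
    bsum (fun i => fnorm (al i - \sum_(j < k) a i j)) e.
  apply: (bsum_dominated b0 bM) => // [|i]; last first.
    by have /has_sumP := haal i; under eq_fun do rewrite fnormBC.
  apply: nearW => k i; rewrite fnorm_ge0 /=; apply: has_sum_bound_tail (haal i) _.
  by apply: bsum_shift (ab i) => j; exact: fnorm_ge0.
apply: filterS h => k hk; rewrite sub0r normrN ger0_norm ?fnorm_ge0 //.
rewrite fnormBC; apply: has_sum_bound hk.
by apply: has_sumB hal _; exact: has_sum_sum.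
Qed.

Lemma bsum_exchange r s (a : nat -> nat -> 'M[C]_(r, s)) be b M :
  (forall i, bsum (fun j => fnorm (a i j)) (b i)) -> bsum b M ->
  (forall j, has_sum (a^~ j) (be j)) -> bsum (fun j => fnorm (be j)) M.
Proof.
move=> ab bM habe k.
have h : \sum_(j < k) fnorm (\sum_(i < n) a i j - be j) @[n --> \oo] -->
    \sum_(j < k) (0 : R).
  by apply: cvg_sumr => j; have /has_sumP := habe j.
rewrite big1_eq in h; apply/ler_addgt0Pl => e e0.
move/cvgrPdist_le : h => /(_ _ e0) [n _ /(_ n (leqnn n))].
rewrite sub0r normrN ger0_norm; last first.
  by apply: sumr_ge0 => j _; exact: fnorm_ge0.
move=> h; apply: (@le_trans _ _ (\sum_(j < k) fnorm (\sum_(i < n) a i j - be j)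
    + \sum_(j < k) fnorm (\sum_(i < n) a i j))).
  rewrite -big_split; apply: ler_sum => j _ /=.
  have {1}-> : be j = \sum_(i < n) a i j - (\sum_(i < n) a i j - be j).
    by apply/matrixP => x y; rewrite !mxE; ring.
  by rewrite addrC; exact: fnormB.
rewrite lerD //; apply: le_trans (bM n).
apply: (@le_trans _ _ (\sum_(j < k) \sum_(i < n) fnorm (a i j))).
  by apply: ler_sum => j _; exact: fnorm_sum.
by rewrite exchange_big /=; apply: ler_sum => i _; exact: ab.
Qed.

End DoubleSeries.

Section PowerSeries.
Context {R : realType}.
Local Notation C := (C R).

Definition psterm r s (a : nat -> 'M[C]_(r, s)) (z : C) n := z ^+ n *: a n.

(** The coefficients of a product of power series; as an operator on [b] this is
    the lower triangular Toeplitz operator with symbol [a]. *)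
Definition convol r s t (a : nat -> 'M[C]_(r, s)) (b : nat -> 'M[C]_(s, t)) n :=
  \sum_(i < n.+1) a (n - i)%N *m b i.

(** The coefficients are kept explicit because all identities between Wiener
    functions below are proved on them. *)
Definition wiener_coef r s (a : nat -> 'M[C]_(r, s)) (F : C -> 'M[C]_(r, s)) :=
  asum a /\ forall z, cdisc z -> has_sum (psterm a z) (F z).

Lemma wienerP r s (F : C -> 'M[C]_(r, s)) : wiener F <-> exists a, wiener_coef a F.
Proof.
by split=> -[a [ca aF]]; exists a; split=> //; apply/asumP.
Qed.

Lemma disc_cdisc (z : C) : disc z -> cdisc z.
Proof. by move=> /disc_cmod /ltW h; apply/cdisc_cmod. Qed.

Lemma fnorm_psterm r s (a : nat -> 'M[C]_(r, s)) z n : cdisc z ->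
  fnorm (psterm a z n) <= fnorm (a n).
Proof.
move=> /cdisc_cmod z1; rewrite fnormZ ler_piMl ?fnorm_ge0 // cmodX.
by rewrite exprn_ile1 // cmod_ge0.
Qed.

Lemma asum_psterm r s (a : nat -> 'M[C]_(r, s)) z : asum a -> cdisc z ->
  asum (psterm a z).
Proof.
by move=> [M aM] z1; exists M; apply: bsum_le aM => i; exact: fnorm_psterm.
Qed.

Lemma wiener_coef_vsum r s (a : nat -> 'M[C]_(r, s)) : asum a ->
  wiener_coef a (fun z => vsum (psterm a z)).
Proof.
by move=> aa; split=> // z z1; apply: asum_has_sum; exact: asum_psterm.
Qed.

Lemma eq_wiener_coef r s (a : nat -> 'M[C]_(r, s)) F K :
  (forall z, cdisc z -> F z = K z) -> wiener_coef a F -> wiener_coef a K.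
Proof. by move=> FK [aa aF]; split=> [//|z z1]; rewrite -(FK z z1); exact: aF. Qed.

Lemma wiener_coef_taylor r s (a : nat -> 'M[C]_(r, s)) F :
  wiener_coef a F -> is_taylor F a.
Proof. by move=> [_ aF] z /disc_cdisc; exact: aF. Qed.

(** The first nonzero coefficient [a k] would dominate the series near zero:
    convergence at one half bounds [a n] by [M * 2 ^+ n], so at a small [t] the
    terms past [k] add up to [O(t ^+ k.+1)]. *)
Lemma power_series_eq0 r s (a : nat -> 'M[C]_(r, s)) :
  (forall z, disc z -> has_sum (psterm a z) 0) -> a = fun=> 0.
Proof.
move=> a0; apply/funext => k; elim/ltn_ind: k => k IH.
have [M aM] : exists M, forall n, fnorm (a n) <= M * 2 ^+ n.
  pose z : C := ((2^-1 : R)%:C)%C.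
  have cz : cmod z = 2^-1 by rewrite cmod_real ger0_norm.
  have /a0/has_sumP : disc z by apply/disc_cmod; rewrite cz; lra.
  move=> /cvgrPdist_le /(_ 1 ltr01) [N _ hN].
  exists (2 + \sum_(i < N) fnorm (a i)) => n.
  have S0 : 0 <= \sum_(i < N) fnorm (a i).
    by apply: sumr_ge0 => i _; exact: fnorm_ge0.
  have p1 : 1 <= 2 ^+ n :> R by rewrite exprn_ege1 // ler1n.
  have [nN|Nn] := ltnP n N.
    apply: (@le_trans _ _ (\sum_(i < N) fnorm (a i))).
      by rewrite (bigD1 (Ordinal nN)) //= lerDl sumr_ge0 // => *; exact: fnorm_ge0.
    apply: (@le_trans _ _ ((2 + \sum_(i < N) fnorm (a i)) * 1)).
      by rewrite mulr1 lerDr.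
    by rewrite ler_wpM2l // addr_ge0.
  have h1 := hN n Nn; have h2 := hN n.+1 (leqW Nn).
  move: h1 h2; rewrite /= !subr0 !sub0r !normrN !ger0_norm ?fnorm_ge0 // => h1 h2.
  have : fnorm (psterm a z n) <= 2.
    have -> : psterm a z n = \sum_(i < n.+1) psterm a z i - \sum_(i < n) psterm a z i.
      by rewrite big_ord_recr /= addrAC subrr add0r.
    apply: le_trans (fnormB _ _) _; lra.
  rewrite /psterm fnormZ cmodX cz exprVn mulrC ler_pdivrMr ?exprn_gt0 // => h.
  by apply: le_trans h _; rewrite ler_wpM2r ?exprn_ge0 // lerDl.
have M0 : 0 <= M by have := aM 0%N; rewrite expr0 mulr1; apply: le_trans (fnorm_ge0 _).
apply: fnorm_eq0; apply/le_anti; rewrite fnorm_ge0 andbT.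
apply/ler_addgt0Pl => e e0; rewrite addr0.
(* The terms past k add up to at most t ^ k * (B * t), which tB makes <= t ^ k * e. *)
pose B := M * 2 ^+ k * 4.
have B0 : 0 <= B by rewrite !mulr_ge0 ?exprn_ge0.
pose t := Num.min 4^-1 (e / (B + 1)).
have t0 : 0 < t by rewrite lt_min invr_gt0 ltr0n divr_gt0 // ltr_wpDl.
have t4 : t <= 4^-1 by rewrite ge_min lexx.
have tB : B * t <= e.
  apply: (@le_trans _ _ (B * (e / (B + 1)))).
    by rewrite ler_wpM2l // ge_min lexx orbT.
  rewrite mulrA ler_pdivrMr ?ltr_wpDl // mulrC.
  by rewrite ler_wpM2l ?(ltW e0) // lerDl ler01.
pose z : C := (t%:C)%C.
have cz : cmod z = t by rewrite cmod_real ger0_norm // ltW.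
have /a0 hz : disc z by apply/disc_cmod; rewrite cz; lra.
have := @has_sum_bound_tail _ _ _ (psterm a z) 0 (t ^+ k * e) k.+1 hz.
rewrite sub0r fnormN big_ord_recr /= big1 => [|i _]; last first.
  by rewrite /psterm IH ?scaler0.
rewrite add0r /psterm fnormZ cmodX cz => h.
rewrite -(ler_pM2l (exprn_gt0 k t0)); apply: h => n.
apply: (@le_trans _ _ (\sum_(i < n) t ^+ k * (B * t) * (2^-1 ^+ i.+1))).
  apply: ler_sum => i _; rewrite fnormZ cmodX cz.
  apply: (@le_trans _ _ (t ^+ (k.+1 + i) * (M * 2 ^+ (k.+1 + i)))).
    by rewrite ler_wpM2l ?exprn_ge0 ?(ltW t0).
  rewrite !addSn !exprS !exprD /B.
  have -> : t * (t ^+ k * t ^+ i) * (M * (2 * (2 ^+ k * 2 ^+ i))) =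
    t ^+ k * (M * 2 ^+ k * 4 * t) * (2^-1 * (t ^+ i * 2 ^+ i)).
    have e4 : 4 * 2^-1 = 2 :> R by lra.
    move: (t ^+ k) (t ^+ i) (2 ^+ k) (2 ^+ i) (2^-1) e4 => A1 A2 A3 A4 h2 e4.
    have -> : A1 * (M * A3 * 4 * t) * (h2 * (A2 * A4)) =
      A1 * M * A3 * t * A2 * A4 * (4 * h2) by ring.
    by rewrite e4; ring.
  rewrite ler_wpM2l //; first by rewrite !mulr_ge0 ?exprn_ge0 ?(ltW t0).
  rewrite ler_wpM2l // -exprMn lerXn2r ?nnegrE ?mulr_ge0 ?(ltW t0) //.
  by lra.
rewrite -mulr_sumr -mulrA ler_wpM2l ?exprn_ge0 ?(ltW t0) //.
apply: (@le_trans _ _ (B * t * 1)); last by rewrite mulr1.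
rewrite ler_wpM2l ?mulr_ge0 ?(ltW t0) //.
suff -> : \sum_(i < n) (2^-1 ^+ i.+1 : R) = 1 - 2^-1 ^+ n.
  by rewrite gerBl exprn_ge0.
elim: n => [|n IHn]; first by rewrite big_ord0 expr0 subrr.
rewrite big_ord_recr /= IHn exprS; lra.
Qed.

End PowerSeries.

Section WienerAlgebra.
Context {R : realType}.
Local Notation C := (C R).

Lemma taylor_eq r s (F : C -> 'M[C]_(r, s)) a : is_taylor F a -> taylor F = a.
Proof.
move=> aF; have tF : is_taylor F (taylor F) by apply: xgetI aF.
apply/funext => n; apply/eqP; rewrite -subr_eq0; apply/eqP.
have h : (fun n => taylor F n - a n) = fun=> 0.
  apply: power_series_eq0 => z z1; rewrite -(subrr (F z)).
  have hs : has_sum (fun n => psterm (taylor F) z n - psterm a z n) (F z - F z).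
    by apply: has_sumB; [exact: tF|exact: aF].
  by apply: eq_has_sum hs => k; rewrite /psterm scalerBr.
by have /(congr1 (fun f => f n)) := h.
Qed.

Lemma wiener_coef_taylor_eq r s (F : C -> 'M[C]_(r, s)) a :
  wiener_coef a F -> taylor F = a.
Proof. by move=> /wiener_coef_taylor /taylor_eq. Qed.

Lemma is_taylor_ext r s (F K : C -> 'M[C]_(r, s)) a :
  (forall z, disc z -> F z = K z) -> is_taylor F a -> is_taylor K a.
Proof. by move=> FK aF z z1; rewrite -(FK z z1); exact: aF. Qed.

(** Continuity up to the circle comes for free: the coefficients are
    determined on the disc. *)
Lemma wiener_coef_disc_eq r s (F K : C -> 'M[C]_(r, s)) a b :
  wiener_coef a F -> wiener_coef b K -> (forall z, disc z -> F z = K z) ->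
  forall z, cdisc z -> F z = K z.
Proof.
move=> aF bK FK z z1; have ab : a = b.
  rewrite -(wiener_coef_taylor_eq bK); apply/esym/taylor_eq.
  exact: is_taylor_ext FK (wiener_coef_taylor aF).
by move: bK; rewrite -ab => bK; apply: has_sum_uniq (aF.2 z z1) (bK.2 z z1).
Qed.

Lemma wiener_coef_Hinf r s (F : C -> 'M[C]_(r, s)) a : wiener_coef a F -> Hinf F.
Proof.
move=> aF; split; first by exists a; exact: wiener_coef_taylor aF.
have [[M aM] aF'] := aF; exists M => z /disc_cdisc z1.
apply: has_sum_bound (aF' z z1) _.
by apply: bsum_le aM => i; exact: fnorm_psterm.
Qed.

Lemma asumD r s (a b : nat -> 'M[C]_(r, s)) :
  asum a -> asum b -> asum (fun n => a n + b n).
Proof.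
move=> [M aM] [N bN]; exists (M + N); apply: bsum_le (bsumD aM bN) => i.
exact: fnormD.
Qed.

Lemma asumMl r s t (A : 'M[C]_(r, s)) (a : nat -> 'M[C]_(s, t)) :
  asum a -> asum (fun n => A *m a n).
Proof.
move=> [M aM]; exists (fnorm A * M).
apply: bsum_le (bsumZ (fnorm_ge0 A) aM) => i; exact: fnormM.
Qed.

Lemma asumMr r s t (A : 'M[C]_(s, t)) (a : nat -> 'M[C]_(r, s)) :
  asum a -> asum (fun n => a n *m A).
Proof.
move=> [M aM]; exists (fnorm A * M).
by apply: bsum_le (bsumZ (fnorm_ge0 A) aM) => i; rewrite mulrC fnormM.
Qed.

Lemma wiener_coefMl r s t (A : 'M[C]_(r, s)) (a : nat -> 'M[C]_(s, t)) F :
  wiener_coef a F -> wiener_coef (fun n => A *m a n) (fun z => A *m F z).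
Proof.
move=> [aa aF]; split=> [|z z1]; first exact: asumMl.
have h := has_sumM A (aF z z1); apply: eq_has_sum h => n.
by rewrite /psterm -scalemxAr.
Qed.

Lemma wiener_coefMr r s t (A : 'M[C]_(s, t)) (a : nat -> 'M[C]_(r, s)) F :
  wiener_coef a F -> wiener_coef (fun n => a n *m A) (fun z => F z *m A).
Proof.
move=> [aa aF]; split=> [|z z1]; first exact: asumMr.
have h := has_sumMr A (aF z z1); apply: eq_has_sum h => n.
by rewrite /psterm -scalemxAl.
Qed.

Lemma wiener_coefD r s (a b : nat -> 'M[C]_(r, s)) F K :
  wiener_coef a F -> wiener_coef b K ->
  wiener_coef (fun n => a n + b n) (fun z => F z + K z).
Proof.
move=> [aa aF] [bb bK]; split=> [|z z1]; first exact: asumD.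
have h := has_sumD (aF z z1) (bK z z1).
by apply: eq_has_sum h => n; rewrite /psterm scalerDr.
Qed.

Lemma convol0 r s t (a : nat -> 'M[C]_(r, s)) (b : nat -> 'M[C]_(s, t)) :
  convol a b 0%N = a 0%N *m b 0%N.
Proof. by rewrite /convol big_ord_recl big_ord0 addr0. Qed.

Lemma convolS r s t (a : nat -> 'M[C]_(r, s)) (b : nat -> 'M[C]_(s, t)) n :
  convol a b n.+1 = a n.+1 *m b 0%N + convol a (fun i => b i.+1) n.
Proof. by rewrite /convol big_ord_recl subn0. Qed.

Lemma convolSl r s t (a : nat -> 'M[C]_(r, s)) (b : nat -> 'M[C]_(s, t)) n :
  convol a b n.+1 = convol (fun i => a i.+1) b n + a 0%N *m b n.+1.
Proof.
rewrite /convol big_ord_recr subnn /=; congr (_ + _); apply: eq_bigr => i _.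
by rewrite subSn // -ltnS.
Qed.

Lemma convolMr r s t u (a : nat -> 'M[C]_(r, s)) (b : nat -> 'M[C]_(s, t))
    (A : 'M[C]_(t, u)) n :
  convol a (fun i => b i *m A) n = convol a b n *m A.
Proof. by rewrite /convol mulmx_suml; apply: eq_bigr => i _; rewrite mulmxA. Qed.

Lemma convolDr r s t (a : nat -> 'M[C]_(r, s)) (b c : nat -> 'M[C]_(s, t)) n :
  convol a (fun i => b i + c i) n = convol a b n + convol a c n.
Proof.
by rewrite /convol -big_split; apply: eq_bigr => i _; rewrite mulmxDr.
Qed.

Lemma convolZr r s t (a : nat -> 'M[C]_(r, s)) (b : nat -> 'M[C]_(s, t)) z n :
  convol a (fun i => z *: b i) n = z *: convol a b n.
Proof.
by rewrite /convol scaler_sumr; apply: eq_bigr => i _; rewrite scalemxAr.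
Qed.

Lemma convolNr r s t (a : nat -> 'M[C]_(r, s)) (b : nat -> 'M[C]_(s, t)) n :
  convol a (fun i => - b i) n = - convol a b n.
Proof.
by rewrite /convol -sumrN; apply: eq_bigr => i _; rewrite mulmxN.
Qed.

(** Induction on the index, splitting off the first entry of [x]. *)
Lemma convolA r s t u (a : nat -> 'M[C]_(r, s)) (b : nat -> 'M[C]_(s, t))
    (x : nat -> 'M[C]_(t, u)) :
  convol a (convol b x) =1 convol (convol a b) x.
Proof.
move=> n; elim: n x => [|n IH] x; first by rewrite !convol0 mulmxA.
rewrite [RHS]convolS -IH -convolMr.
have -> : convol b x = fun i => b i *m x 0%N +
    (if i is j.+1 then convol b (fun i => x i.+1) j else 0).
  by apply/funext => -[|i]; rewrite ?convol0 ?addr0 // convolS.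
by rewrite convolDr; congr (_ + _); rewrite convolS /= mulmx0 add0r.
Qed.

Lemma wiener_coef_convol r s t (a : nat -> 'M[C]_(r, s)) (b : nat -> 'M[C]_(s, t)) F K :
  wiener_coef a F -> wiener_coef b K -> wiener_coef (convol a b) (fun z => F z *m K z).
Proof.
move=> [[M aM] aF] [[N bN] bK].
(* the product array, indexed by the index in b and then by the total degree *)
pose c z i n := if (i <= n)%N then psterm a z (n - i)%N *m psterm b z i else 0.
have convolE z n : has_sum ((c z)^~ n) (psterm (convol a b) z n).
  have -> : psterm (convol a b) z n = \sum_(i < n.+1) c z i n.
    rewrite /psterm /convol scaler_sumr; apply: eq_bigr => -[i iln] _.
    rewrite /c /= -ltnS iln /psterm -scalemxAl -scalemxAr scalerA -exprD.
    by rewrite subnK.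
  by apply: has_sum_fin => i ni; rewrite /c leqNgt ni.
have M0 := bsum_ge0 aM.
have cb z i : cdisc z -> bsum (fun n => fnorm (c z i n)) (M * fnorm (b i)).
  move=> z1 n; apply: (@le_trans _ _ (\sum_(k < i + n) fnorm (c z i k))).
    apply: (@ler_sum_widen _ (fun k => fnorm (c z i k))); last exact: leq_addl.
    by move=> j; exact: fnorm_ge0.
  rewrite (@sum_addn _ (fun k => fnorm (c z i k))) big1 ?add0r => [|[k ki] _]; last first.
    by rewrite /c /= leqNgt ki fnorm0.
  apply: (@le_trans _ _ (\sum_(k < n) fnorm (a k) * fnorm (b i))).
    apply: ler_sum => k _; rewrite /c leq_addr addKn.
    apply: le_trans (fnormM _ _) _.
    by rewrite ler_pM ?fnorm_ge0 // fnorm_psterm.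
  by rewrite -mulr_suml ler_wpM2r ?fnorm_ge0.
have MN := bsumZ M0 bN.
split=> [|z z1].
  have z1 : cdisc (1 : C) by apply/cdisc_cmod; rewrite cmod1.
  exists (M * N); apply: bsum_le (bsum_exchange (fun i => cb 1 i z1) MN (convolE 1)).
  by move=> n; rewrite /psterm expr1n scale1r.
apply: (has_sum_exchange (fun i => cb z i z1) MN _ (convolE z)).
- move=> i; have h := has_sumMr (psterm b z i) (aF z z1).
  have := @has_sum_addn _ _ _ (c z i) (F z *m psterm b z i) i.
  rewrite big1 ?add0r => [|[k ki] _]; last by rewrite /c /= leqNgt ki.
  by apply; apply: eq_has_sum h => n; rewrite /c leq_addr addKn.
- exact: (has_sumM (F z) (bK z z1)).
Qed.

End WienerAlgebra.

(** * Square summable sequences *)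

Section L2.
Context {R : realType}.
Local Notation C := (C R).

Definition l2le (f : nat -> R) (M : R) :=
  forall n, Num.sqrt (\sum_(i < n) f i ^+ 2) <= M.

Lemma l2le_ge0 f M : l2le f M -> 0 <= M.
Proof. by move=> /(_ 0%N); apply: le_trans; exact: sqrtr_ge0. Qed.

Lemma l2leP f M : 0 <= M -> l2le f M <-> bsum (fun i => f i ^+ 2) (M ^+ 2).
Proof.
move=> M0; split=> h n; last first.
  by rewrite -(ger0_norm M0) -sqrtr_sqr ler_wsqrtr.
by rewrite -[leLHS]sqr_sqrtr ?sum_sqr_ge0 // lerXn2r ?nnegrE ?sqrtr_ge0.
Qed.

Lemma l2le_mono f g M : (forall i, 0 <= f i <= g i) -> l2le g M -> l2le f M.
Proof. by move=> fg gM n; apply: le_trans (gM n); exact: ler_sqrt_sum. Qed.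

Lemma l2leW f M N : M <= N -> l2le f M -> l2le f N.
Proof. by move=> MN fM n; apply: le_trans MN. Qed.

Lemma l2leD f g M N : l2le f M -> l2le g N -> l2le (fun i => f i + g i) (M + N).
Proof.
by move=> fM gN n; apply: le_trans (minkowski_sum _ _ _ _) _; rewrite lerD.
Qed.

Lemma l2leZ f M c : 0 <= c -> l2le f M -> l2le (fun i => c * f i) (c * M).
Proof.
move=> c0 fM n; under eq_bigr do rewrite exprMn.
by rewrite -mulr_sumr sqrtrM ?sqr_ge0 // sqrtr_sqr ger0_norm // ler_wpM2l.
Qed.

Lemma l2le_addn f M k : l2le f M -> l2le (fun i => f (k + i)%N) M.
Proof.
move=> fM n; apply: le_trans (fM (k + n)%N).
by rewrite ler_wsqrtr // (@sum_addn _ (fun i => f i ^+ 2)) lerDr sum_sqr_ge0.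
Qed.

Lemma l2le_subn f M k : l2le f M ->
  l2le (fun i => if (k <= i)%N then f (i - k)%N else 0) M.
Proof.
move=> fM n; apply: le_trans (fM n); rewrite ler_wsqrtr //.
apply: (@le_trans _ _ (\sum_(i < k + n)
    (if (k <= i)%N then f (i - k)%N else 0) ^+ 2)).
  apply: (@ler_sum_widen _ (fun i => (if (k <= i)%N then f (i - k)%N else 0) ^+ 2)).
    by move=> i; exact: sqr_ge0.
  exact: leq_addl.
rewrite (@sum_addn _ (fun i => (if (k <= i)%N then f (i - k)%N else 0) ^+ 2)).
rewrite big1 ?add0r => [|[i ik] _]; last by rewrite /= leqNgt ik expr0n.
by apply: ler_sum => i _; rewrite leq_addr addKn.
Qed.

Lemma sqrt_sum_le n (f : 'I_n -> R) : (forall i, 0 <= f i) ->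
  Num.sqrt (\sum_(i < n) f i ^+ 2) <= \sum_(i < n) f i.
Proof.
move=> f0; elim: n f f0 => [|n IH] f f0; first by rewrite !big_ord0 sqrtr0.
rewrite !big_ord_recr /= -(sqr_sqrtr (sum_sqr_ge0 _ _ _)).
have := IH (fun i => f (widen_ord (leqnSn n) i)) (fun i => f0 _).
set s := Num.sqrt _ => IHs.
have s0 : 0 <= s by exact: sqrtr_ge0.
apply: (@le_trans _ _ (s + f ord_max)); last by rewrite lerD2r.
rewrite -[leRHS]ger0_norm ?addr_ge0 // -[leRHS]sqrtr_sqr ler_wsqrtr //.
by rewrite sqrrD -addrA lerD2l lerDr mulrn_wge0 ?mulr_ge0.
Qed.

Lemma bsum_l2le f M : (forall i, 0 <= f i) -> bsum f M -> l2le f M.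
Proof. by move=> f0 fM n; apply: le_trans (fM n); exact: sqrt_sum_le. Qed.

(** Minkowski's inequality for countably many summands. Toeplitz operators are
    sums over their diagonals [d], and each diagonal produces a shifted copy of
    the argument scaled by one coefficient, whence their bounds. *)
Lemma l2le_has_sum r s (T : nat -> nat -> 'M[C]_(r, s)) x (F : nat -> nat -> R) S M :
  (forall i, has_sum (T i) (x i)) -> (forall i d, fnorm (T i d) <= F d i) ->
  (forall d, l2le (F d) (S d)) -> bsum S M ->
  l2le (fun i => fnorm (x i)) M.
Proof.
move=> hT TF FS SM n; apply/ler_addgt0Pl => e e0.
have : \sum_(i < n) fnorm (\sum_(d < D) T i d - x i) @[D --> \oo] -->
    \sum_(i < n) (0 : R).
  by apply: cvg_sumr => i; have /has_sumP := hT i.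
rewrite big1_eq => /cvgrPdist_le /(_ _ e0) [D _ /(_ D (leqnn D))].
rewrite sub0r normrN ger0_norm; last first.
  by apply: sumr_ge0 => j _; exact: fnorm_ge0.
move=> h.
apply: (@le_trans _ _ (Num.sqrt (\sum_(i < n)
    (fnorm (\sum_(d < D) T i d - x i) + fnorm (\sum_(d < D) T i d)) ^+ 2))).
  apply: ler_sqrt_sum => i _; rewrite fnorm_ge0 /=.
  have {1}-> : x i = \sum_(d < D) T i d - (\sum_(d < D) T i d - x i).
    by apply/matrixP => a b; rewrite !mxE; ring.
  by rewrite [leRHS]addrC; exact: fnormB.
apply: le_trans (minkowski_sum _ _ _ _) _; rewrite lerD //.
  by apply: le_trans h; apply: sqrt_sum_le => i; exact: fnorm_ge0.
apply: le_trans (SM D).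
apply: (@le_trans _ _ (Num.sqrt (\sum_(i < n) (\sum_(d < D) F d i) ^+ 2))).
  apply: ler_sqrt_sum => i _; rewrite fnorm_ge0 /=.
  by apply: le_trans (fnorm_sum _ _ _) _; apply: ler_sum.
elim: (D) => [|k IH].
  by under eq_bigr do rewrite big_ord0 expr0n; rewrite big1 ?sqrtr0 ?big_ord0.
rewrite big_ord_recr /=; under eq_bigr do rewrite big_ord_recr /=.
by apply: le_trans (minkowski_sum _ _ _ _) _; rewrite lerD //; exact: FS.
Qed.

Implicit Types (n : nat).

Lemma l2norm_ge0 n (x : nat -> 'cV[C]_n) : 0 <= l2norm x.
Proof. exact: sqrtr_ge0. Qed.

Lemma ell2_l2le n (x : nat -> 'cV[C]_n) : ell2 x ->
  l2le (fun i => fnorm (x i)) (l2norm x).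
Proof.
move=> ex k; rewrite /l2norm ler_wsqrtr //.
by apply: (cvg_bsum _ ex) => i; exact: sqr_ge0.
Qed.

Lemma l2le_ell2 n (x : nat -> 'cV[C]_n) M :
  l2le (fun i => fnorm (x i)) M -> ell2 x.
Proof.
move=> xM; have /l2leP := xM => /(_ (l2le_ge0 xM)).
by apply: bsum_cvg => i; exact: sqr_ge0.
Qed.

Lemma l2norm_le n (x : nat -> 'cV[C]_n) M :
  l2le (fun i => fnorm (x i)) M -> l2norm x <= M.
Proof.
move=> xM; have M0 := l2le_ge0 xM; have /l2leP := xM => /(_ M0) h.
rewrite /l2norm -(ger0_norm M0) -sqrtr_sqr ler_wsqrtr //.
by apply: bsum_lim h => i; exact: sqr_ge0.
Qed.

Lemma l2norm_sqr n (x : nat -> 'cV[C]_n) : ell2 x ->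
  l2norm x ^+ 2 = limn (series (fun i => fnorm (x i) ^+ 2)).
Proof.
move=> ex; rewrite /l2norm sqr_sqrtr //; apply: limr_ge => //.
by apply: nearW => k; rewrite seriesE sum_sqr_ge0.
Qed.

Lemma fnorm_le_l2norm n (x : nat -> 'cV[C]_n) i : ell2 x -> fnorm (x i) <= l2norm x.
Proof.
move=> /ell2_l2le /(_ i.+1); apply: le_trans.
rewrite -[leLHS]ger0_norm ?fnorm_ge0 // -sqrtr_sqr ler_wsqrtr //.
by rewrite big_ord_recr /= lerDr sum_sqr_ge0.
Qed.

Lemma l2norm_eq0 n (x : nat -> 'cV[C]_n) : ell2 x -> l2norm x <= 0 -> x = fun=> 0.
Proof.
move=> ex x0; apply/funext => i; apply: fnorm_eq0; apply/le_anti.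
by rewrite fnorm_ge0 andbT (le_trans (fnorm_le_l2norm i ex)).
Qed.

Lemma ell2D n (x y : nat -> 'cV[C]_n) : ell2 x -> ell2 y ->
  ell2 (fun i => x i + y i) /\ l2norm (fun i => x i + y i) <= l2norm x + l2norm y.
Proof.
move=> /ell2_l2le ex /ell2_l2le ey; have h := l2leD ex ey.
have {}h : l2le (fun i => fnorm (x i + y i)) (l2norm x + l2norm y).
  by apply: l2le_mono h => i; rewrite fnorm_ge0 fnormD.
by split; [exact: l2le_ell2 h|exact: l2norm_le].
Qed.

Lemma ell2Z n z (x : nat -> 'cV[C]_n) : ell2 x ->
  ell2 (fun i => z *: x i) /\ l2norm (fun i => z *: x i) <= cmod z * l2norm x.
Proof.
move=> /ell2_l2le ex; have h := l2leZ (cmod_ge0 z) ex.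
have {}h : l2le (fun i => fnorm (z *: x i)) (cmod z * l2norm x).
  by apply: l2le_mono h => i; rewrite fnorm_ge0 fnormZ lexx.
by split; [exact: l2le_ell2 h|exact: l2norm_le].
Qed.

Lemma ell2N n (x : nat -> 'cV[C]_n) : ell2 x ->
  ell2 (fun i => - x i) /\ l2norm (fun i => - x i) = l2norm x.
Proof.
move=> ex; have -> : l2norm (fun i => - x i) = l2norm x.
  by rewrite /l2norm; under eq_fun do rewrite fnormN.
by split=> //; rewrite /ell2 /=; under eq_fun do rewrite fnormN.
Qed.

Lemma ell2B n (x y : nat -> 'cV[C]_n) : ell2 x -> ell2 y ->
  ell2 (fun i => x i - y i) /\ l2norm (fun i => x i - y i) <= l2norm x + l2norm y.
Proof.
move=> ex /ell2N [ey <-]; exact: ell2D.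
Qed.

Lemma ell2_0 n : ell2 (fun=> 0 : 'cV[C]_n).
Proof.
apply: (@l2le_ell2 _ _ 0) => k.
by rewrite big1 ?sqrtr0 // => i _; rewrite fnorm0 expr0n.
Qed.

Lemma l2norm0 n : l2norm (fun=> 0 : 'cV[C]_n) = 0.
Proof.
apply/le_anti; rewrite l2norm_ge0 andbT; apply: l2norm_le => k.
by rewrite big1 ?sqrtr0 // => i _; rewrite fnorm0 expr0n.
Qed.

Lemma asum_ell2 n (x : nat -> 'cV[C]_n) : asum x -> ell2 x.
Proof.
move=> [M xM]; apply: (@l2le_ell2 _ _ M); apply: bsum_l2le xM => i.
exact: fnorm_ge0.
Qed.

Lemma ell2_addn n (x : nat -> 'cV[C]_n) k : ell2 x -> ell2 (fun i => x (k + i)%N).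
Proof. by move=> /ell2_l2le /(l2le_addn k) /l2le_ell2. Qed.

Lemma l2norm_addn n (x : nat -> 'cV[C]_n) k : ell2 x ->
  l2norm (fun i => x (k + i)%N) <= l2norm x.
Proof. by move=> /ell2_l2le /(l2le_addn k) /l2norm_le. Qed.

Lemma l2norm_split n (x : nat -> 'cV[C]_n) k : ell2 x ->
  l2norm x ^+ 2 = \sum_(i < k) fnorm (x i) ^+ 2 + l2norm (fun i => x (k + i)%N) ^+ 2.
Proof.
move=> ex; have esx := @ell2_addn _ _ k ex; rewrite !l2norm_sqr //.
apply/cvg_lim => //; rewrite -(cvg_shiftn k) /=.
have : \sum_(i < k) fnorm (x i) ^+ 2 + series (fun i => fnorm (x (k + i)%N) ^+ 2) j
   @[j --> \oo] --> \sum_(i < k) fnorm (x i) ^+ 2 +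
    limn (series (fun i => fnorm (x (k + i)%N) ^+ 2)).
  by apply: cvgD => //; exact: cvg_cst.
apply: cvg_trans; apply: near_eq_cvg; apply: nearW => j.
by rewrite !seriesE addnC (@sum_addn _ (fun i => fnorm (x i) ^+ 2)).
Qed.

Lemma l2norm_tail n (x : nat -> 'cV[C]_n) e : ell2 x -> 0 < e ->
  exists k, l2norm (fun i => x (k + i)%N) <= e.
Proof.
move=> ex e0; have xM : bsum (fun i => fnorm (x i) ^+ 2) (l2norm x ^+ 2).
  by apply/l2leP; [exact: l2norm_ge0|exact: ell2_l2le].
have [//|k hk] := bsum_tail _ xM (exprn_gt0 2 e0).
  by move=> i; exact: sqr_ge0.
exists k; apply: l2norm_le; apply/l2leP => //; exact: ltW.
Qed.

End L2.

Section Dot.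
Context {R : realType}.
Local Notation C := (C R).
Implicit Types (n : nat).

Definition dotterm n (x y : nat -> 'cV[C]_n) i := (y i)^t* *m x i.

Lemma bsum_dotterm n (x y : nat -> 'cV[C]_n) : ell2 x -> ell2 y ->
  bsum (fun i => fnorm (dotterm x y i)) (l2norm x * l2norm y).
Proof.
move=> /ell2_l2le ex /ell2_l2le ey k.
apply: (@le_trans _ _ (\sum_(i < k) fnorm (x i) * fnorm (y i))).
  apply: ler_sum => i _; apply: le_trans (fnormM _ _) _.
  by rewrite fnorm_adj mulrC.
apply: le_trans (cauchy_schwarz_sum _ _ _ _) _.
by rewrite ler_pM ?sqrtr_ge0.
Qed.

Lemma l2dot_eq n (x y : nat -> 'cV[C]_n) l :
  has_sum (dotterm x y) l -> l2dot x y = l 0 0.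
Proof.
move=> /has_sumP hl; apply: cvg_lim; first exact: norm_hausdorff.
apply/cvgrPdist_le => e e0.
have eR : e = ((complex.Re e)%:C)%C by rewrite complex.RRe_real // gtr0_real.
have {}e0 : 0 < complex.Re e by move: e0; rewrite eR ltcR.
move/cvgrPdist_le : hl => /(_ _ e0); apply: filterS => k.
rewrite sub0r normrN ger0_norm ?fnorm_ge0 // => h.
rewrite eR distrC norm_cmod lecR; apply: le_trans h.
have := cmod_le_fnorm (\sum_(i < k) dotterm x y i - l) 0 0.
by rewrite !mxE summxE seriesE.
Qed.

Lemma has_sum_dot n (x y : nat -> 'cV[C]_n) : ell2 x -> ell2 y ->
  has_sum (dotterm x y) (l2dot x y)%:M.
Proof.
move=> ex ey; have h : has_sum (dotterm x y) (vsum (dotterm x y)).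
  by apply: asum_has_sum; exists (l2norm x * l2norm y); exact: bsum_dotterm.
have -> : (l2dot x y)%:M = vsum (dotterm x y); last by [].
by rewrite (l2dot_eq h) [RHS]mx11_scalar.
Qed.

Lemma l2dot_eqM n (x y : nat -> 'cV[C]_n) z :
  has_sum (dotterm x y) z%:M -> l2dot x y = z.
Proof. by move=> /l2dot_eq ->; rewrite mxE eqxx mulr1n. Qed.

Lemma l2dot_cmod n (x y : nat -> 'cV[C]_n) : ell2 x -> ell2 y ->
  cmod (l2dot x y) <= l2norm x * l2norm y.
Proof.
move=> ex ey; have := has_sum_bound (has_sum_dot ex ey) (bsum_dotterm ex ey).
by rewrite fnorm_mx11 mxE eqxx mulr1n.
Qed.

Lemma l2dotDl n (x x' y : nat -> 'cV[C]_n) : ell2 x -> ell2 x' -> ell2 y ->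
  l2dot (fun i => x i + x' i) y = l2dot x y + l2dot x' y.
Proof.
move=> ex ex' ey; apply: l2dot_eqM; rewrite raddfD /=.
have h := has_sumD (has_sum_dot ex ey) (has_sum_dot ex' ey).
by apply: eq_has_sum h => i; rewrite /dotterm mulmxDr.
Qed.

Lemma l2dotZl n z (x y : nat -> 'cV[C]_n) : ell2 x -> ell2 y ->
  l2dot (fun i => z *: x i) y = z * l2dot x y.
Proof.
move=> ex ey; apply: l2dot_eqM; rewrite -scale_scalar_mx.
have h := has_sumZ z (has_sum_dot ex ey).
by apply: eq_has_sum h => i; rewrite /dotterm -scalemxAr.
Qed.

Lemma l2dotC n (x y : nat -> 'cV[C]_n) : ell2 x -> ell2 y ->
  l2dot y x = (l2dot x y)^*.
Proof.
move=> ex ey; have h := has_sum_adj (has_sum_dot ex ey).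
have /l2dot_eq -> : has_sum (dotterm y x) (((l2dot x y)%:M)^t*).
  apply: eq_has_sum h => i; rewrite /dotterm trmx_mul map_mxM /=.
  by congr (_ *m _); apply/matrixP => a b; rewrite !mxE conjCK.
by rewrite !mxE eqxx mulr1n.
Qed.

Lemma l2dotNl n (x y : nat -> 'cV[C]_n) : ell2 x -> ell2 y ->
  l2dot (fun i => - x i) y = - l2dot x y.
Proof.
move=> ex ey; rewrite -mulN1r -(l2dotZl (-1) ex ey).
by under [in RHS]eq_fun do rewrite scaleN1r.
Qed.

Lemma l2dotBl n (x x' y : nat -> 'cV[C]_n) : ell2 x -> ell2 x' -> ell2 y ->
  l2dot (fun i => x i - x' i) y = l2dot x y - l2dot x' y.
Proof.
move=> ex ex' ey; rewrite -(l2dotNl ex' ey); apply: l2dotDl => //.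
by have [] := ell2N ex'.
Qed.

Lemma l2dotDr n (x y y' : nat -> 'cV[C]_n) : ell2 x -> ell2 y -> ell2 y' ->
  l2dot x (fun i => y i + y' i) = l2dot x y + l2dot x y'.
Proof.
move=> ex ey ey'; have [eyy _] := ell2D ey ey'.
by rewrite (l2dotC eyy ex) l2dotDl // rmorphD /= -!l2dotC.
Qed.

Lemma l2dotZr n z (x y : nat -> 'cV[C]_n) : ell2 x -> ell2 y ->
  l2dot x (fun i => z *: y i) = z^* * l2dot x y.
Proof.
move=> ex ey; have [ezy _] := ell2Z z ey.
by rewrite (l2dotC ezy ex) l2dotZl // rmorphM /= -!l2dotC.
Qed.

Lemma l2dotBr n (x y y' : nat -> 'cV[C]_n) : ell2 x -> ell2 y -> ell2 y' ->
  l2dot x (fun i => y i - y' i) = l2dot x y - l2dot x y'.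
Proof.
move=> ex ey ey'; have [eyy _] := ell2B ey ey'.
by rewrite (l2dotC eyy ex) l2dotBl // rmorphB /= -!l2dotC.
Qed.

Lemma l2dot_self n (x : nat -> 'cV[C]_n) : ell2 x ->
  l2dot x x = ((l2norm x ^+ 2)%:C)%C.
Proof.
move=> ex; apply: l2dot_eqM; apply/has_sumP.
set l := limn (series (fun i => fnorm (x i) ^+ 2)).
have : `|l - series (fun i => fnorm (x i) ^+ 2) k| @[k --> \oo] --> `|l - l|.
  by apply: cvg_norm; apply: cvgB => //; exact: cvg_cst.
rewrite subrr normr0.
apply: cvg_trans; apply: near_eq_cvg; apply: nearW => k.
rewrite fnorm_mx11 !mxE eqxx mulr1n l2norm_sqr // summxE distrC -/l.
rewrite -cmod_real rmorphB /= seriesE rmorph_sum /=; congr (cmod (_ - _)).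
by apply: eq_bigr => i _; rewrite fnorm_sqr_col.
Qed.

Lemma l2dot_inj n (x y : nat -> 'cV[C]_n) :  ell2 x -> ell2 y ->
  (forall w, ell2 w -> l2dot w x = l2dot w y) -> x = y.
Proof.
move=> ex ey xy; have [exy _] := ell2B ex ey.
have : l2dot (fun i => x i - y i) (fun i => x i - y i) = 0.
  by rewrite l2dotBr // xy // subrr.
rewrite l2dot_self // => -[/eqP]; rewrite sqrf_eq0 => /eqP h.
have {}h : (fun i => x i - y i) = (fun=> 0) by apply: l2norm_eq0 => //; rewrite h.
by apply/funext => i; apply/eqP; rewrite -subr_eq0; have /(congr1 (@^~ i)) /= -> := h.
Qed.

Lemma l2dot0l n (y : nat -> 'cV[C]_n) : l2dot (fun=> 0) y = 0.
Proof.
have h : has_sum (dotterm (fun=> 0) y) 0.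
  by have := @has_sum0 R 1 1; apply: eq_has_sum => i; rewrite /dotterm mulmx0.
by rewrite (l2dot_eq h) mxE.
Qed.

Lemma ell2_embed n (u : 'cV[C]_n) : ell2 (embed u).
Proof.
apply: asum_ell2; exists (fnorm u) => -[|k]; first by rewrite big_ord0 fnorm_ge0.
by rewrite big_ord_recl big1 ?addr0 //= => i _; rewrite fnorm0.
Qed.

Lemma l2dot_embedr n u (x : nat -> 'cV[C]_n) : ell2 x ->
  l2dot x (embed u) = (u^t* *m x 0%N) 0 0.
Proof.
move=> ex; apply: l2dot_eq; have h : has_sum (dotterm x (embed u))
    (\sum_(i < 1) dotterm x (embed u) i).
  apply: has_sum_fin => -[|i] // _; rewrite /dotterm /=.
  by rewrite trmx0 map_mx0 mul0mx.
by rewrite big_ord1 in h.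
Qed.

Lemma ell2_shift n (x : nat -> 'cV[C]_n) : ell2 x -> ell2 (shiftop x).
Proof.
move=> /ell2_l2le /(l2le_subn 1) h; apply: (@l2le_ell2 _ _ _ (l2norm x)).
apply: l2le_mono h => i; rewrite fnorm_ge0 /=.
by case: i => [|i] /=; rewrite ?fnorm0 // subn1.
Qed.

Lemma l2dot_shift n (x y : nat -> 'cV[C]_n) : ell2 x -> ell2 y ->
  l2dot (shiftop x) y = l2dot x (fun i => y i.+1).
Proof.
move=> ex ey; apply: l2dot_eqM.
have ey1 : ell2 (fun i => y i.+1) := @ell2_addn _ _ _ 1 ey.
have h := has_sum_dot ex ey1.
have h1 := @has_sum_shift _ _ _ (dotterm (shiftop x) y) _ h.
have h2 : dotterm (shiftop x) y 0%N = 0 by rewrite /dotterm mulmx0.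
by rewrite h2 add0r in h1.
Qed.

Lemma l2normD_orth n (x y : nat -> 'cV[C]_n) : ell2 x -> ell2 y ->
  l2dot x y = 0 ->
  l2norm (fun i => x i + y i) ^+ 2 = l2norm x ^+ 2 + l2norm y ^+ 2.
Proof.
move=> ex ey xy; have [exy _] := ell2D ex ey.
have : l2dot (fun i => x i + y i) (fun i => x i + y i) = l2dot x x + l2dot y y.
  rewrite (l2dotDl ex ey exy) (l2dotDr ex ex ey) (l2dotDr ey ex ey).
  by rewrite (l2dotC ex ey) xy rmorph0 addr0 add0r.
by rewrite !l2dot_self // -rmorphD => -[].
Qed.

Lemma l2norm_shift n (x : nat -> 'cV[C]_n) : ell2 x ->
  l2norm (shiftop x) = l2norm x.
Proof.
move=> ex; have esx := ell2_shift ex.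
have : l2dot (shiftop x) (shiftop x) = l2dot x x by rewrite l2dot_shift.
by rewrite !l2dot_self // => -[] /eqP; rewrite eqrXn2 ?l2norm_ge0 // => /eqP.
Qed.

End Dot.

(** * Toeplitz operators and their adjoints *)

Section Toeplitz.
Context {R : realType}.
Local Notation C := (C R).
Variables (m p : nat) (g : nat -> 'M[C]_(m, p)) (N : R).
Hypothesis gN : bsum (fun d => fnorm (g d)) N.

Lemma convolE_diag (x : nat -> 'cV[C]_p) n :
  convol g x n = \sum_(d < n.+1) g d *m x (n - d)%N.
Proof.
rewrite /convol (reindex_inj rev_ord_inj) /=; apply: eq_bigr => i _.
by rewrite subSS subKn // -ltnS.
Qed.

Lemma has_sum_convol (x : nat -> 'cV[C]_p) n :
  has_sum (fun d => if (d <= n)%N then g d *m x (n - d)%N else 0) (convol g x n).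
Proof.
have h : has_sum (fun d => if (d <= n)%N then g d *m x (n - d)%N else 0)
    (\sum_(d < n.+1) if (d <= n)%N then g d *m x (n - d)%N else 0).
  by apply: has_sum_fin => i ni; rewrite leqNgt ni.
have -> // : convol g x n =
    \sum_(d < n.+1) if (d <= n)%N then g d *m x (n - d)%N else 0.
by rewrite convolE_diag; apply: eq_bigr => -[i /= iln] _; rewrite -ltnS iln.
Qed.

Arguments has_sum_convol : clear implicits.

Lemma convol_l2 (x : nat -> 'cV[C]_p) : ell2 x ->
  ell2 (convol g x) /\ l2norm (convol g x) <= N * l2norm x.
Proof.
move=> ex; suff h : l2le (fun i => fnorm (convol g x i)) (N * l2norm x).
  by split; [exact: l2le_ell2 h|exact: l2norm_le].
have := (@l2le_has_sum _ _ _ _ _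
   (fun d i => fnorm (g d) * (if (d <= i)%N then fnorm (x (i - d)%N) else 0))
   (fun d => fnorm (g d) * l2norm x) (N * l2norm x) (has_sum_convol x)).
apply.
- move=> i d; case: ifP => _; first exact: fnormM.
  by rewrite fnorm0 mulr0.
- move=> d; apply: l2leZ; first exact: fnorm_ge0.
  exact: (@l2le_subn _ (fun i => fnorm (x i)) _ _ (ell2_l2le ex)).
by move=> n; rewrite -mulr_suml ler_wpM2r ?l2norm_ge0.
Qed.

(** The adjoint of the Toeplitz operator of [g], see [l2dot_convol]. *)
Definition toepadj (y : nat -> 'cV[C]_m) j : 'cV[C]_p :=
  vsum (fun d => (g d)^t* *m y (j + d)%N).

Lemma bsum_toepadj (y : nat -> 'cV[C]_m) j : ell2 y ->
  bsum (fun d => fnorm ((g d)^t* *m y (j + d)%N)) (N * l2norm y).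
Proof.
move=> ey n; apply: (@le_trans _ _ (\sum_(d < n) fnorm (g d) * l2norm y)).
  apply: ler_sum => d _; apply: le_trans (fnormM _ _) _.
  by rewrite fnorm_adj ler_wpM2l ?fnorm_ge0 // fnorm_le_l2norm.
by rewrite -mulr_suml ler_wpM2r ?l2norm_ge0.
Qed.

Lemma has_sum_toepadj (y : nat -> 'cV[C]_m) j : ell2 y ->
  has_sum (fun d => (g d)^t* *m y (j + d)%N) (toepadj y j).
Proof.
move=> ey; apply: asum_has_sum; exists (N * l2norm y); exact: bsum_toepadj.
Qed.

Arguments has_sum_toepadj y j _ : clear implicits.

Lemma toepadj_l2 (y : nat -> 'cV[C]_m) : ell2 y ->
  ell2 (toepadj y) /\ l2norm (toepadj y) <= N * l2norm y.
Proof.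
move=> ey; suff h : l2le (fun i => fnorm (toepadj y i)) (N * l2norm y).
  by split; [exact: l2le_ell2 h|exact: l2norm_le].
have := (@l2le_has_sum _ _ _ _ _
   (fun d i => fnorm (g d) * fnorm (y (d + i)%N))
   (fun d => fnorm (g d) * l2norm y) (N * l2norm y)
   (fun i => has_sum_toepadj y i ey)).
apply.
- by move=> i d; apply: le_trans (fnormM _ _) _; rewrite fnorm_adj addnC.
- move=> d; apply: l2leZ; first exact: fnorm_ge0.
  exact: (@l2le_addn _ (fun i => fnorm (y i)) _ _ (ell2_l2le ey)).
by move=> n; rewrite -mulr_suml ler_wpM2r ?l2norm_ge0.
Qed.

(** Both sides are the sum over all diagonals [d] of the inner products of
    [g d] applied to [x] with [y] shifted back by [d]. *)
Lemma l2dot_convol (x : nat -> 'cV[C]_p) (y : nat -> 'cV[C]_m) :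
  ell2 x -> ell2 y -> l2dot (convol g x) y = l2dot x (toepadj y).
Proof.
move=> ex ey.
have ey' d : ell2 (fun i => y (d + i)%N) by exact: ell2_addn.
pose gx d i := g d *m x i.
have gxle d : l2le (fun i => fnorm (gx d i)) (fnorm (g d) * l2norm x).
  apply: l2le_mono (l2leZ (fnorm_ge0 (g d)) (ell2_l2le ex)) => i.
  by rewrite fnorm_ge0 fnormM.
have egx d : ell2 (gx d) by exact: l2le_ell2 (gxle d).
pose al d := (l2dot (gx d) (fun i => y (d + i)%N))%:M : 'M[C]_1.
pose b d := fnorm (g d) * l2norm x * l2norm y.
have bM : bsum b (N * l2norm x * l2norm y).
  by move=> n; rewrite -!mulr_suml !ler_wpM2r ?l2norm_ge0.
pose a d i := dotterm (gx d) (fun i => y (d + i)%N) i.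
have ab d : bsum (fun i => fnorm (a d i)) (b d).
  move=> n; apply: le_trans (bsum_dotterm (egx d) (ey' d) n) _.
  rewrite ler_pM ?l2norm_ge0 //; first exact: l2norm_le.
  exact: l2norm_addn.
have hal d : has_sum (a d) (al d) by exact: has_sum_dot.
have [L hL] : exists L, has_sum al L.
  exists (vsum al); apply: asum_has_sum; exists (N * l2norm x * l2norm y).
  by apply: bsum_le bM => d; exact: has_sum_bound (hal d) (ab d).
have -> : l2dot x (toepadj y) = L 0 0.
  apply: l2dot_eq; apply: (has_sum_exchange ab bM hal _ hL) => i.
  have h := has_sumMr (x i) (has_sum_adj (has_sum_toepadj y i ey)).
  apply: eq_has_sum h => d; rewrite /a /dotterm trmx_mul map_mxM /= addnC.
  rewrite -mulmxA; congr (_ *m _); rewrite /gx; congr (_ *m _).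
  by apply/matrixP => u v; rewrite !mxE conjCK.
pose a' d i := if (d <= i)%N then (y i)^t* *m (g d *m x (i - d)%N) else 0.
have ab' d : bsum (fun i => fnorm (a' d i)) (b d).
  move=> n; apply: (@le_trans _ _ (\sum_(i < d + n) fnorm (a' d i))).
    apply: (@ler_sum_widen _ (fun i => fnorm (a' d i))); last exact: leq_addl.
    by move=> i; exact: fnorm_ge0.
  rewrite (@sum_addn _ (fun i => fnorm (a' d i))) big1 ?add0r.
    apply: le_trans (ab d n); apply: ler_sum => i _.
    by rewrite /a' leq_addr addKn.
  by move=> [i id] _; rewrite /a' /= leqNgt id fnorm0.
have hal' d : has_sum (a' d) (al d).
  have := @has_sum_addn _ _ _ (a' d) (al d) d.
  rewrite big1 ?add0r => [|[i id] _]; last by rewrite /a' /= leqNgt id.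
  by apply; have := hal d; apply: eq_has_sum => i; rewrite /a' leq_addr addKn.
apply: l2dot_eq; apply: (has_sum_exchange ab' bM hal' _ hL) => i.
have h := has_sumM ((y i)^t*) (has_sum_convol x i).
by apply: eq_has_sum h => d; rewrite /a'; case: ifP => //; rewrite mulmx0.
Qed.

Lemma toepadjD (y y' : nat -> 'cV[C]_m) j : ell2 y -> ell2 y' ->
  toepadj (fun i => y i + y' i) j = toepadj y j + toepadj y' j.
Proof.
move=> ey ey'; apply: vsumE.
have h := has_sumD (has_sum_toepadj y j ey) (has_sum_toepadj y' j ey').
by apply: eq_has_sum h => i; rewrite mulmxDr.
Qed.

Lemma toepadjZ z (y : nat -> 'cV[C]_m) j : ell2 y ->
  toepadj (fun i => z *: y i) j = z *: toepadj y j.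
Proof.
move=> ey; apply: vsumE; have h := has_sumZ z (has_sum_toepadj y j ey).
by apply: eq_has_sum h => i; rewrite scalemxAr.
Qed.

(** Continuity of the adjoint along series that converge absolutely in norm. *)
Lemma toepadj_series (r : nat -> nat -> 'cV[C]_m) y S M j :
  (forall k, ell2 (r k)) -> (forall k, l2norm (r k) <= S k) -> bsum S M ->
  (forall i, has_sum (r^~ i) (y i)) ->
  has_sum (fun k => toepadj (r k) j) (toepadj y j).
Proof.
move=> er rS SM ry.
have N0 := bsum_ge0 gN.
pose a k d := (g d)^t* *m r k (j + d)%N.
have ab k : bsum (fun d => fnorm (a k d)) (N * S k).
  move=> n; apply: le_trans (bsum_toepadj j (er k) n) _.
  by rewrite ler_wpM2l.
have bM := bsumZ N0 SM.
have hal k : has_sum (a k) (toepadj (r k) j) by exact: has_sum_toepadj.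
have [L hL] : exists L, has_sum (fun k => toepadj (r k) j) L.
  exists (vsum (fun k => toepadj (r k) j)); apply: asum_has_sum.
  by exists (N * M); apply: bsum_le bM => k; exact: has_sum_bound (hal k) (ab k).
suff -> : toepadj y j = L by [].
apply: vsumE; apply: (has_sum_exchange ab bM hal _ hL) => d.
exact: (has_sumM _ (ry (j + d)%N)).
Qed.

Lemma convol_series (r : nat -> nat -> 'cV[C]_p) y j :
  (forall i, has_sum (r^~ i) (y i)) ->
  has_sum (fun k => convol g (r k) j) (convol g y j).
Proof.
by move=> ry; apply: has_sum_sum => i; exact: (has_sumM _ (ry i)).
Qed.

End Toeplitz.

(** * Invertibility on square summable sequences *)

Section Gram.
Context {R : realType}.
Local Notation C := (C R).
Variables (m p : nat) (g : nat -> 'M[C]_(m, p)) (N : R).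
Hypothesis gN : bsum (fun d => fnorm (g d)) N.

(** The operator [T T^*], with [T] the Toeplitz operator of [g]. *)
Definition gram (y : nat -> 'cV[C]_m) := convol g (toepadj g y).

Lemma gram_l2 y : ell2 y -> ell2 (gram y) /\ l2norm (gram y) <= N ^+ 2 * l2norm y.
Proof.
move=> /(toepadj_l2 gN) [ey ty]; have [et le] := convol_l2 gN ey.
split=> //; apply: le_trans le _; rewrite expr2 -mulrA.
by rewrite ler_wpM2l // (bsum_ge0 gN).
Qed.

Lemma gramD y y' : ell2 y -> ell2 y' ->
  gram (fun i => y i + y' i) = fun i => gram y i + gram y' i.
Proof.
move=> ey ey'; apply/funext => i; rewrite /gram -convolDr.
by congr (convol g _ i); apply/funext => j; rewrite (toepadjD gN).
Qed.

Lemma gramZ z y : ell2 y -> gram (fun i => z *: y i) = fun i => z *: gram y i.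
Proof.
move=> ey; apply/funext => i; rewrite /gram -convolZr.
by congr (convol g _ i); apply/funext => j; rewrite (toepadjZ gN).
Qed.

Lemma l2dot_gram x y : ell2 x -> ell2 y -> l2dot (gram x) y = l2dot x (gram y).
Proof.
move=> ex ey; have [etx _] := toepadj_l2 gN ex; have [ety _] := toepadj_l2 gN ey.
have [egx _] := gram_l2 ex; have [egy _] := gram_l2 ey.
rewrite /gram (l2dot_convol gN etx ey) (l2dotC egy ex) (l2dot_convol gN ety ex).
exact: l2dotC.
Qed.

Variable delta : R.
Hypothesis delta_gt0 : 0 < delta.
Hypothesis gram_pos : forall x, ell2 x ->
  (((delta * l2norm x ^+ 2)%:C)%C : C) <= l2dot (gram x) x.

Lemma gram_lower x : ell2 x -> delta * l2norm x <= l2norm (gram x).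
Proof.
move=> ex; have [egx _] := gram_l2 ex.
have [x0|x0] := eqVneq (l2norm x) 0; first by rewrite x0 mulr0 l2norm_ge0.
have {}x0 : 0 < l2norm x by rewrite lt_neqAle eq_sym x0 l2norm_ge0.
rewrite -(ler_pM2r x0) -mulrA -expr2.
have := gram_pos ex; rewrite lecE /= => /andP[_ h].
apply: le_trans h _; apply: le_trans (ler_norm _) _.
by apply: le_trans (Re_le_cmod _) _; exact: l2dot_cmod.
Qed.

Lemma gram_inj x x' : ell2 x -> ell2 x' -> gram x = gram x' -> x = x'.
Proof.
move=> ex ex' xx'; have [exx _] := ell2B ex ex'.
have ez : ell2 (fun i => (-1) *: x' i) by have [] := ell2Z (-1) ex'.
have E : (fun i => x i - x' i) = (fun i => x i + (-1) *: x' i).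
  by apply/funext => i; rewrite scaleN1r.
have := gram_lower exx; rewrite E gramD // gramZ // xx'.
have -> : (fun i => gram x' i + -1 *: gram x' i) = fun=> 0.
  by apply/funext => i; rewrite scaleN1r subrr.
rewrite l2norm0 pmulr_rle0 // -E => h.
have /funeqP h0 := l2norm_eq0 exx h.
by apply/funext => i; apply/eqP; rewrite -subr_eq0; apply/eqP; exact: h0.
Qed.

(** In the square of the norm of [x - c T T^* x] the linear term gains
    [2 * c * delta] and the quadratic term loses at most [c ^+ 2 * N ^+ 4];
    with [c = delta / K] the loss is at most [c * delta]. *)
Lemma gram_contraction : exists (c q : R), [/\ 0 < c, 0 <= q, q < 1 &
  forall x, ell2 x ->
    l2norm (fun i => x i - (c%:C)%C *: gram x i) <= q * l2norm x].
Proof.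
pose K := N ^+ 4 + delta ^+ 2 + 1.
have K0 : 0 < K by rewrite /K ltr_wpDl // addr_ge0 // ?sqr_ge0 // exprn_even_ge0.
pose c := delta / K; have c0 : 0 < c by rewrite divr_gt0.
have cK : c * K = delta by rewrite /c mulfVK ?gt_eqF.
have q0 : 0 <= 1 - c * delta.
  rewrite subr_ge0 /c mulrAC ler_pdivrMr // mul1r /K.
  by rewrite -expr2 -addrA addrCA lerDl addr_ge0 // exprn_even_ge0.
have q1 : 1 - c * delta < 1 by rewrite gtrBl mulr_gt0.
exists c, (Num.sqrt (1 - c * delta)); split=> //.
  by rewrite -[ltRHS]sqrtr1 ltr_sqrt.
move=> x ex; have [egx gx_le] := gram_l2 ex.
have [ecgx _] := ell2Z ((c%:C)%C : C) egx.
have [ed _] := ell2B ex ecgx.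
have ege0 : 0 <= l2norm x := l2norm_ge0 x.
suff : l2norm (fun i => x i - (c%:C)%C *: gram x i) ^+ 2 <=
    (1 - c * delta) * l2norm x ^+ 2.
  rewrite -{1}(sqr_sqrtr q0) -exprMn => h.
  by rewrite -(@ler_pXn2r _ 2) ?nnegrE ?mulr_ge0 ?sqrtr_ge0 ?l2norm_ge0.
have := gram_pos ex; rewrite lecE /= => /andP[_ h].
have E : l2norm (fun i => x i - (c%:C)%C *: gram x i) ^+ 2 =
   l2norm x ^+ 2 - 2 * c * complex.Re (l2dot (gram x) x) + c ^+ 2 * l2norm (gram x) ^+ 2.
  have : l2dot (fun i => x i - (c%:C)%C *: gram x i)
       (fun i => x i - (c%:C)%C *: gram x i) =
     l2dot x x - (c%:C)%C * (l2dot (gram x) x + (l2dot (gram x) x)^*) +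
     (c%:C)%C * (c%:C)%C * l2dot (gram x) (gram x).
    rewrite (l2dotBl ex ecgx ed) (l2dotBr ex ex ecgx) (l2dotBr ecgx ex ecgx).
    rewrite (l2dotZr _ ex egx) (l2dotZl _ egx ecgx) (l2dotZl _ egx ex).
    rewrite (l2dotZr _ egx egx) -(l2dotC egx ex).
    have -> : ((c%:C)%C : C)^* = (c%:C)%C.
      by apply: CrealP; apply/complex_realP; exists c.
    move: (l2dot x x) (l2dot x (gram x)) (l2dot (gram x) x) => d1 d2 d3.
    move: (l2dot (gram x) (gram x)) ((c%:C)%C : C) => d4 k.
    by ring.
  have zR : l2dot (gram x) x \is Num.real.
    apply: ger0_real; apply: le_trans (gram_pos ex); rewrite lecR.
    by rewrite mulr_ge0 ?sqr_ge0 // ltW.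
  rewrite (CrealP zR) -(complex.RRe_real zR) !l2dot_self // /=.
  rewrite -rmorphD -!rmorphM -rmorphB -rmorphD => -[->]; ring.
rewrite E.
have : l2norm (gram x) ^+ 2 <= N ^+ 4 * l2norm x ^+ 2.
  have -> : N ^+ 4 * l2norm x ^+ 2 = (N ^+ 2 * l2norm x) ^+ 2 by ring.
  rewrite lerXn2r // nnegrE ?l2norm_ge0 //; apply: mulr_ge0 => //; exact: sqr_ge0.
move: h; move: (complex.Re _) (l2norm (gram x) ^+ 2) (l2norm x ^+ 2) (sqr_ge0 (l2norm x)).
move=> r G X X0 h hG.
have h1 : c * (delta * X) <= c * r by rewrite ler_wpM2l // ltW.
have h2 : c ^+ 2 * G <= c ^+ 2 * (N ^+ 4 * X) by rewrite ler_wpM2l // sqr_ge0.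
have h3 : c ^+ 2 * (N ^+ 4 * X) <= c * delta * X.
  have -> : c * delta * X = c ^+ 2 * (K * X) by rewrite -cK; ring.
  rewrite ler_wpM2l ?sqr_ge0 // ler_wpM2r // /K -addrA lerDl.
  by rewrite addr_ge0 ?sqr_ge0.
lra.
Qed.

(** Richardson iteration: the residuals [r n] decay geometrically in norm, and
    [c] times their sum solves the equation. *)
Lemma gram_surj b : ell2 b -> exists2 y, ell2 y & gram y = b.
Proof.
move=> eb; have [c [q [c0 q0 q1 hc]]] := gram_contraction.
pose step (x : nat -> 'cV[C]_m) i := x i - (c%:C)%C *: gram x i.
pose r n := iter n step b.
have er n : ell2 (r n).
  elim: n => [|n IH] //=; have [eg _] := gram_l2 IH.
  have [ecg _] := ell2Z ((c%:C)%C : C) eg.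
  by have [] := ell2B IH ecg.
have rq n : l2norm (r n) <= l2norm b * q ^+ n.
  elim: n => [|n IH]; first by rewrite expr0 mulr1.
  apply: le_trans (hc _ (er n)) _; rewrite exprS mulrCA ler_wpM2l //.
have qM : bsum (fun n => l2norm b * q ^+ n) (l2norm b / (1 - q)).
  move=> n; rewrite -mulr_sumr ler_wpM2l ?l2norm_ge0 //.
  exact: sum_geom_le.
pose y i := vsum (r^~ i).
have ry i : has_sum (r^~ i) (y i).
  apply: asum_has_sum; exists (l2norm b / (1 - q)).
  apply: bsum_le qM => n; apply: le_trans (rq n).
  exact: (fnorm_le_l2norm _ (er n)).
have ey : ell2 y.
  apply: (@l2le_ell2 _ _ _ (l2norm b / (1 - q))).
  have := @l2le_has_sum _ _ _ (fun i n => r n i) y (fun n i => fnorm (r n i))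
    (fun n => l2norm b * q ^+ n) _ ry; apply=> //.
  by move=> n; apply: l2leW (rq n) _; exact: ell2_l2le.
have hg i : has_sum (fun n => gram (r n) i) (gram y i).
  apply: convol_series => j; exact: (@toepadj_series _ _ _ _ _ gN _ _ _ _ j er rq qM ry).
have cy i : (c%:C)%C *: gram y i = b i.
  have h1 : has_sum (fun n => r n.+1 i) (y i - (c%:C)%C *: gram y i).
    exact: has_sumB (ry i) (has_sumZ _ (hg i)).
  have h2 := has_sum_uniq (has_sum_shift h1) (ry i).
  have : b i + (y i - (c%:C)%C *: gram y i) = y i := h2.
  by move/eqP; rewrite addrCA -subr_eq0 addrAC subrr add0r subr_eq0 => /eqP ->.
exists (fun i => (c%:C)%C *: y i); first by have [] := ell2Z (c%:C)%C ey.
by rewrite gramZ //; apply/funext.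
Qed.

End Gram.

(** * Invertibility on absolutely summable sequences *)

Section Weights.
Context {R : realType}.
Local Notation C := (C R).

(** Each [t k] is bounded by a series in [d], while the sum over [k] is
    controlled at fixed [d]. *)
Lemma sum_le_exchange K (S : nat -> nat -> R) (t c : nat -> R) (B : nat -> R) M :
  (forall d k, 0 <= S d k) -> (forall k, bsum (S^~ k) (B k)) ->
  (forall k L, bsum (S^~ k) L -> t k <= L) ->
  (forall d, \sum_(k < K) S d k <= c d) -> bsum c M ->
  \sum_(k < K) t k <= M.
Proof.
move=> S0 SB tL Sc cM.
pose L k := limn (series (S^~ k)).
have cS k : cvgn (series (S^~ k)) by exact: (bsum_cvg _ (SB k)).
apply: (@le_trans _ _ (\sum_(k < K) L k)).
  by apply: ler_sum => k _; apply: tL; exact: cvg_bsum.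
have h : \sum_(k < K) series (S^~ k) D @[D --> \oo] --> \sum_(k < K) L k.
  by apply: cvg_sumr => k; exact: cS.
rewrite -(cvg_lim _ h) //; apply: limr_le; first by apply/cvg_ex; eexists; exact: h.
apply: nearW => D; apply: le_trans (cM D).
under eq_bigr do rewrite seriesE.
by rewrite exchange_big /=; apply: ler_sum => d _; exact: Sc.
Qed.

Variable lam : R.
Hypotheses (lam0 : 0 < lam) (lam1 : lam < 1).

(** Centres range over the integers, so that shifting the index of a weight is
    always the same as shifting its centre. *)
Definition weight (k : int) (i : nat) : R := lam ^+ `|i%:Z - k|%N.

Lemma weight_ge0 k i : 0 <= weight k i.
Proof. by rewrite exprn_ge0 // ltW. Qed.

Lemma weight_le1 k i : weight k i <= 1.
Proof. by rewrite exprn_ile1 // ltW. Qed.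

Lemma weight_center i : weight i%:Z i = 1.
Proof. by rewrite /weight subrr expr0. Qed.

Lemma weight_addn k i d : weight k (i + d) = weight (k - d%:Z) i.
Proof. by clear lam0 lam1; rewrite /weight; congr (_ ^+ absz _); lia. Qed.

Lemma weight_addz k i d : weight (k + d%:Z) (i + d) = weight k i.
Proof. by rewrite weight_addn addrK. Qed.

Lemma lam_exp_dist a b d : (a <= b)%N -> (b - a <= d)%N ->
  `|lam ^+ a - lam ^+ b| <= (1 - lam ^+ d) * lam ^+ a.
Proof.
move=> ab bd; have -> : lam ^+ b = lam ^+ (b - a) * lam ^+ a.
  by rewrite -exprD subnK.
rewrite -{1}[lam ^+ a]mul1r -mulrBl normrM (ger0_norm (exprn_ge0 a (ltW lam0))).
rewrite ler_wpM2r ?exprn_ge0 ?(ltW lam0) // ger0_norm.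
  by rewrite lerD2l lerN2 ler_wiXn2l // ltW.
by rewrite subr_ge0 exprn_ile1 // ltW.
Qed.

(** The smaller of the two weights is at least [lam ^+ d] times the larger. *)
Lemma weight_dist k i d : `|weight k i - weight k (i + d)| <=
  (1 - lam ^+ d) * (weight k i + weight k (i + d)).
Proof.
have e0 : 0 <= 1 - lam ^+ d by rewrite subr_ge0 exprn_ile1 // ltW.
rewrite /weight; set a := `|_|%N; set b := `|(i + d)%N%:Z - k|%N.
have [ab|/ltnW ba] := leqP a b.
  apply: le_trans (@lam_exp_dist a b d ab _) _; first by rewrite /a /b; lia.
  by rewrite ler_wpM2l // lerDl exprn_ge0 // ltW.
rewrite distrC; apply: le_trans (@lam_exp_dist b a d ba _) _.
  by rewrite /a /b; lia.
by rewrite ler_wpM2l // lerDr exprn_ge0 // ltW.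
Qed.

Lemma sum_weight s i K :
  \sum_(j < K) weight (s + j%:Z) i <= (1 - lam)^-1 + (1 - lam)^-1.
Proof.
have L0 : 0 <= (1 - lam)^-1 by rewrite invr_ge0 subr_ge0 ltW.
have sum_geom n := sum_geom_le n (ltW lam0) lam1.
have [is0|si] := lerP (i%:Z - s) 0.
  apply: (@le_trans _ _ (\sum_(j < K) lam ^+ j)).
    apply: ler_sum => j _; rewrite /weight ler_wiXn2l // ?ltW //; lia.
  by apply: le_trans (sum_geom K) _; rewrite lerDl.
have [a ea] : exists a : nat, i%:Z = s + a%:Z.
  by exists `|i%:Z - s|%N; lia.
apply: (@le_trans _ _ (\sum_(j < a + K) weight (s + j%:Z) i)).
  apply: (@ler_sum_widen _ (fun j => weight (s + j%:Z) i)); last exact: leq_addl.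
  by move=> j; exact: weight_ge0.
rewrite (@sum_addn _ (fun j => weight (s + j%:Z) i)) lerD //.
  rewrite (reindex_inj rev_ord_inj) /=.
  apply: le_trans (sum_geom a); apply: ler_sum => -[j ja] _ /=.
  by rewrite /weight ler_wiXn2l // ?ltW //; lia.
apply: le_trans (sum_geom K); apply: ler_sum => j _.
by rewrite /weight ler_wiXn2l // ?ltW //; lia.
Qed.

End Weights.

Section Localization.
Context {R : realType}.
Local Notation C := (C R).
Variables (m p : nat) (g : nat -> 'M[C]_(m, p)) (N : R).
Hypothesis gN : bsum (fun d => fnorm (g d)) N.
Variable lam : R.
Hypotheses (lam0 : 0 < lam) (lam1 : lam < 1).

Let w := weight lam.
Let w0 k i : 0 <= w k i := weight_ge0 lam0 k i.
Let om d : R := 1 - lam ^+ d.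

Let om0 d : 0 <= om d.
Proof. by rewrite subr_ge0 exprn_ile1 // ltW. Qed.

Let om1 d : om d <= 1.
Proof. by rewrite gerBl exprn_ge0 // ltW. Qed.

Let N0 : 0 <= N := bsum_ge0 gN.

Let gam d := fnorm (g d).
Let gam0 d : 0 <= gam d := fnorm_ge0 (g d).

Definition weigh n k (x : nat -> 'cV[C]_n) i : 'cV[C]_n := ((w k i)%:C)%C *: x i.

Definition wnorm n (x : nat -> 'cV[C]_n) k : R := l2norm (weigh k x).

Lemma fnorm_weigh n k (x : nat -> 'cV[C]_n) i :
  fnorm (weigh k x i) = w k i * fnorm (x i).
Proof. by rewrite fnormZ cmod_real ger0_norm. Qed.

Lemma weigh_le n k (x : nat -> 'cV[C]_n) i : fnorm (weigh k x i) <= fnorm (x i).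
Proof. by rewrite fnorm_weigh ler_piMl ?fnorm_ge0 // weight_le1. Qed.

Lemma ell2_weigh n k (x : nat -> 'cV[C]_n) : ell2 x -> ell2 (weigh k x).
Proof.
move=> /ell2_l2le ex; apply: (@l2le_ell2 _ _ _ (l2norm x)).
by apply: l2le_mono ex => i; rewrite fnorm_ge0 weigh_le.
Qed.

Lemma wnorm_le n k (x : nat -> 'cV[C]_n) : ell2 x -> wnorm x k <= l2norm x.
Proof.
move=> /ell2_l2le ex; apply: l2norm_le.
by apply: l2le_mono ex => i; rewrite fnorm_ge0 weigh_le.
Qed.

Lemma wnorm_ge0 n k (x : nat -> 'cV[C]_n) : 0 <= wnorm x k.
Proof. exact: l2norm_ge0. Qed.

Lemma l2le_weigh n k (x : nat -> 'cV[C]_n) : ell2 x ->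
  l2le (fun i => w k i * fnorm (x i)) (wnorm x k).
Proof.
move=> /(@ell2_weigh _ k) /ell2_l2le; apply: l2le_mono => i.
by rewrite fnorm_weigh lexx mulr_ge0 ?fnorm_ge0.
Qed.

(** Bounds over all windows of [K] consecutive integers are invariant under
    translation, as [wbound_shift] shows, and finite for bounded [f]; a small
    multiple of such a bound can therefore be absorbed into it. *)
Definition wbound K (f : int -> R) (U : R) :=
  forall s : int, \sum_(i < K) f (s + i%:Z) <= U.

Lemma wbound_shift K f U d : wbound K f U -> wbound K (fun k => f (k + d)) U.
Proof.
move=> fU s; apply: le_trans (fU (s + d)).
by apply: ler_sum => i _; rewrite addrAC.
Qed.

Lemma wboundD K f f' U U' : wbound K f U -> wbound K f' U' ->
  wbound K (fun k => f k + f' k) (U + U').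
Proof. by move=> fU fU' s; rewrite big_split lerD. Qed.

Section Window.
Variables (eps : R) (K : nat).
Hypothesis omeps : bsum (fun d => gam d * om d) eps.

Lemma wbound_ge0 n (x : nat -> 'cV[C]_n) U : wbound K (wnorm x) U -> 0 <= U.
Proof. by move=> /(_ 0); apply: le_trans; apply: sumr_ge0 => *; exact: wnorm_ge0. Qed.

Lemma wbound_toepadj (y : nat -> 'cV[C]_m) U : ell2 y ->
  wbound K (wnorm y) U -> wbound K (wnorm (toepadj g y)) (N * U).
Proof.
move=> ey yU s; set tau := toepadj g y; have etau : ell2 tau := (toepadj_l2 gN ey).1.
pose S d (k : nat) := gam d * wnorm y (s + k%:Z + d%:Z).
apply: (@sum_le_exchange _ K S (fun k => wnorm tau (s + k%:Z))
  (fun d => gam d * U) (fun=> N * l2norm y)).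
- by move=> d k; rewrite mulr_ge0 ?wnorm_ge0.
- move=> k n; apply: le_trans (_ : _ <= \sum_(d < n) gam d * l2norm y) _.
    by apply: ler_sum => d _; rewrite ler_wpM2l // wnorm_le.
  by rewrite -mulr_suml ler_wpM2r ?l2norm_ge0.
- move=> k L SL; apply: l2norm_le.
  have hs i : has_sum (fun d => ((w (s + k%:Z) i)%:C)%C *: ((g d)^t* *m y (i + d)%N))
      (weigh (s + k%:Z) tau i).
    exact: (has_sumZ _ (@has_sum_toepadj _ _ _ _ _ gN y i ey)).
  have := @l2le_has_sum _ _ _ _ _ (fun d i => gam d *
    (w (s + k%:Z + d%:Z) (d + i)%N * fnorm (y (d + i)%N))) (S^~ k) L hs.
  apply=> [i d|d|//].
    rewrite /= fnormZ cmod_real ger0_norm // [(d + i)%N]addnC /w weight_addz mulrCA.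
    by rewrite ler_wpM2l // /gam -(fnorm_adj (g d)) fnormM.
  apply: l2leZ => //.
  exact: (@l2le_addn _ (fun i => w _ i * fnorm (y i)) _ d (l2le_weigh _ ey)).
- by move=> d; rewrite -mulr_sumr ler_wpM2l //; exact: wbound_shift.
- by move=> n; rewrite -mulr_suml ler_wpM2r // (wbound_ge0 yU).
Qed.

(** On the [d]-th diagonal the commutator with a weight has the difference of two
    weights at distance [d] as a factor, which [weight_dist] bounds by
    [1 - lam ^+ d] times weights centred at [k] and [k - d]. *)
Lemma wbound_comm_toep (x : nat -> 'cV[C]_p) U : ell2 x ->
  wbound K (wnorm x) U ->
  wbound K (fun k => l2norm (fun i => convol g (weigh k x) i - weigh k (convol g x) i))
    (eps * (U + U)).
Proof.
move=> ex xU s.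
pose S d (k : nat) := gam d * om d *
  (wnorm x (s + k%:Z) + wnorm x (s + k%:Z - d%:Z)).
have S0 d k : 0 <= S d k by rewrite !mulr_ge0 // addr_ge0 ?wnorm_ge0.
apply: (@sum_le_exchange _ K S
  (fun k => l2norm (fun i => convol g (weigh (s + k%:Z) x) i -
     weigh (s + k%:Z) (convol g x) i))
  (fun d => gam d * om d * (U + U)) (fun=> eps * (l2norm x + l2norm x))) => //.
- move=> k n; apply: (@le_trans _ _
      (\sum_(d < n) gam d * om d * (l2norm x + l2norm x))).
    by apply: ler_sum => d _; rewrite ler_wpM2l ?mulr_ge0 // lerD // wnorm_le.
  by rewrite -mulr_suml ler_wpM2r // addr_ge0 ?l2norm_ge0.
- move=> k L SL; apply: l2norm_le; set z := s + k%:Z.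
  pose xd d i := if (d <= i)%N then x (i - d)%N else 0.
  pose T i d := if (d <= i)%N then
    (((w z (i - d)%N - w z i)%:C)%C : C) *: (g d *m x (i - d)%N) else 0.
  have hs i : has_sum (T i) (convol g (weigh z x) i - weigh z (convol g x) i).
    have h := has_sumB (@has_sum_convol _ _ _ g (weigh z x) i)
       (has_sumZ ((w z i)%:C)%C (@has_sum_convol _ _ _ g x i)).
    apply: eq_has_sum h => d; rewrite /T; case: ifP => _.
      by rewrite /weigh -scalemxAr -scalerBl -rmorphB.
    by rewrite scaler0 subrr.
  have := @l2le_has_sum _ _ _ _ _ (fun d i => gam d * om d *
    (if (d <= i)%N then w z (i - d)%N * fnorm (x (i - d)%N) +
      w (z - d%:Z) (i - d)%N * fnorm (x (i - d)%N) else 0)) (S^~ k) L hs.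
  apply=> [i d|d|//].
    rewrite /T; case: ifP => [di|_]; last by rewrite fnorm0 mulr0.
    rewrite fnormZ cmod_real -mulrDl mulrA /w -weight_addn subnK //.
    apply: le_trans (ler_wpM2l (normr_ge0 _) (fnormM _ _)) _.
    have h := weight_dist lam0 lam1 z (i - d) d; rewrite subnK // in h.
    rewrite mulrA ler_wpM2r ?fnorm_ge0 // [leLHS]mulrC -mulrA.
    by rewrite ler_wpM2l ?fnorm_ge0.
  rewrite /S; apply: (@l2leZ _ _ _ (gam d * om d)); first by rewrite mulr_ge0.
  apply: (@l2le_subn _ (fun i => w z i * fnorm (x i) + w (z - d%:Z) i * fnorm (x i))).
  by apply: l2leD; exact: l2le_weigh.
- move=> d; rewrite -mulr_sumr ler_wpM2l ?mulr_ge0 //.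
  exact: (wboundD xU (wbound_shift (- d%:Z) xU)).
- by move=> n; rewrite -mulr_suml ler_wpM2r // addr_ge0 // (wbound_ge0 xU).
Qed.

Lemma wbound_comm_adj (y : nat -> 'cV[C]_m) U : ell2 y ->
  wbound K (wnorm y) U ->
  wbound K (fun k => l2norm (fun i =>
     toepadj g (weigh k y) i - weigh k (toepadj g y) i)) (eps * (U + U)).
Proof.
move=> ey yU s.
pose S d (k : nat) := gam d * om d *
  (wnorm y (s + k%:Z) + wnorm y (s + k%:Z + d%:Z)).
have S0 d k : 0 <= S d k by rewrite !mulr_ge0 // addr_ge0 ?wnorm_ge0.
apply: (@sum_le_exchange _ K S
  (fun k => l2norm (fun i => toepadj g (weigh (s + k%:Z) y) i -
     weigh (s + k%:Z) (toepadj g y) i))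
  (fun d => gam d * om d * (U + U)) (fun=> eps * (l2norm y + l2norm y))) => //.
- move=> k n; apply: (@le_trans _ _
      (\sum_(d < n) gam d * om d * (l2norm y + l2norm y))).
    by apply: ler_sum => d _; rewrite ler_wpM2l ?mulr_ge0 // lerD // wnorm_le.
  by rewrite -mulr_suml ler_wpM2r // addr_ge0 ?l2norm_ge0.
- move=> k L SL; apply: l2norm_le; set z := s + k%:Z.
  pose T i d := (((w z (i + d)%N - w z i)%:C)%C : C) *: ((g d)^t* *m y (i + d)%N).
  have hs i : has_sum (T i) (toepadj g (weigh z y) i - weigh z (toepadj g y) i).
    have h := has_sumB (@has_sum_toepadj _ _ _ _ _ gN _ i (@ell2_weigh _ z _ ey))
       (has_sumZ ((w z i)%:C)%C (@has_sum_toepadj _ _ _ _ _ gN y i ey)).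
    apply: eq_has_sum h => d; rewrite /T.
    by rewrite /weigh -scalemxAr -scalerBl -rmorphB.
  have := @l2le_has_sum _ _ _ _ _ (fun d i => gam d * om d *
    (w z (d + i)%N * fnorm (y (d + i)%N) +
      w (z + d%:Z) (d + i)%N * fnorm (y (d + i)%N))) (S^~ k) L hs.
  apply=> [i d|d|//].
    rewrite /T fnormZ cmod_real -mulrDl mulrA [(d + i)%N]addnC /w weight_addz.
    apply: le_trans (ler_wpM2l (normr_ge0 _) (fnormM _ _)) _.
    have h := weight_dist lam0 lam1 z i d.
    rewrite fnorm_adj mulrA ler_wpM2r ?fnorm_ge0 // [leLHS]mulrC -mulrA.
    rewrite ler_wpM2l ?fnorm_ge0 //.
    by rewrite distrC [X in _ * X]addrC.
  rewrite /S; apply: (@l2leZ _ _ _ (gam d * om d)); first by rewrite mulr_ge0.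
  apply: (@l2le_addn _ (fun i => w z i * fnorm (y i) + w (z + d%:Z) i * fnorm (y i))).
  by apply: l2leD; exact: l2le_weigh.
- move=> d; rewrite -mulr_sumr ler_wpM2l ?mulr_ge0 //.
  exact: (wboundD yU (wbound_shift d%:Z yU)).
- by move=> n; rewrite -mulr_suml ler_wpM2r // addr_ge0 // (wbound_ge0 yU).
Qed.

Lemma wbound_asum n (b : nat -> 'cV[C]_n) M :
  bsum (fun i => fnorm (b i)) M ->
  wbound K (wnorm b) (M * ((1 - lam)^-1 + (1 - lam)^-1)).
Proof.
move=> bM s.
pose S i (k : nat) := w (s + k%:Z) i * fnorm (b i).
apply: (@sum_le_exchange _ K S (fun k => wnorm b (s + k%:Z))
   (fun i => fnorm (b i) * ((1 - lam)^-1 + (1 - lam)^-1)) (fun=> M)).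
- by move=> i k; rewrite mulr_ge0 ?fnorm_ge0.
- move=> k; apply: bsum_le bM => i; rewrite ler_piMl ?fnorm_ge0 //.
  exact: weight_le1.
- move=> k L SL; apply: l2norm_le; apply: bsum_l2le => [i|]; first exact: fnorm_ge0.
  by apply: bsum_le SL => i; rewrite fnorm_weigh.
- move=> i; rewrite /S -mulr_suml mulrC ler_wpM2l ?fnorm_ge0 //.
  exact: sum_weight.
- move=> k; rewrite -mulr_suml ler_wpM2r // addr_ge0 // invr_ge0 subr_ge0 ltW //.
Qed.

End Window.
End Localization.

Section WienerInverse.
Context {R : realType}.
Local Notation C := (C R).
Variables (m p : nat) (g : nat -> 'M[C]_(m, p)) (N : R).
Hypothesis gN : bsum (fun d => fnorm (g d)) N.
Variable delta : R.
Hypothesis delta_gt0 : 0 < delta.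
Hypothesis gram_pos : forall x, ell2 x ->
  (((delta * l2norm x ^+ 2)%:C)%C : C) <= l2dot (gram g x) x.

(** As the rate tends to 1, every factor [1 - lam ^+ d] tends to zero. *)
Lemma exists_slow_rate e : 0 < e -> exists lam : R, [/\ 0 < lam, lam < 1 &
  bsum (fun d => fnorm (g d) * (1 - lam ^+ d)) e].
Proof.
move=> e0; pose lam n : R := 1 - 2^-1 * harmonic n.
have h0 n : 0 < harmonic n :> R by rewrite /harmonic /= invr_gt0 ltr0n.
have h1 n : harmonic n <= 1 :> R by rewrite /harmonic /= invf_le1 ?ler1n ?ltr0n.
have lam0 n : 0 < lam n by have := h1 n; rewrite /lam; lra.
have lam1 n : lam n < 1 by have := h0 n; rewrite /lam; lra.
have lamc : lam n @[n --> \oo] --> (1 : R).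
  have : 1 - 2^-1 * harmonic n @[n --> \oo] --> (1 - 2^-1 * 0 : R).
    apply: cvgB; first exact: cvg_cst.
    by apply: cvgMr; exact: cvg_harmonic.
  by rewrite mulr0 subr0.
have lamX d : lam n ^+ d @[n --> \oo] --> (1 : R).
  elim: d => [|d IH]; first by under eq_fun do rewrite expr0; exact: cvg_cst.
  have h : lam n ^+ d.+1 @[n --> \oo] --> (1 * 1 : R).
    by under eq_fun do rewrite exprS; exact: cvgM.
  by rewrite mulr1 in h.
have : \forall n \near \oo, bsum (fun d => fnorm (g d) * (1 - lam n ^+ d)) e.
  apply: (bsum_dominated _ gN) => // [d||d]; first exact: fnorm_ge0.
    apply: nearW => n d.
    rewrite mulr_ge0 ?fnorm_ge0 ?subr_ge0 ?exprn_ile1 ?(ltW (lam0 n)) ?(ltW (lam1 n)) //=.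
    by rewrite ler_piMr ?fnorm_ge0 // gerBl exprn_ge0 // ltW.
  have : fnorm (g d) * (1 - lam n ^+ d) @[n --> \oo] --> fnorm (g d) * (1 - 1).
    by apply: cvgMr; apply: cvgB => //; exact: cvg_cst.
  by rewrite subrr mulr0.
by case=> n _ /(_ n (leqnn n)) h; exists (lam n).
Qed.

(** The localization estimate: the lower bound for [T T^*] is applied to the
    weighted sequence, and both commutators are small on average over the
    windows. *)
Lemma wbound_gram lam eps K (y : nat -> 'cV[C]_m) U V :
  0 < lam -> lam < 1 -> bsum (fun d => fnorm (g d) * (1 - lam ^+ d)) eps ->
  ell2 y -> wbound K (wnorm lam (gram g y)) V -> wbound K (wnorm lam y) U ->
  wbound K (fun k => delta * wnorm lam y k) (V + 4 * (eps * N * U)).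
Proof.
move=> lam0 lam1 omeps ey hV hU.
have N0 : 0 <= N := bsum_ge0 gN.
have etau := (toepadj_l2 gN ey).1; set tau := toepadj g y in etau.
have htau := wbound_toepadj gN lam0 lam1 ey hU.
have h1 := wbound_comm_toep lam0 lam1 omeps etau htau.
have h2 := wbound_comm_adj gN lam0 lam1 omeps ey hU.
have -> : V + 4 * (eps * N * U) =
  V + (eps * (N * U + N * U) + N * (eps * (U + U))) by ring.
move=> s; have h3 : N * (\sum_(i < K) l2norm (fun i0 =>
    toepadj g (weigh lam (s + i%:Z) y) i0 - weigh lam (s + i%:Z) (toepadj g y) i0))
    <= N * (eps * (U + U)) by rewrite ler_wpM2l.
apply: le_trans (lerD (hV s) (lerD (h1 s) h3)).
rewrite mulr_sumr -!big_split; apply: ler_sum => i _ /=.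
move: (s + i%:Z) => k.
have ew : ell2 (weigh lam k y) by exact: ell2_weigh.
have ewt : ell2 (weigh lam k tau) by exact: ell2_weigh.
have [etw _] := toepadj_l2 gN ew.
have [ec2 _] := ell2B etw ewt.
have [ect _] := convol_l2 gN ewt.
have [egy _] := gram_l2 gN ey.
have ewg : ell2 (weigh lam k (gram g y)) by exact: ell2_weigh.
have [ec1 _] := ell2B ect ewg.
have [ec3 c3le] := convol_l2 gN ec2.
rewrite /wnorm; apply: le_trans (gram_lower gN gram_pos ew) _.
have -> : gram g (weigh lam k y) = fun i => weigh lam k (gram g y) i +
   ((convol g (weigh lam k tau) i - weigh lam k (convol g tau) i) +
   convol g (fun i => toepadj g (weigh lam k y) i - weigh lam k tau i) i).
  apply/funext => j; rewrite /gram addrA [X in _ = X + _]addrC subrK -convolDr.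
  by congr (convol g _ j); apply/funext => l; rewrite addrC subrK.
have [ec13 le13] := ell2D ec1 ec3.
have [_ le] := ell2D ewg ec13.
apply: le_trans le _; rewrite lerD2l; apply: le_trans le13 _.
by rewrite lerD2l.
Qed.

(** Wiener's lemma for [T T^*]. With a slow enough rate [wbound_gram] turns a
    bound [U] on the windows into [V / delta + U / 2], whatever their length, so
    iterating it bounds all windows by [2 * V / delta]; since the weight is 1 at
    its centre, the window sums majorize the sums of norms. *)
Lemma gram_asum (y : nat -> 'cV[C]_m) : ell2 y -> asum (gram g y) -> asum y.
Proof.
move=> ey [M bM]; have N0 : 0 <= N := bsum_ge0 gN.
pose eps := delta / (8 * (N + 1)).
have N1 : 0 < N + 1 by rewrite ltr_wpDl.
have eps0 : 0 < eps by rewrite divr_gt0 // mulr_gt0.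
have epsN : 8 * (eps * N) <= delta.
  have -> : delta = 8 * (eps * (N + 1)).
    by rewrite /eps; field; rewrite gt_eqF.
  by rewrite !ler_wpM2l ?ltW // ltrDl.
have [lam [lam0 lam1 omeps]] := exists_slow_rate eps0.
pose V := M * ((1 - lam)^-1 + (1 - lam)^-1).
have hV K : wbound K (wnorm lam (gram g y)) V by exact: wbound_asum.
pose U0 K := K%:R * l2norm y.
have U00 K : 0 <= U0 K by rewrite mulr_ge0 ?l2norm_ge0.
have V0 : 0 <= V / delta.
  rewrite divr_ge0 ?(ltW delta_gt0) // mulr_ge0 ?(bsum_ge0 bM) //.
  by rewrite addr_ge0 // invr_ge0 subr_ge0 ltW.
have hU K n : wbound K (wnorm lam y) (2 * (V / delta) + U0 K * 2^-1 ^+ n).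
  elim: n => [|n IH] s.
    apply: (@le_trans _ _ (\sum_(i < K) l2norm y)).
      by apply: ler_sum => i _; exact: wnorm_le.
    by rewrite sumr_const card_ord expr0 mulr1 -[leLHS]mulr_natl lerDr mulr_ge0.
  have := wbound_gram lam0 lam1 omeps ey (hV K) IH s.
  rewrite -mulr_sumr exprS; set u := \sum_(i < K) _; set X := U0 K * _ => h.
  have X0 : 0 <= X by rewrite mulr_ge0 // exprn_ge0.
  have -> : U0 K * (2^-1 * 2^-1 ^+ n) = 2^-1 * X by rewrite mulrCA.
  set W := V / delta in h V0 *.
  have eV : V = delta * W by rewrite mulrC divfK // gt_eqF.
  have h2 : 8 * (eps * N) * (2 * W + X) <= delta * (2 * W + X).
    by rewrite ler_wpM2r // addr_ge0 // mulr_ge0.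
  rewrite -(ler_pM2l delta_gt0); rewrite eV in h.
  rewrite -mulrA in h2; move: h h2; move: (eps * N * (2 * W + X)) => q h h2.
  have e2 : delta * (2 * W + X) = 2 * (delta * W) + delta * X by ring.
  have e3 : delta * (2 * W + 2^-1 * X) = 2 * (delta * W) + 2^-1 * (delta * X) by ring.
  rewrite e3; rewrite e2 in h2; lra.
exists (2 * (V / delta)) => K.
apply/ler_addgt0Pl => e e0.
have hc : U0 K * 2^-1 ^+ n @[n --> \oo] --> U0 K * 0.
  by apply: cvgMr; apply: cvg_expr; rewrite ger0_norm //; lra.
rewrite mulr0 in hc; move/cvgrPdist_le : hc => /(_ _ e0) [n _ /(_ n (leqnn n))].
rewrite sub0r normrN ger0_norm ?mulr_ge0 ?exprn_ge0 ?l2norm_ge0 // => hn.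
apply: (@le_trans _ _ (\sum_(i < K) wnorm lam y (0 + i%:Z))).
  apply: ler_sum => i _; rewrite add0r.
  have := fnorm_le_l2norm i (ell2_weigh (k := i%:Z) lam0 lam1 ey).
  by rewrite fnorm_weigh // weight_center mul1r.
by apply: le_trans (hU K n 0) _; rewrite addrC lerD2r.
Qed.

End WienerInverse.

(** * The right inverse of the Toeplitz operator *)

Section MxOf.
Context {R : realType}.
Local Notation C := (C R).

Lemma mx_ofE r s (f : 'cV[C]_s -> 'cV[C]_r) u :
  (forall a u v, f (a *: u + v) = a *: f u + f v) -> mx_of f *m u = f u.
Proof.
move=> flin; have f0 : f 0 = 0.
  by have := flin (-1) 0 0; rewrite scaler0 addr0 scaleN1r addNr.
have fsum (I : Type) (l : seq I) (c : I -> C) (v : I -> 'cV[C]_s) :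
    f (\sum_(i <- l) c i *: v i) = \sum_(i <- l) c i *: f (v i).
  by elim: l => [|i l IH]; rewrite ?big_nil // !big_cons flin IH.
have {2}-> : u = \sum_j u j 0 *: delta_mx j 0.
  by rewrite {1}(matrix_sum_delta u); apply: eq_bigr => j _; rewrite big_ord1.
rewrite fsum; apply/matrixP => i j; rewrite ord1 mxE summxE.
by apply: eq_bigr => k _; rewrite !mxE mulrC.
Qed.

Lemma eq_mulmx_cV r s (A B : 'M[C]_(r, s)) :
  (forall u : 'cV[C]_s, A *m u = B *m u) -> A = B.
Proof.
move=> AB; apply/matrixP => i j.
have /(congr1 (fun w : 'cV[C]_r => w i 0)) := AB (delta_mx j 0).
by rewrite -!colE !mxE.
Qed.

Lemma asum_cols r s (a : nat -> 'M[C]_(r, s)) :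
  (forall u : 'cV[C]_s, asum (fun n => a n *m u)) -> asum a.
Proof.
move=> aA; have /choice[M hM] : forall j : 'I_s, exists M,
    bsum (fun n => fnorm (a n *m (delta_mx j 0 : 'cV[C]_s))) M by move=> j; exact: aA.
exists (\sum_(i < r) \sum_(j < s) M j) => n.
apply: (@le_trans _ _ (\sum_(k < n) \sum_(i < r) \sum_(j < s)
    fnorm (a k *m (delta_mx j 0 : 'cV[C]_s)))).
  apply: ler_sum => k _; apply: le_trans (fnorm_le _) _.
  apply: ler_sum => i _; apply: ler_sum => j _.
  have := cmod_le_fnorm (a k *m (delta_mx j 0 : 'cV[C]_s)) i 0.
  by rewrite -colE mxE.
rewrite exchange_big /=; apply: ler_sum => i _.
rewrite exchange_big /=; apply: ler_sum => j _; exact: hM.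
Qed.

End MxOf.

Section Dagger.
Context {R : realType}.
Local Notation C := (C R).
Variables (m p : nat) (g : nat -> 'M[C]_(m, p)) (N : R).
Hypothesis gN : bsum (fun d => fnorm (g d)) N.
Variable delta : R.
Hypothesis delta_gt0 : 0 < delta.
Hypothesis gram_pos : forall x, ell2 x ->
  (((delta * l2norm x ^+ 2)%:C)%C : C) <= l2dot (gram g x) x.

Definition ginv : (nat -> 'cV[C]_m) -> nat -> 'cV[C]_m := invop (gram g).
(** The right inverse [T^* (T T^* )^-1] of [T]. *)
Definition dagger b := toepadj g (ginv b).
Definition gcol (u : 'cV[C]_p) i := g i *m u.
(** The column [H_G E u]. *)
Definition gtail (u : 'cV[C]_p) i := g i.+1 *m u.

Lemma ginvP b : ell2 b -> ell2 (ginv b) /\ gram g (ginv b) = b.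
Proof.
move=> eb; have [y ey yb] := gram_surj gN delta_gt0 gram_pos eb.
by rewrite /ginv /invop; case: xgetP => [x -> //|/(_ y)] [].
Qed.

Lemma ginv_gram y : ell2 y -> ginv (gram g y) = y.
Proof.
move=> ey; have [egy _] := gram_l2 gN ey; have [e h] := ginvP egy.
exact: (gram_inj gN delta_gt0 gram_pos e ey h).
Qed.

Lemma ell2_gcol u : ell2 (gcol u).
Proof. by apply: asum_ell2; apply: asumMr; exists N. Qed.

Lemma asum_gtail u : asum (gtail u).
Proof.
apply: (asumMr u); exists N.
by apply: (@bsum_shift _ (fun i => fnorm (g i)) N 1) => // i; exact: fnorm_ge0.
Qed.

Lemma ell2_dagger b : ell2 b -> ell2 (dagger b).
Proof. by move=> /ginvP [eb _]; have [] := toepadj_l2 gN eb. Qed.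

Lemma convol_dagger b : ell2 b -> convol g (dagger b) = b.
Proof. by move=> /ginvP []. Qed.

Lemma dagger_eq b y : ell2 y -> gram g y = b -> dagger b = toepadj g y.
Proof. by move=> ey <-; rewrite /dagger ginv_gram. Qed.

Lemma ginv_lin (a : C) b b' : ell2 b -> ell2 b' ->
  ginv (fun i => a *: b i + b' i) = fun i => a *: ginv b i + ginv b' i.
Proof.
move=> /ginvP [eb hb] /ginvP [eb' hb'].
have [ea _] := ell2Z a eb; have [es _] := ell2D ea eb'.
have := ginv_gram es; rewrite (gramD gN ea eb') (gramZ gN a eb) hb hb'.
by [].
Qed.

Lemma dagger_lin (a : C) b b' : ell2 b -> ell2 b' ->
  dagger (fun i => a *: b i + b' i) = fun i => a *: dagger b i + dagger b' i.
Proof.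
move=> eb eb'; have [e h] := ginvP eb; have [e' h'] := ginvP eb'.
have [ea _] := ell2Z a e; rewrite /dagger ginv_lin //.
apply/funext => i; rewrite (toepadjD gN i ea e').
by rewrite (toepadjZ gN a i e).
Qed.

Lemma l2dot_dagger x b : ell2 x -> ell2 b -> convol g x = (fun=> 0) ->
  l2dot x (dagger b) = 0.
Proof.
move=> ex /ginvP [eb _] gx0; rewrite /dagger -(l2dot_convol gN ex eb) gx0.
exact: l2dot0l.
Qed.

(** [T^*] commutes with the backward shift, and [T] does so up to a Hankel
    column that involves only the first entry. This identity carries the whole
    theorem: it yields [Y Xi0], [Y Delta] and the inverse of [Y]. *)
Lemma dagger_shift b : ell2 b ->
  (fun i => dagger b i.+1) = dagger (fun i => b i.+1 - gtail (dagger b 0%N) i).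
Proof.
move=> eb; have [ey yb] := ginvP eb.
have ey1 : ell2 (fun i => ginv b i.+1) := @ell2_addn _ _ _ 1 ey.
apply/esym; rewrite (dagger_eq ey1) //; apply/funext => i.
have := congr1 (fun x => x i.+1) (convol_dagger eb); rewrite convolS => <-.
by rewrite addrAC subrr add0r.
Qed.

Lemma asum_ginv b : asum b -> asum (ginv b).
Proof.
move=> ab; have [ey yb] := ginvP (asum_ell2 ab).
by apply: (gram_asum gN delta_gt0 gram_pos ey); rewrite yb.
Qed.

Lemma asum_toepadj y : asum y -> asum (toepadj g y).
Proof.
move=> ay; have ey := asum_ell2 ay; have [M yM] := ay.
exists (M * N).
apply: (@bsum_exchange _ _ _ (fun d j => (g d)^t* *m y (j + d)%N) _
  (fun d => M * fnorm (g d))).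
- move=> d n; rewrite mulrC.
  apply: (@le_trans _ _ (\sum_(j < n) fnorm (g d) * fnorm (y (d + j)%N))).
    apply: ler_sum => j _; apply: le_trans (fnormM _ _) _.
    by rewrite fnorm_adj addnC.
  rewrite -mulr_sumr ler_wpM2l ?fnorm_ge0 //.
  by apply: (@bsum_shift _ (fun j => fnorm (y j)) M d) => // j; exact: fnorm_ge0.
- by move=> n; rewrite -mulr_sumr ler_wpM2l // (bsum_ge0 yM).
- by move=> j; exact: (@has_sum_toepadj _ _ _ _ _ gN y j ey).
Qed.

Lemma asum_dagger b : asum b -> asum (dagger b).
Proof. by move=> /asum_ginv /asum_toepadj. Qed.

Lemma dagger0 : dagger (fun=> 0) = fun=> 0.
Proof.
have e0 := @ell2_0 R m; have := dagger_lin (-1) e0 e0.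
have -> : (fun i : nat => -1 *: (0 : 'cV[C]_m) + 0) = fun=> 0.
  by apply/funext => i; rewrite scaler0 addr0.
by move=> ->; apply/funext => i; rewrite scaleN1r addNr.
Qed.

Lemma gtail_lin a u v : gtail (a *: u + v) = fun i => a *: gtail u i + gtail v i.
Proof. by apply/funext => i; rewrite /gtail mulmxDr scalemxAr. Qed.

Lemma gcol_lin a u v : gcol (a *: u + v) = fun i => a *: gcol u i + gcol v i.
Proof. by apply/funext => i; rewrite /gcol mulmxDr scalemxAr. Qed.

Lemma ell2_gtail u : ell2 (gtail u).
Proof. by apply: asum_ell2; exact: asum_gtail. Qed.

Arguments ell2_gtail u : clear implicits.
Arguments ell2_gcol u : clear implicits.

(** The [n]-th entry of [T^* (T T^* )^-1 H_G E], as a matrix. *)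
Definition hcoef n : 'M[C]_p := mx_of (fun u => dagger (gtail u) n).

Lemma hcoefE n u : hcoef n *m u = dagger (gtail u) n.
Proof.
apply: mx_ofE => a {}u v; rewrite gtail_lin.
by rewrite (dagger_lin a (ell2_gtail u) (ell2_gtail v)).
Qed.

Definition Ycoef n : 'M[C]_p := if n is k.+1 then - hcoef k else 1%:M.

Lemma asum_hcoef : asum hcoef.
Proof.
apply: asum_cols => u; have := asum_dagger (asum_gtail u).
by congr (asum _); apply/funext => n; rewrite hcoefE.
Qed.

Lemma asum_shift r s (a : nat -> 'M[C]_(r, s)) :
  asum (fun n => a n.+1) -> asum a.
Proof.
move=> [M aM]; exists (fnorm (a 0%N) + M) => -[|n].
  by rewrite big_ord0 addr_ge0 ?fnorm_ge0 // (bsum_ge0 aM).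
by rewrite big_ord_recl lerD2l; exact: aM.
Qed.

Lemma asum_Ycoef : asum Ycoef.
Proof.
apply: asum_shift; have [M hM] := asum_hcoef; exists M.
by apply: bsum_le hM => i /=; rewrite fnormN.
Qed.

Lemma YcoefS n u : Ycoef n.+1 *m u = - dagger (gtail u) n.
Proof. by rewrite /= mulNmx hcoefE. Qed.

(** In terms of functions, [G Y] is constant. *)
Lemma convol_Ycoef n : convol g Ycoef n = if n is 0%N then g 0%N else 0.
Proof.
apply: eq_mulmx_cV => u; rewrite -convolMr; case: n => [|n].
  by rewrite convol0 mul1mx.
rewrite convolS mul0mx mul1mx.
have -> : (fun i => Ycoef i.+1 *m u) = fun i => - dagger (gtail u) i.
  by apply/funext => i; rewrite YcoefS.
by rewrite convolNr (convol_dagger (ell2_gtail u)) subrr.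
Qed.

(** For data whose backward shift is a Hankel column [H_G E u], such as [E u] or
    [T E u], the preceding identity gives all entries but the first in closed
    form. *)
Lemma dagger_tail b u : ell2 b -> (forall i, b i.+1 = gtail u i) ->
  forall n, dagger b n.+1 = dagger (gtail (u - dagger b 0%N)) n.
Proof.
move=> eb bu n; have /(congr1 (fun x => x n)) := dagger_shift eb.
move=> /= ->; congr (dagger _ n); apply/funext => i.
by rewrite bu /gtail mulmxBr.
Qed.

Definition Xi0m : 'M[C]_(p, m) := mx_of (fun u => dagger (embed u) 0%N).

Lemma embed_lin n a (u v : 'cV[C]_n) :
  embed (a *: u + v) = fun i => a *: embed u i + embed v i.
Proof. by apply/funext => -[|i] //=; rewrite scaler0 addr0. Qed.

Lemma Xi0mE u : Xi0m *m u = dagger (embed u) 0%N.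
Proof.
apply: mx_ofE => a {}u v; rewrite embed_lin.
by rewrite (dagger_lin a (@ell2_embed _ _ u) (@ell2_embed _ _ v)).
Qed.

Lemma Ycoef_Xi0m n u : Ycoef n *m (Xi0m *m u) = dagger (embed u) n.
Proof.
case: n => [|n]; first by rewrite mul1mx Xi0mE.
have hu i : embed u i.+1 = gtail 0 i by rewrite /gtail mulmx0.
rewrite (dagger_tail (@ell2_embed _ _ u) hu) YcoefS Xi0mE sub0r.
have -> : gtail (- dagger (embed u) 0%N) =
    fun i => (-1) *: gtail (dagger (embed u) 0%N) i + (fun=> 0) i.
  by apply/funext => i; rewrite scaleN1r addr0 /gtail mulmxN.
rewrite (dagger_lin (-1) (ell2_gtail _) (@ell2_0 _ _)) dagger0.
by rewrite scaleN1r addr0.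
Qed.

Definition cornerm : 'M[C]_p := mx_of (fun u => dagger (gcol u) 0%N).

Lemma cornermE u : cornerm *m u = dagger (gcol u) 0%N.
Proof.
apply: mx_ofE => a {}u v; rewrite gcol_lin.
by rewrite (dagger_lin a (ell2_gcol u) (ell2_gcol v)).
Qed.

Lemma Ycoef_corner n u :
  Ycoef n *m ((1%:M - cornerm) *m u) = embed u n - dagger (gcol u) n.
Proof.
rewrite mulmxBl mul1mx cornermE; case: n => [|n]; first by rewrite mul1mx.
rewrite YcoefS (@dagger_tail (gcol u) u) ?sub0r //.
exact: ell2_gcol.
Qed.

End Dagger.

(** * The inverse of Y *)

Section Resolvent.
Context {R : realType}.
Local Notation C := (C R).

(** The remainder after [k] steps is [z ^+ k *: v k], and [v] is bounded. *)
Lemma has_sum_resolvent n (v x : nat -> 'cV[C]_n) z : disc z -> ell2 v ->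
  (forall k, v k = x k + z *: v k.+1) -> has_sum (fun k => z ^+ k *: x k) (v 0%N).
Proof.
move=> /disc_cmod z1 ev vx; apply/has_sumP.
have E K : \sum_(k < K) z ^+ k *: x k - v 0%N = - (z ^+ K *: v K).
  elim: K => [|K IH]; first by rewrite big_ord0 sub0r expr0 scale1r.
  rewrite big_ord_recr /= addrAC IH [v K]vx scalerDr opprD addrAC addNr add0r.
  by rewrite scalerA -exprSr.
under eq_fun do rewrite E fnormN fnormZ cmodX.
have h : cmod z ^+ K * l2norm v @[K --> \oo] --> 0 * l2norm v.
  by apply: cvgMl; apply: cvg_expr; rewrite ger0_norm ?cmod_ge0.
rewrite mul0r in h; apply: squeeze_cvgr h; last exact: cvg_cst.
apply: nearW => K; rewrite mulr_ge0 ?exprn_ge0 ?cmod_ge0 ?fnorm_ge0 //=.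
by rewrite ler_wpM2l ?exprn_ge0 ?cmod_ge0 // fnorm_le_l2norm.
Qed.

Lemma sum_cmodX (z : C) n : disc z ->
  \sum_(i < n) cmod z ^+ i <= (1 - cmod z)^-1.
Proof.
by move=> /disc_cmod z1; apply: sum_geom_le => //; exact: cmod_ge0.
Qed.

Lemma adj_dot_inj n (x y : 'cV[C]_n) :
  (forall w : 'cV[C]_n, (w^t* *m x) 0 0 = (w^t* *m y) 0 0) -> x = y.
Proof.
move=> h; apply/matrixP => i j; rewrite ord1.
have := h (delta_mx i 0); rewrite trmx_delta map_delta_mx -!rowE !mxE.
by [].
Qed.

Lemma wiener_coef_const r s (A : 'M[C]_(r, s)) :
  wiener_coef (fun n => if n is 0%N then A else 0) (fun=> A).
Proof.
split; first by apply: asum_shift; exists 0 => n; rewrite big1 // => i _; rewrite fnorm0.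
move=> z _; pose e n : 'M[C]_(r, s) := if n is 0%N then A else 0.
have h : has_sum (psterm e z) (\sum_(i < 1) psterm e z i).
  by apply: has_sum_fin => -[|i] // _; rewrite /psterm scaler0.
by rewrite big_ord1 /psterm expr0 scale1r in h.
Qed.

Lemma convol_const r s t (A : 'M[C]_(r, s)) (b : nat -> 'M[C]_(s, t)) n :
  convol (fun n => if n is 0%N then A else 0) b n = A *m b n.
Proof.
case: n => [|n]; first by rewrite convol0.
by rewrite convolSl /convol big1 ?add0r // => i _; rewrite mul0mx.
Qed.

End Resolvent.

Section DaggerInverse.
Context {R : realType}.
Local Notation C := (C R).
Variables (m p : nat) (g : nat -> 'M[C]_(m, p)) (N : R).
Hypothesis gN : bsum (fun d => fnorm (g d)) N.
Variable delta : R.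
Hypothesis delta_gt0 : 0 < delta.
Hypothesis gram_pos : forall x, ell2 x ->
  (((delta * l2norm x ^+ 2)%:C)%C : C) <= l2dot (gram g x) x.

Lemma convol_embed (u : 'cV[C]_p) : convol g (embed u) = gcol g u.
Proof.
apply/funext => -[|n]; first by rewrite convol0.
by rewrite convolS /convol big1 ?addr0 // => i _; rewrite mulmx0.
Qed.

(** The first block row of [T^* (T T^* )^-1] is the adjoint of the column
    [(T T^* )^-1 T E]. *)
Definition kap i : 'M[C]_(m, p) := mx_of (fun w => ginv g (gcol g w) i).

Lemma kapE i w : kap i *m w = ginv g (gcol g w) i.
Proof.
apply: mx_ofE => a u v; rewrite gcol_lin.
by rewrite (ginv_lin gN delta_gt0 gram_pos a (@ell2_gcol _ _ _ _ _ gN u)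
  (@ell2_gcol _ _ _ _ _ gN v)).
Qed.

Lemma asum_gcol u : asum (gcol g u).
Proof. by apply: asumMr; exists N. Qed.

Lemma asum_kap : asum kap.
Proof.
apply: asum_cols => w; have := asum_ginv gN delta_gt0 gram_pos (asum_gcol w).
by congr (asum _); apply/funext => n; rewrite kapE.
Qed.

Lemma l2dot_dagger_embed b w : ell2 b ->
  l2dot (dagger g b) (embed w) = l2dot b (ginv g (gcol g w)).
Proof.
move=> eb; have ew := @ell2_embed R p w.
have egw := @ell2_gcol _ _ _ _ _ gN w.
have [eyb hb] := ginvP gN delta_gt0 gram_pos eb.
have [eyw hw] := ginvP gN delta_gt0 gram_pos egw.
have [et _] := toepadj_l2 gN eyb.
rewrite /dagger (l2dotC ew et) -(l2dot_convol gN ew eyb) convol_embed.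
rewrite -(l2dotC egw eyb) -{1}hw -(l2dot_gram gN eyb eyw).
by rewrite hb.
Qed.

(** The row [kap] is absolutely summable by [gram_asum], which makes the
    coefficients of the inverse of [Y] absolutely summable. *)
Lemma has_sum_dagger0 b : ell2 b ->
  has_sum (fun i => (kap i)^t* *m b i) (dagger g b 0%N).
Proof.
move=> eb; have [M kM] := asum_kap.
have hs : has_sum (fun i => (kap i)^t* *m b i) (vsum (fun i => (kap i)^t* *m b i)).
  apply: asum_has_sum; exists (l2norm b * M).
  apply: bsum_le (bsumZ (l2norm_ge0 b) kM) => i.
  apply: le_trans (fnormM _ _) _; rewrite fnorm_adj mulrC.
  by rewrite ler_wpM2r ?fnorm_ge0 // fnorm_le_l2norm.
have -> // : dagger g b 0%N = vsum (fun i => (kap i)^t* *m b i).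
apply: adj_dot_inj => w.
have ed := ell2_dagger gN delta_gt0 gram_pos eb.
rewrite -(l2dot_embedr w ed) l2dot_dagger_embed //.
apply: l2dot_eq; have h := has_sumM (w^t*) hs.
by apply: eq_has_sum h => i; rewrite /dotterm -kapE trmx_mul map_mxM mulmxA.
Qed.

Definition zcoef n : 'M[C]_p := vsum (fun i => (kap i)^t* *m g (i + n).+1).
(** The coefficients of the inverse of [Y], as given by its realization
    [I + z E^* T^* (T T^* )^-1 H_G (I - z S)^-1 E]. *)
Definition Zcoef n : 'M[C]_p := if n is k.+1 then zcoef k else 1%:M.

Lemma fnorm_g_le i : fnorm (g i) <= N.
Proof. by apply: (bsum_elem i _ gN) => j; exact: fnorm_ge0. Qed.

Lemma has_sum_zcoef n : has_sum (fun i => (kap i)^t* *m g (i + n).+1) (zcoef n).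
Proof.
apply: asum_has_sum; have [M kM] := asum_kap; exists (N * M).
apply: bsum_le (bsumZ (bsum_ge0 gN) kM) => i.
apply: le_trans (fnormM _ _) _; rewrite fnorm_adj mulrC.
by rewrite ler_wpM2r ?fnorm_ge0 // fnorm_g_le.
Qed.

Arguments has_sum_zcoef n : clear implicits.

Lemma bsum_g_shift k : bsum (fun n => fnorm (g (k + n).+1)) N.
Proof.
have := @bsum_shift _ (fun i => fnorm (g i)) N k.+1.
by apply=> // i; exact: fnorm_ge0.
Qed.

Lemma asum_Zcoef : asum Zcoef.
Proof.
apply: asum_shift; have [M kM] := asum_kap; exists (N * M).
apply: (@bsum_exchange _ _ _ (fun i n => (kap i)^t* *m g (i + n).+1) _
  (fun i => N * fnorm (kap i))).
- move=> i n; apply: (@le_trans _ _ (\sum_(j < n) fnorm (kap i) * fnorm (g (i + j).+1))).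
    by apply: ler_sum => j _; apply: le_trans (fnormM _ _) _; rewrite fnorm_adj.
  by rewrite -mulr_sumr mulrC ler_wpM2r ?fnorm_ge0 // bsum_g_shift.
- by move=> n; rewrite -mulr_sumr ler_wpM2l // (bsum_ge0 gN).
- exact: has_sum_zcoef.
Qed.

(** The column [H_G (I - z S)^-1 E u]. *)
Definition hres z (u : 'cV[C]_p) i := vsum (fun j => z ^+ j *: (g (i + j).+1 *m u)).

Lemma bsum_hres z (u : 'cV[C]_p) i : cdisc z ->
  bsum (fun j => fnorm (z ^+ j *: (g (i + j).+1 *m u))) (N * fnorm u).
Proof.
move=> z1 n; apply: (@le_trans _ _ (\sum_(j < n) fnorm (g (i + j).+1) * fnorm u)).
  apply: ler_sum => j _.
  apply: le_trans (@fnorm_psterm _ _ _ (fun j => g (i + j).+1 *m u) z j z1) _.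
  exact: fnormM.
by rewrite -mulr_suml ler_wpM2r ?fnorm_ge0 // bsum_g_shift.
Qed.

Lemma has_sum_hres z (u : 'cV[C]_p) i : cdisc z ->
  has_sum (fun j => z ^+ j *: (g (i + j).+1 *m u)) (hres z u i).
Proof.
by move=> z1; apply: asum_has_sum; exists (N * fnorm u); exact: bsum_hres.
Qed.
Arguments has_sum_hres z u i _ : clear implicits.

Lemma hresS z u i : cdisc z -> hres z u i = gtail g u i + z *: hres z u i.+1.
Proof.
move=> z1; apply: vsumE.
have h := has_sumZ z (has_sum_hres z u i.+1 z1).
have -> : gtail g u i = z ^+ 0 *: (g (i + 0).+1 *m u).
  by rewrite expr0 scale1r addn0.
apply: (@has_sum_shift _ _ _ (fun j => z ^+ j *: (g (i + j).+1 *m u))).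
by apply: eq_has_sum h => j; rewrite scalerA -exprS addSnnS.
Qed.

Lemma asum_hres z u : disc z -> asum (hres z u).
Proof.
move=> z1; have z1' := disc_cdisc z1; move/disc_cmod : (z1) => zlt.
exists ((1 - cmod z)^-1 * (N * fnorm u)).
apply: (@bsum_exchange _ _ _ (fun j i => z ^+ j *: (g (i + j).+1 *m u)) _
  (fun j => cmod z ^+ j * (N * fnorm u))).
- move=> j n; apply: (@le_trans _ _
    (\sum_(i < n) cmod z ^+ j * (fnorm (g (j + i).+1) * fnorm u))).
    apply: ler_sum => i _; rewrite fnormZ cmodX addnC.
    by rewrite ler_wpM2l ?exprn_ge0 ?cmod_ge0 // fnormM.
  rewrite -mulr_sumr -mulr_suml ler_wpM2l ?exprn_ge0 ?cmod_ge0 //.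
  by rewrite ler_wpM2r ?fnorm_ge0 // bsum_g_shift.
- move=> n; rewrite -mulr_suml ler_wpM2r ?mulr_ge0 ?fnorm_ge0 ?(bsum_ge0 gN) //.
  exact: sum_cmodX.
- by move=> i; exact: has_sum_hres.
Qed.

Lemma dagger_hres0 z u : disc z ->
  has_sum (fun n => z ^+ n *: (zcoef n *m u)) (dagger g (hres z u) 0%N).
Proof.
move=> z1; have z1' := disc_cdisc z1.
have [M kM] := asum_kap.
have h0 := has_sum_dagger0 (asum_ell2 (asum_hres u z1)).
apply: (@has_sum_exchange _ _ _
  (fun i n => (kap i)^t* *m (z ^+ n *: (g (i + n).+1 *m u))) _ _ _
  (fun i => N * fnorm u * fnorm (kap i)) _ _ _ _ _ h0).
- move=> i n; apply: (@le_trans _ _ (\sum_(j < n)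
     fnorm (kap i) * fnorm (z ^+ j *: (g (i + j).+1 *m u)))).
    by apply: ler_sum => j _; apply: le_trans (fnormM _ _) _; rewrite fnorm_adj.
  by rewrite -mulr_sumr mulrC ler_wpM2r ?fnorm_ge0 // bsum_hres.
- apply: bsumZ kM; apply: mulr_ge0; [exact: bsum_ge0 gN|exact: fnorm_ge0].
- by move=> i; exact: (has_sumM _ (has_sum_hres z u i z1')).
- move=> n; have h := has_sumZ (z ^+ n) (has_sumMr u (has_sum_zcoef n)).
  by apply: eq_has_sum h => i; rewrite -scalemxAr mulmxA.
Qed.

(** With [f = hres z u], the sequence [v = dagger f] satisfies
    [v - z S^* v = dagger (gtail (u + z v_0))], which determines [v_0]. *)
Lemma Ycoef_hres z u : disc z ->
  has_sum (fun n => z ^+ n *: (Ycoef g n *m (u + z *: dagger g (hres z u) 0%N))) u.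
Proof.
move=> z1; have z1' := disc_cdisc z1.
have ef := asum_ell2 (asum_hres u z1).
have ed := ell2_dagger gN delta_gt0 gram_pos ef.
set v := dagger g (hres z u) in ed *; set u' := u + z *: v 0%N.
have et w : ell2 (gtail g w) by exact: (@ell2_gtail _ _ _ _ _ gN).
have rec k : v k = dagger g (gtail g u') k + z *: v k.+1.
  have -> : v k.+1 = dagger g (fun i => hres z u i.+1 - gtail g (v 0%N) i) k.
    by have /(congr1 (fun x => x k)) := dagger_shift gN delta_gt0 gram_pos ef.
  have ef1 : ell2 (fun i => hres z u i.+1) := @ell2_addn _ _ _ 1 ef.
  have [efb _] := ell2B ef1 (et (v 0%N)).
  have E : dagger g (fun i => z *: (hres z u i.+1 - gtail g (v 0%N) i) + gtail g u' i) k =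
    z *: dagger g (fun i => hres z u i.+1 - gtail g (v 0%N) i) k +
    dagger g (gtail g u') k.
    by rewrite (dagger_lin gN delta_gt0 gram_pos z efb (et u')).
  rewrite [RHS]addrC -E.
  congr (dagger g _ k); apply/funext => i; rewrite (hresS u i z1').
  rewrite /gtail /u' mulmxDr -scalemxAr scalerBr [RHS]addrACA addNr addr0.
  by rewrite addrC.
have := has_sum_resolvent z1 ed rec.
move=> /(has_sumZ (- z)) h.
have -> : u = z ^+ 0 *: (Ycoef g 0%N *m u') + - z *: v 0%N.
  by rewrite expr0 scale1r mul1mx scaleNr addrK.
apply: (@has_sum_shift _ _ _ (fun n => z ^+ n *: (Ycoef g n *m u'))).
apply: eq_has_sum h => n; rewrite (YcoefS gN delta_gt0 gram_pos) scalerN.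
by rewrite scalerA mulNr -exprS scaleNr.
Qed.

(** On the disc this is [Ycoef_hres] applied to every column. *)
Lemma Ycoef_Zcoef F K : wiener_coef (Ycoef g) F -> wiener_coef Zcoef K ->
  forall z, cdisc z -> F z *m K z = 1%:M.
Proof.
move=> wF wK; have wFK := wiener_coef_convol wF wK.
have we := wiener_coef_const (1%:M : 'M[C]_p).
apply: (wiener_coef_disc_eq wFK we) => z z1; have z1' := disc_cdisc z1.
apply: eq_mulmx_cV => u; rewrite mul1mx -mulmxA.
have Ku : K z *m u = u + z *: dagger g (hres z u) 0%N.
  apply: has_sum_uniq (has_sumMr u (wK.2 z z1')) _.
  have h1 : has_sum (fun n => psterm Zcoef z n.+1 *m u)
      (z *: dagger g (hres z u) 0%N).
    have h := has_sumZ z (@dagger_hres0 z u z1).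
    by apply: eq_has_sum h => n; rewrite /psterm scalerA -exprS -scalemxAl.
  have e0 : psterm Zcoef z 0%N *m u = u by rewrite /psterm expr0 scale1r mul1mx.
  have -> : u + z *: dagger g (hres z u) 0%N =
     psterm Zcoef z 0%N *m u + z *: dagger g (hres z u) 0%N by rewrite e0.
  exact: (@has_sum_shift _ _ _ (fun n => psterm Zcoef z n *m u) _ h1).
rewrite Ku; set u' := u + _.
apply: has_sum_uniq (has_sumMr u' (wF.2 z z1')) _.
have h := @Ycoef_hres z u z1; apply: eq_has_sum h => n.
by rewrite /psterm -scalemxAl.
Qed.

End DaggerInverse.

(** * The inner function Theta *)

Section Inner.
Context {R : realType}.
Local Notation C := (C R).
Variables (m p k : nat) (g : nat -> 'M[C]_(m, p)) (N : R).
Hypothesis gN : bsum (fun d => fnorm (g d)) N.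
Variable delta : R.
Hypothesis delta_gt0 : 0 < delta.
Hypothesis gram_pos : forall x, ell2 x ->
  (((delta * l2norm x ^+ 2)%:C)%C : C) <= l2dot (gram g x) x.
Variable T0 : 'M[C]_(p, k).
Hypothesis T0_def : T0 *m T0^t* = 1%:M - cornerm g.
Hypothesis T0_ker : forall u : 'cV[C]_k, T0 *m u = 0 -> u = 0.

Lemma adjmxM r s t (A : 'M[C]_(r, s)) (B : 'M[C]_(s, t)) :
  (A *m B)^t* = B^t* *m A^t*.
Proof. by rewrite trmx_mul map_mxM. Qed.

Lemma adjmxK r s (A : 'M[C]_(r, s)) : (A^t*)^t* = A.
Proof. by apply/matrixP => i j; rewrite !mxE conjCK. Qed.

Lemma col_self0 n (x : 'cV[C]_n) : x^t* *m x = 0 -> x = 0.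
Proof.
move=> x0; have := fnorm_sqr_col x; rewrite x0 mxE => -[/eqP].
by rewrite sqrf_eq0 => /eqP; exact: fnorm_eq0.
Qed.

Lemma T0_gram_unit : T0^t* *m T0 \in unitmx.
Proof.
rewrite -unitmx_tr -row_free_unit; apply: inj_row_free => v v0.
have h : T0^t* *m T0 *m v^T = 0.
  by apply: trmx_inj; rewrite trmx_mul trmxK v0 trmx0.
suff : v^T = 0 by move/(congr1 trmx); rewrite trmxK trmx0.
apply: T0_ker; apply: col_self0.
by rewrite adjmxM -mulmxA (mulmxA _ T0) h mulmx0.
Qed.

Definition T0inv : 'M[C]_(k, p) := invmx (T0^t* *m T0) *m T0^t*.

Lemma T0invK : T0inv *m T0 = 1%:M.
Proof. by rewrite /T0inv -mulmxA mulVmx // T0_gram_unit. Qed.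

Lemma T0adj_proj (u : 'cV[C]_p) : T0^t* *m (u - T0 *m (T0inv *m u)) = 0.
Proof.
rewrite mulmxBr /T0inv -!mulmxA (mulmxA (T0^t*) T0) mulKVmx ?subrr //.
exact: T0_gram_unit.
Qed.

(** The coefficients of [Theta]. *)
Definition Thcoef n := Ycoef g n *m T0.

Lemma asum_Thcoef : asum Thcoef.
Proof. by apply: asumMr; exact: (asum_Ycoef gN delta_gt0 gram_pos). Qed.

(** A preimage under [T0^*]. *)
Definition T0lift (v : 'cV[C]_k) : 'cV[C]_p := T0 *m (invmx (T0^t* *m T0) *m v).

Lemma T0liftK v : T0^t* *m T0lift v = v.
Proof. by rewrite /T0lift mulmxA mulKVmx // T0_gram_unit. Qed.

Let egcol u := @ell2_gcol _ _ _ _ _ gN u.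
Let edag b (eb : ell2 b) := ell2_dagger gN delta_gt0 gram_pos eb.

Lemma Ycoef_T0adj n (u : 'cV[C]_p) :
  Thcoef n *m (T0^t* *m u) = embed u n - dagger g (gcol g u) n.
Proof.
rewrite -(Ycoef_corner gN delta_gt0 gram_pos) -T0_def /Thcoef.
by rewrite -!mulmxA.
Qed.

Lemma Thcoef_lift n v :
  Thcoef n *m v = embed (T0lift v) n - dagger g (gcol g (T0lift v)) n.
Proof. by rewrite -Ycoef_T0adj T0liftK. Qed.

Lemma ell2_Thcoef v : ell2 (fun n => Thcoef n *m v).
Proof. by apply: asum_ell2; apply: asumMr; exact: asum_Thcoef. Qed.
Arguments ell2_Thcoef v : clear implicits.

Lemma convol_g_Ycoef_col n (u : 'cV[C]_p) :
  convol g (fun i => Ycoef g i *m u) n = if n is 0%N then g 0%N *m u else 0.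
Proof.
rewrite convolMr (convol_Ycoef gN delta_gt0 gram_pos).
by case: n => [//|n]; rewrite mul0mx.
Qed.

Lemma g0_T0 : g 0%N *m T0 = 0.
Proof.
apply: eq_mulmx_cV => v; rewrite mul0mx -mulmxA.
have := convol_g_Ycoef_col 0 (T0 *m v) => /= <-.
have -> : (fun i => Ycoef g i *m (T0 *m v)) =
    fun i => embed (T0lift v) i + - dagger g (gcol g (T0lift v)) i.
  by apply/funext => i; rewrite -Thcoef_lift /Thcoef mulmxA.
rewrite convolDr convolNr convol_embed (convol_dagger gN delta_gt0 gram_pos) ?subrr //.
Qed.

Lemma convol_g_Th (x : nat -> 'cV[C]_k) : convol g (convol Thcoef x) = fun=> 0.
Proof.
apply/funext => n; rewrite convolA.
have -> : convol g Thcoef = fun=> 0.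
  apply/funext => i; rewrite /Thcoef convolMr (convol_Ycoef gN delta_gt0 gram_pos).
  by case: i => [|i]; rewrite ?g0_T0 ?mul0mx.
by rewrite /convol big1 // => i _; rewrite mul0mx.
Qed.

(** Against the kernel of [T_G] the columns of [Theta] act by their first
    entries alone. *)
Lemma l2dot_ker_Th y v : ell2 y -> convol g y = (fun=> 0) ->
  l2dot y (fun n => Thcoef n *m v) = ((T0lift v)^t* *m y 0%N) 0 0.
Proof.
move=> ey gy0.
have -> : (fun n => Thcoef n *m v) =
   fun n => embed (T0lift v) n - dagger g (gcol g (T0lift v)) n.
  by apply/funext => n; rewrite Thcoef_lift.
have eu := @ell2_embed R p (T0lift v).
have eg := @egcol (T0lift v).
rewrite (l2dotBr ey eu (edag eg)) l2dot_embedr //.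
by rewrite (l2dot_dagger gN delta_gt0 gram_pos ey eg gy0) subr0.
Qed.

Lemma l2norm_Thcol v : l2norm (fun n => Thcoef n *m v) = fnorm v.
Proof.
have ev := ell2_Thcoef v.
have gy0 : convol g (fun n => Thcoef n *m v) = fun=> 0.
  apply/funext => n.
  have -> : (fun n => Thcoef n *m v) = fun n => Ycoef g n *m (T0 *m v).
    by apply/funext => i; rewrite /Thcoef mulmxA.
  rewrite convol_g_Ycoef_col; case: n => [|//].
  by rewrite mulmxA g0_T0 mul0mx.
have := l2dot_ker_Th v ev gy0; rewrite l2dot_self // {2}/Thcoef mul1mx.
rewrite mulmxA -{1}[T0]adjmxK -adjmxM T0liftK -fnorm_sqr_col => -[/eqP].
by rewrite eqrXn2 ?l2norm_ge0 ?fnorm_ge0 // => /eqP.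
Qed.

(** Apart from the contribution of [x 0], the image starts with zero and lies in
    the kernel of [T_G], so the two parts are orthogonal. *)
Lemma convol_Th_step (x : nat -> 'cV[C]_k) : ell2 x ->
  l2norm (convol Thcoef x) ^+ 2 =
  fnorm (x 0%N) ^+ 2 + l2norm (convol Thcoef (fun i => x i.+1)) ^+ 2.
Proof.
move=> ex; have [M hM] := asum_Thcoef.
have ex1 : ell2 (fun i => x i.+1) := @ell2_addn _ _ _ 1 ex.
have [ey _] := convol_l2 hM ex1; set y := convol Thcoef _ in ey *.
have esy := ell2_shift ey; have et := ell2_Thcoef (x 0%N).
have -> : convol Thcoef x = fun n => shiftop y n + Thcoef n *m x 0%N.
  by apply/funext => -[|n]; rewrite ?convol0 ?add0r // convolS addrC.
have gsy : convol g (shiftop y) = fun=> 0.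
  apply/funext => -[|n]; first by rewrite convol0 mulmx0.
  have /(congr1 (fun f => f n)) h := convol_g_Th (fun i => x i.+1).
  by rewrite convolS mulmx0 add0r.
have orth : l2dot (shiftop y) (fun n => Thcoef n *m x 0%N) = 0.
  by rewrite l2dot_ker_Th // mulmx0 mxE.
by rewrite (l2normD_orth esy et orth) l2norm_Thcol l2norm_shift // addrC.
Qed.

Lemma sum_unroll (f a : nat -> R) K : (forall n, f n = a n + f n.+1) ->
  f 0%N = \sum_(i < K) a i + f K.
Proof.
move=> fa; elim: K => [|K IH]; first by rewrite big_ord0 add0r.
by rewrite IH fa big_ord_recr addrA.
Qed.

Lemma convol_Th_split (x : nat -> 'cV[C]_k) K : ell2 x ->
  l2norm (convol Thcoef x) ^+ 2 = \sum_(i < K) fnorm (x i) ^+ 2 +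
    l2norm (convol Thcoef (fun i => x (K + i)%N)) ^+ 2.
Proof.
move=> ex.
apply: (@sum_unroll (fun n => l2norm (convol Thcoef (fun i => x (n + i)%N)) ^+ 2)
  (fun n => fnorm (x n) ^+ 2) K) => n.
have <- : (fun i => x (n + i.+1)%N) = fun i => x (n.+1 + i)%N.
  by apply/funext => i; rewrite addnS.
have -> : x n = x (n + 0)%N by rewrite addn0.
exact: (convol_Th_step (@ell2_addn _ _ _ n ex)).
Qed.

(** Unrolling [convol_Th_step] matches the first [K] terms of both norms, and the
    remainders are bounded by a tail of [x]. *)
Lemma convol_Th_isometry (x : nat -> 'cV[C]_k) : ell2 x ->
  ell2 (convol Thcoef x) /\ l2norm (convol Thcoef x) = l2norm x.
Proof.
move=> ex; have [M hM] := asum_Thcoef; have [ey _] := convol_l2 hM ex.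
split=> //; apply/eqP; rewrite -(eqrXn2 (n := 2)) ?l2norm_ge0 //.
rewrite -subr_eq0 -normr_eq0; apply/eqP/le_anti; rewrite normr_ge0 andbT.
apply/ler_addgt0Pl => e e0; rewrite addr0.
have M1 : 0 < M ^+ 2 + 1 by rewrite ltr_wpDl ?sqr_ge0.
have d0 : 0 < e / (M ^+ 2 + 1) by rewrite divr_gt0.
have s0 : 0 < Num.sqrt (e / (M ^+ 2 + 1)) by rewrite sqrtr_gt0.
have [K hK] := l2norm_tail ex s0.
rewrite (convol_Th_split K ex) (l2norm_split K ex) opprD addrACA subrr add0r.
set t := l2norm (fun i => x (K + i)%N) in hK *.
have [_] := convol_l2 hM (@ell2_addn _ _ _ K ex); rewrite -/t.
set A := l2norm _ => AM.
have A0 : 0 <= A by exact: l2norm_ge0.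
have t0 : 0 <= t by exact: l2norm_ge0.
have t2 : (M ^+ 2 + 1) * t ^+ 2 <= e.
  rewrite mulrC -ler_pdivlMr // -(sqr_sqrtr (ltW d0)).
  by rewrite lerXn2r ?nnegrE ?sqrtr_ge0.
have A2 : A ^+ 2 <= M ^+ 2 * t ^+ 2.
  by rewrite -exprMn lerXn2r ?nnegrE // (le_trans A0).
apply: le_trans (ler_normB _ _) _.
rewrite !ger0_norm ?sqr_ge0 //; apply: le_trans t2.
by rewrite mulrDl mul1r lerD2r.
Qed.

(** The component [w] of [u] orthogonal to the range of [T0] vanishes: [Y u] lies
    in the kernel of [T_G], while [E w] lies in the range of the right inverse,
    hence of [T_G^*]. *)
Lemma g0_ker (u : 'cV[C]_p) : g 0%N *m u = 0 -> T0 *m (T0inv *m u) = u.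
Proof.
move=> g0u; pose w := u - T0 *m (T0inv *m u).
have Tw : T0^t* *m w = 0 by exact: T0adj_proj.
suff w0 : w = 0 by apply/esym/eqP; rewrite -subr_eq0; apply/eqP.
have ey : ell2 (fun n => Ycoef g n *m u).
  by apply: asum_ell2; apply: asumMr; exact: (asum_Ycoef gN delta_gt0 gram_pos).
have gy0 : convol g (fun n => Ycoef g n *m u) = fun=> 0.
  by apply/funext => n; rewrite convol_g_Ycoef_col; case: n.
have wu : w^t* *m u = 0.
  have : l2dot (fun n => Ycoef g n *m u) (embed w) = 0.
    have -> : embed w = dagger g (gcol g w).
      apply/funext => n; apply/eqP; rewrite -subr_eq0 -Ycoef_T0adj.
      by rewrite Tw mulmx0.
    exact: (l2dot_dagger gN delta_gt0 gram_pos ey (@egcol w) gy0).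
  rewrite l2dot_embedr // mul1mx => h.
  by apply/matrixP => i j; rewrite !ord1 h mxE.
apply: col_self0; rewrite {2}/w mulmxBr wu sub0r (mulmxA _ T0).
by rewrite -{1}[T0]adjmxK -adjmxM Tw trmx0 map_mx0 mul0mx oppr0.
Qed.

Lemma g0_Xi0 : g 0%N *m Xi0m g = 1%:M.
Proof.
apply: eq_mulmx_cV => u; rewrite mul1mx -mulmxA (Xi0mE gN delta_gt0 gram_pos).
have := congr1 (fun x => x 0%N)
  (convol_dagger gN delta_gt0 gram_pos (@ell2_embed R m u)).
by rewrite convol0.
Qed.

Lemma g0_compl : T0 *m (T0inv *m (1%:M - Xi0m g *m g 0%N)) = 1%:M - Xi0m g *m g 0%N.
Proof.
apply: eq_mulmx_cV => u; rewrite -mulmxA -(mulmxA T0inv); apply: g0_ker.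
by rewrite mulmxA mulmxBr mulmx1 mulmxA g0_Xi0 mul1mx subrr mul0mx.
Qed.

Lemma convol_Ycoef_Zcoef :
  convol (Ycoef g) (Zcoef g) = fun n => if n is 0%N then 1%:M else 0.
Proof.
have wF := wiener_coef_vsum (asum_Ycoef gN delta_gt0 gram_pos).
have wK := wiener_coef_vsum (asum_Zcoef gN delta_gt0 gram_pos).
rewrite -(wiener_coef_taylor_eq (wiener_coef_convol wF wK)).
apply: wiener_coef_taylor_eq; apply: eq_wiener_coef (wiener_coef_const 1%:M) => z z1.
by rewrite (Ycoef_Zcoef gN delta_gt0 gram_pos wF wK).
Qed.

(** With [w] the image of [x] under the inverse of [Y], the product [G_0 w] is
    [G Y w = G x = 0] entry by entry, so that [w] takes values in the range of
    [T0]. *)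
Lemma ker_Th (x : nat -> 'cV[C]_p) : ell2 x -> convol g x = (fun=> 0) ->
  exists2 v, ell2 v & convol Thcoef v = x.
Proof.
move=> ex gx0; pose w := convol (Zcoef g) x.
have Yw : convol (Ycoef g) w = x.
  apply/funext => n; rewrite convolA convol_Ycoef_Zcoef convol_const.
  by rewrite mul1mx.
have [M hM] := asum_Zcoef gN delta_gt0 gram_pos; have [ew _] := convol_l2 hM ex.
have g0w n : g 0%N *m w n = 0.
  have /(congr1 (fun f => f n)) := gx0; rewrite -Yw convolA.
  have -> : convol g (Ycoef g) = fun n => if n is 0%N then g 0%N else 0.
    by apply/funext => i; rewrite (convol_Ycoef gN delta_gt0 gram_pos).
  by rewrite convol_const.
exists (fun n => T0inv *m w n).
  have := l2leZ (fnorm_ge0 T0inv) (ell2_l2le ew) => h.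
  apply: (@l2le_ell2 _ _ _ (fnorm T0inv * l2norm w)).
  by apply: l2le_mono h => i; rewrite fnorm_ge0 fnormM.
rewrite -Yw; apply/funext => n; apply: eq_bigr => i _.
by rewrite /Thcoef -mulmxA g0_ker.
Qed.

End Inner.

(** * Operators and boundary values *)

Section Operators.
Context {R : realType}.
Local Notation C := (C R).

Lemma mx_of_mul r s (A : 'M[C]_(r, s)) : mx_of (fun u => A *m u) = A.
Proof. by apply/matrixP => i j; rewrite mxE -colE mxE. Qed.

Lemma eq_mx_of r s (f h : 'cV[C]_s -> 'cV[C]_r) : f =1 h -> mx_of f = mx_of h.
Proof. by move=> /funext ->. Qed.

Lemma toeplitzE r s (F : C -> 'M[C]_(r, s)) x :
  toeplitz F x = convol (taylor F) x.
Proof.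
apply/funext => i; rewrite /toeplitz /blockop.
have h : has_sum (fun j => (if (j <= i)%N then taylor F (i - j)%N else 0) *m x j)
   (\sum_(j < i.+1) (if (j <= i)%N then taylor F (i - j)%N else 0) *m x j).
  by apply: has_sum_fin => j ij; rewrite leqNgt ij mul0mx.
rewrite -/(vsum _) (vsumE h) /convol; apply: eq_bigr => -[j /= ji] _.
by rewrite -ltnS ji.
Qed.

Lemma adjop_eq r s (T : (nat -> 'cV[C]_s) -> (nat -> 'cV[C]_r)) y w :
  ell2 w -> (forall x, ell2 x -> l2dot (T x) y = l2dot x w) -> adjop T y = w.
Proof.
move=> ew Tw; have : [set w' | ell2 w' /\
    forall x, ell2 x -> l2dot (T x) y = l2dot x w'] (adjop T y).
  by apply: (@xgetPex _ (fun=> 0)); exists w.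
move=> [ew' Tw']; apply: (l2dot_inj ew' ew) => x ex.
exact: (etrans (esym (Tw' x ex)) (Tw x ex)).
Qed.

Lemma adjop_shift n (y : nat -> 'cV[C]_n) : ell2 y ->
  adjop (@shiftop R n) y = fun i => y i.+1.
Proof.
move=> ey; have ey1 : ell2 (fun i => y i.+1) := @ell2_addn _ _ _ 1 ey.
by apply: (adjop_eq ey1) => x ex; exact: l2dot_shift.
Qed.

Lemma resolvent_shift n z (u : 'cV[C]_n) : disc z ->
  resolvent (@shiftop R n) z (embed u) = fun i => z ^+ i *: u.
Proof.
move=> z1; have e : ell2 (fun i => z ^+ i *: u).
  apply: asum_ell2; exists ((1 - cmod z)^-1 * fnorm u) => k.
  under eq_bigr do rewrite fnormZ cmodX.
  rewrite -mulr_suml ler_wpM2r ?fnorm_ge0 //.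
  exact: sum_cmodX.
have sol : (fun i => z ^+ i *: u - z *: shiftop (fun i => z ^+ i *: u) i) = embed u.
  apply/funext => -[|i] /=; first by rewrite expr0 scale1r scaler0 subr0.
  by rewrite scalerA -exprS subrr.
have : [set x | ell2 x /\ (fun i => x i - z *: shiftop x i) = embed u]
    (resolvent (@shiftop R n) z (embed u)).
  by apply: (@xgetPex _ (fun=> 0)); exists (fun i => z ^+ i *: u).
move=> [_]; move: (resolvent _ _ _) => x hx; apply/funext; elim => [|i IH].
  have := congr1 (fun f => f 0%N) hx => /=.
  by rewrite scaler0 subr0 expr0 scale1r.
have := congr1 (fun f => f i.+1) hx => /=.
by rewrite IH => /eqP; rewrite subr_eq0 scalerA -exprS => /eqP.
Qed.

(** A square summable solution exists because the data are absolutely summable,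
    and [has_sum_resolvent] reads off its first entry. *)
Lemma resolvent_backshift0 n z (b : nat -> 'cV[C]_n) : disc z -> asum b ->
  has_sum (fun k => z ^+ k *: b k) (resolvent (adjop (@shiftop R n)) z b 0%N).
Proof.
move=> z1 [M bM]; have z1' := disc_cdisc z1.
have M0 := bsum_ge0 bM.
have b0 i : 0 <= fnorm (b i) := fnorm_ge0 _.
have bs i : bsum (fun k => fnorm (b (i + k)%N)) M by exact: (@bsum_shift _ (fun i => fnorm (b i))).
pose w i := vsum (fun k => z ^+ k *: b (i + k)%N).
have hw i : has_sum (fun k => z ^+ k *: b (i + k)%N) (w i).
  apply: asum_has_sum; exists M; apply: bsum_le (bs i) => k.
  exact: (@fnorm_psterm _ _ _ (fun k => b (i + k)%N)).
have ew : ell2 w.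
  apply: asum_ell2; exists ((1 - cmod z)^-1 * M).
  apply: (@bsum_exchange _ _ _ (fun k i => z ^+ k *: b (i + k)%N) _
    (fun k => cmod z ^+ k * M) _ _ _ hw).
    move=> k j; under eq_bigr do rewrite fnormZ cmodX addnC.
    by rewrite -mulr_sumr ler_wpM2l ?exprn_ge0 ?cmod_ge0 //; exact: bs.
  by move=> j; rewrite -mulr_suml ler_wpM2r //; exact: sum_cmodX.
have wrec i : w i = b i + z *: w i.+1.
  apply: vsumE.
  have -> : b i = z ^+ 0 *: b (i + 0)%N by rewrite expr0 scale1r addn0.
  apply: (@has_sum_shift _ _ _ (fun k => z ^+ k *: b (i + k)%N)).
  have h := has_sumZ z (hw i.+1).
  by apply: eq_has_sum h => k; rewrite scalerA -exprS addSnnS.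
have : [set x | ell2 x /\ (fun i => x i - z *: adjop (@shiftop R n) x i) = b]
    (resolvent (adjop (@shiftop R n)) z b).
  apply: (@xgetPex _ (fun=> 0)); exists w; split=> //.
  rewrite (adjop_shift ew); apply/funext => i; rewrite {1}wrec.
  by rewrite addrK.
move=> [ex hx]; apply: (has_sum_resolvent z1 ex) => k.
rewrite -{2}hx (adjop_shift ex) subrK.
by [].
Qed.

End Operators.

Section Boundary.
Context {R : realType}.
Local Notation C := (C R).

Lemma cmod_powB (w z : C) n : cdisc w -> cdisc z ->
  cmod (w ^+ n - z ^+ n) <= n%:R * cmod (w - z).
Proof.
move=> /cdisc_cmod w1 /cdisc_cmod z1; elim: n => [|n IH].
  by rewrite subrr cmod0 mul0r.
have -> : w ^+ n.+1 - z ^+ n.+1 = w * (w ^+ n - z ^+ n) + (w - z) * z ^+ n.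
  by rewrite !exprS mulrBr mulrBl addrA subrK.
apply: le_trans (cmodD _ _) _; rewrite !cmodM -natr1 mulrDl mul1r lerD //.
  by apply: le_trans IH; rewrite ler_piMl ?cmod_ge0.
by rewrite ler_piMr ?cmod_ge0 // cmodX exprn_ile1 ?cmod_ge0.
Qed.

Lemma closure_disc (z : C) : cdisc z -> closure (@disc R) z.
Proof.
move=> /cdisc_cmod z1 B /nbhs_ballP[e e0 hB].
have eR : e = ((complex.Re e)%:C)%C by rewrite complex.RRe_real // gtr0_real.
have {}e0 : 0 < complex.Re e by move: e0; rewrite eR /= ltcR.
pose t : R := Num.min 1 (complex.Re e / 2).
have t0 : 0 < t by rewrite lt_min ltr01 divr_gt0.
have t1 : t <= 1 by rewrite ge_min lexx.
have te : t < complex.Re e.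
  by apply: (@le_lt_trans _ _ (complex.Re e / 2)); [rewrite ge_min lexx orbT|lra].
exists (((1 - t)%:C)%C * z); split.
  apply/disc_cmod; rewrite cmodM cmod_real ger0_norm ?subr_ge0 //.
  apply: (@le_lt_trans _ _ ((1 - t) * 1)); last by rewrite mulr1 gtrBl.
  by rewrite ler_wpM2l // subr_ge0.
apply: hB; rewrite /ball /= eR norm_cmod ltcR.
have -> : z - ((1 - t)%:C)%C * z = ((t%:C)%C : C) * z.
  by rewrite rmorphB mulrBl rmorph1 mul1r opprB addrC subrK.
rewrite cmodM cmod_real ger0_norm ?(ltW t0) //.
by apply: le_lt_trans te; rewrite ler_piMr // ltW.
Qed.

(** Abel summation: dominated convergence over the coefficients, with the powers
    of [w] tending to those of [z]. *)
Lemma disc_ext_wiener_coef r s (a : nat -> 'M[C]_(r, s)) (F K : C -> 'M[C]_(r, s)) :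
  wiener_coef a F -> (forall z, disc z -> K z = F z) ->
  forall z, cdisc z -> disc_ext K z = F z.
Proof.
move=> aF KF z z1; rewrite /disc_ext; case: ifPn => [zd|_]; first exact: KF.
have PF : ProperFilter (within (@disc R) (nbhs z)).
  by apply: within_nbhs_proper; exact: closure_disc.
apply: cvg_fnorm_lim; apply/cvg_fnorm.
have [[M aM] aF'] := aF.
pose f (w : C) k := fnorm (psterm a w k - psterm a z k).
have fE w k : f w k = cmod (w ^+ k - z ^+ k) * fnorm (a k).
  by rewrite /f /psterm -scalerBl fnormZ.
have nd : \forall w \near within (@disc R) (nbhs z), disc w.
  by apply: withinT; exact: nbhs_filter.
apply/cvgrPdist_le => e e0.
have : \forall w \near within (@disc R) (nbhs z), bsum (f w) e.
  apply: (@bsum_dominated R _ _ _ f (fun k => 2 * fnorm (a k)) (2 * M)) => //.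
  - by move=> k; rewrite mulr_ge0 ?fnorm_ge0.
  - exact: bsumZ.
  - apply: filterS nd => w wd k; rewrite fE mulr_ge0 ?cmod_ge0 ?fnorm_ge0 //=.
    rewrite ler_wpM2r ?fnorm_ge0 // (_ : 2 = 1 + 1) //.
    apply: le_trans (cmodD _ _) _; rewrite cmodN !cmodX.
    move/disc_cdisc/cdisc_cmod : wd => wd; move/cdisc_cmod : z1 => z1.
    by rewrite lerD // exprn_ile1 ?cmod_ge0.
  - move=> k; apply/cvgrPdist_le => d d0.
    pose q := d / (k%:R * fnorm (a k) + 1).
    have q1 : 0 < k%:R * fnorm (a k) + 1 by rewrite ltr_wpDl // mulr_ge0 ?fnorm_ge0.
    have q0 : 0 < q by rewrite divr_gt0.
    have hq : \forall w \near within (@disc R) (nbhs z), cmod (w - z) <= q.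
      apply: cvg_within; exists ((q%:C)%C : C); first by rewrite /= ltcR.
      by move=> w; rewrite /ball_ /= -normrN opprB norm_cmod ltcR => /ltW.
    apply: filterS2 nd hq => w wd hw.
    rewrite sub0r normrN ger0_norm ?fnorm_ge0 // fE.
    apply: (@le_trans _ _ (k%:R * q * fnorm (a k))).
      rewrite ler_wpM2r ?fnorm_ge0 //.
      apply: le_trans (cmod_powB k (disc_cdisc wd) z1) _.
      by rewrite ler_wpM2l.
    rewrite mulrAC mulrC /q mulrAC ler_pdivrMr // ler_wpM2l ?(ltW d0) //.
    by rewrite lerDl.
apply: filterS2 nd => w wd hw; rewrite sub0r normrN ger0_norm ?fnorm_ge0 //.
rewrite KF //; apply: has_sum_bound hw.
by apply: has_sumB; [apply: aF'; exact: disc_cdisc|exact: aF'].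
Qed.

End Boundary.

Section Data.
Context {R : realType}.
Local Notation C := (C R).
Variables (m p : nat) (G : C -> 'M[C]_(m, p)) (g : nat -> 'M[C]_(m, p)).
Hypothesis gG : wiener_coef g G.
Variable N : R.
Hypothesis gN : bsum (fun d => fnorm (g d)) N.

Lemma adjop_toeplitz y : ell2 y -> adjop (toeplitz G) y = toepadj g y.
Proof.
move=> ey; have [et _] := toepadj_l2 gN ey; apply: (adjop_eq et) => x ex.
rewrite toeplitzE (wiener_coef_taylor_eq gG); exact: (l2dot_convol gN ex ey).
Qed.

Lemma TTadjE y : ell2 y -> TTadj G y = gram g y.
Proof.
by move=> ey; rewrite /TTadj adjop_toeplitz // toeplitzE (wiener_coef_taylor_eq gG).
Qed.

Lemma invop_TTadj b : invop (TTadj G) b = ginv g b.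
Proof.
rewrite /ginv /invop; congr (xget _ _); apply/seteqP; split=> y /= [ey <-].
  by rewrite TTadjE.
by rewrite -TTadjE.
Qed.

Lemma hankel_embed u : hankel G (embed u) = gtail g u.
Proof.
apply/funext => i; rewrite /hankel /blockop (wiener_coef_taylor_eq gG).
have h : has_sum (fun j => g (i + j).+1 *m embed u j)
    (\sum_(j < 1) g (i + j).+1 *m embed u j).
  by apply: has_sum_fin => -[|j] // _; rewrite mulmx0.
by rewrite -/(vsum _) (vsumE h) big_ord1 addn0.
Qed.

Lemma hankel_powers z u : hankel G (fun i => z ^+ i *: u) = hres g z u.
Proof.
apply/funext => i; rewrite /hankel /blockop (wiener_coef_taylor_eq gG) /hres.
by rewrite -/(vsum _); congr vsum; apply/funext => j; rewrite scalemxAr.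
Qed.

Variable delta : R.
Hypothesis delta_gt0 : 0 < delta.
Hypothesis gram_pos : forall x, ell2 x ->
  (((delta * l2norm x ^+ 2)%:C)%C : C) <= l2dot (gram g x) x.

Lemma TGdagE b : ell2 b -> TGdag G b = dagger g b.
Proof.
move=> eb; have [e _] := ginvP gN delta_gt0 gram_pos eb.
by rewrite /TGdag invop_TTadj adjop_toeplitz.
Qed.

Lemma Xi0E : Xi0 G = Xi0m g.
Proof.
by apply: eq_mx_of => u; rewrite /embed_adj TGdagE //; exact: ell2_embed.
Qed.

Lemma corner_projE : corner_proj G = cornerm g.
Proof.
apply: eq_mx_of => u; rewrite /embed_adj toeplitzE (wiener_coef_taylor_eq gG).
by rewrite (convol_embed g) TGdagE //; exact: (@ell2_gcol _ _ _ _ _ gN).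
Qed.

Lemma Ydisc_wiener_coef F : wiener_coef (Ycoef g) F ->
  forall z, disc z -> Ydisc G z = F z.
Proof.
move=> wF z z1; have z1' := disc_cdisc z1.
have hh := asum_has_sum (asum_psterm (asum_hcoef gN delta_gt0 gram_pos) z1').
set H := vsum _ in hh.
have -> : Ydisc G z = 1%:M - z *: H.
  rewrite /Ydisc; congr (_ - z *: _); rewrite -[RHS]mx_of_mul.
  apply: eq_mx_of => u; rewrite hankel_embed TGdagE; last first.
    exact: (@ell2_gtail _ _ _ _ _ gN).
  have ad := asum_dagger gN delta_gt0 gram_pos (asum_gtail gN u).
  have h1 := resolvent_backshift0 z1 ad.
  apply: has_sum_uniq h1 _; have h2 := has_sumMr u hh.
  apply: eq_has_sum h2 => n.
  by rewrite /psterm -scalemxAl (hcoefE gN delta_gt0 gram_pos).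
apply/esym; apply: has_sum_uniq (wF.2 z z1') _.
have -> : 1%:M - z *: H = psterm (Ycoef g) z 0%N + - z *: H.
  by rewrite /psterm expr0 scale1r scaleNr.
apply: (@has_sum_shift _ _ _ (psterm (Ycoef g) z)).
have h := has_sumZ (- z) hh.
apply: eq_has_sum h => n.
by rewrite /psterm /= scalerN scalerA mulNr -exprS scaleNr.
Qed.

Lemma Yfun_wiener_coef : wiener_coef (Ycoef g) (Yfun G).
Proof.
have wF := wiener_coef_vsum (asum_Ycoef gN delta_gt0 gram_pos).
apply: eq_wiener_coef (wF) => z z1; apply/esym.
exact: (disc_ext_wiener_coef wF (Ydisc_wiener_coef wF)).
Qed.

Lemma Zcoef_formula K : wiener_coef (Zcoef g) K -> forall z, disc z ->
  1%:M + z *: mx_of (fun u : 'cV[C]_p =>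
    embed_adj (TGdag G (hankel G (resolvent (@shiftop R p) z (embed u))))) = K z.
Proof.
move=> wK z z1; have z1' := disc_cdisc z1.
have [M hM] := asum_Zcoef gN delta_gt0 gram_pos.
have hz : has_sum (psterm (zcoef g) z) (vsum (psterm (zcoef g) z)).
  apply: asum_has_sum; apply: asum_psterm => //; exists M.
  have := @bsum_shift _ (fun i => fnorm (Zcoef g i)) M 1.
  by apply=> // i; exact: fnorm_ge0.
set H := vsum _ in hz.
have -> : mx_of (fun u : 'cV[C]_p =>
    embed_adj (TGdag G (hankel G (resolvent (@shiftop R p) z (embed u))))) = H.
  rewrite -[RHS]mx_of_mul; apply: eq_mx_of => u.
  rewrite resolvent_shift // hankel_powers TGdagE; last first.
    by apply: asum_ell2; exact: (asum_hres gN).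
  have h1 := @dagger_hres0 _ _ _ _ _ gN _ delta_gt0 gram_pos z u z1.
  apply: has_sum_uniq h1 _; have h2 := has_sumMr u hz.
  by apply: eq_has_sum h2 => n; rewrite /psterm -scalemxAl.
apply/esym; apply: has_sum_uniq (wK.2 z z1') _.
have -> : 1%:M + z *: H = psterm (Zcoef g) z 0%N + z *: H.
  by rewrite /psterm expr0 scale1r.
apply: (@has_sum_shift _ _ _ (psterm (Zcoef g) z)).
have h := has_sumZ z hz.
by apply: eq_has_sum h => n; rewrite /psterm /= scalerA -exprS.
Qed.

End Data.

(** * The main result *)

Section BlockInverse.
Context {F : fieldType}.

Lemma block_inverse m k p (e : (m + k)%N = p) (A : 'M[F]_(m, p)) (B : 'M[F]_(k, p))
    (Y : 'M[F]_p) (X : 'M[F]_(p, m)) (T : 'M[F]_(p, k)) :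
  A *m Y *m X = 1%:M -> A *m Y *m T = 0 -> B *m Y *m X = 0 -> B *m Y *m T = 1%:M ->
  \det (castmx (e, erefl p) (col_mx A B)) != 0 /\
  invmx (castmx (e, erefl p) (col_mx A B)) =
    Y *m castmx (erefl p, e) (row_mx X T).
Proof.
case: p / e A B Y X T => A B Y X T AX AT BX BT; rewrite !castmx_id.
have h : col_mx A B *m (Y *m row_mx X T) = 1%:M.
  rewrite mulmxA mul_col_mx mul_col_row AX AT BX BT.
  by rewrite -scalar_mx_block.
have [u _] := mulmx1_unit h; split; first by move: u; rewrite unitmxE unitfE.
by rewrite -[RHS]mul1mx -(mulVmx u) -mulmxA h mulmx1.
Qed.

Lemma rect_inverse_dim a b (A : 'M[F]_(a, b)) (B : 'M[F]_(b, a)) :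
  A *m B = 1%:M -> B *m A = 1%:M -> a = b.
Proof.
move=> /mulmx1_min ab /mulmx1_min ba; apply/eqP; rewrite eqn_leq ab ba //.
Qed.

End BlockInverse.

Section WienerFacts.
Context {R : realType}.
Local Notation C := (C R).

Lemma leg_le_hypotenuse (a b c : R) : 0 <= b -> b ^+ 2 = a ^+ 2 + c ^+ 2 -> a <= b.
Proof.
move=> b0 e; apply: le_trans (ler_norm a) _.
by rewrite -(ger0_norm b0) -!sqrtr_sqr ler_wsqrtr // e lerDl sqr_ge0.
Qed.

Lemma leg_eq0 (a b c : R) : 0 <= b -> b <= a -> b ^+ 2 = a ^+ 2 + c ^+ 2 -> c <= 0.
Proof.
move=> b0 ba e; have : b ^+ 2 <= a ^+ 2 by rewrite lerXn2r ?nnegrE // (le_trans b0).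
rewrite e gerDl => c2; have /eqP : c ^+ 2 == 0 by rewrite eq_le c2 sqr_ge0.
by move/eqP; rewrite sqrf_eq0 => /eqP ->.
Qed.

Lemma wiener_coef_is_wiener r s (a : nat -> 'M[C]_(r, s)) F : wiener_coef a F -> wiener F.
Proof. by move=> aF; apply/wienerP; exists a. Qed.

Lemma H2norm_ext n (a : nat -> 'cV[C]_n) (F K : C -> 'cV[C]_n) :
  wiener_coef a F -> (forall z, cdisc z -> F z = K z) -> H2norm F = H2norm K.
Proof.
move=> aF FK; rewrite /H2norm (wiener_coef_taylor_eq aF).
by rewrite (wiener_coef_taylor_eq (eq_wiener_coef FK aF)).
Qed.

Lemma wiener_coef_eq0 r s (a : nat -> 'M[C]_(r, s)) F : wiener_coef a F ->
  (forall n, a n = 0) -> forall z, cdisc z -> F z = 0.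
Proof.
move=> aF a0 z z1; apply: has_sum_uniq (aF.2 z z1) _.
by have := @has_sum0 R r s; apply: eq_has_sum => n; rewrite /psterm a0 scaler0.
Qed.

End WienerFacts.

Theorem theorem1p1 (R : realType) (m p k : nat)
    (G : C R -> 'M[C R]_(m, p)) (Theta0 : 'M[C R]_(p, k))
    (G_wiener : wiener G)
    (TG_pos : strictly_positive (TTadj G))
    (Theta0_def : Theta0 *m Theta0^t* = 1%:M - corner_proj G)
    (Theta0_ker : forall u : 'cV[C R]_k, Theta0 *m u = 0 -> u = 0) :
  let Y := Yfun G in
  let G0 := taylor G 0%N in
  let Theta := fun z => Y z *m Theta0 in
  let H := fun z => invmx (Theta0^t* *m Theta0) *m Theta0^t*
                    *m (1%:M - Xi0 G *m G0) *m invmx (Y z) in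
  (wiener Y /\
   (forall z, cdisc z -> \det (Y z) != 0) /\
   (forall z, disc z ->
      invmx (Y z) = 1%:M + z *: mx_of (fun u : 'cV[C R]_p =>
        embed_adj (TGdag G (hankel G (resolvent (@shiftop R p) z (embed u)))))) /\
   wiener (fun z => invmx (Y z)) /\
   invertible_outer Y) /\
  (* (i) *)
  (forall z, cdisc z -> G z *m Y z = G0) /\
  (* (ii) *)
  (wiener Theta /\ (m + k)%N = p /\ inner Theta /\
   toeplitz Theta @` @ell2 R k =
     @ell2 R p `&` [set x | toeplitz G x = (fun=> 0)]) /\
  (* (iii) *)
  (wiener H /\
   exists e : (m + k)%N = p, forall z, cdisc z ->
     let GH := castmx (e, erefl p) (col_mx (G z) (H z)) in
     \det GH != 0 /\
     invmx GH = Y z *m castmx (erefl p, e) (row_mx (Xi0 G) Theta0)) /\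
  (* all solutions *)
  (forall V : C R -> 'M[C R]_(k, m), wiener V ->
     bezout_solution G (fun z => Y z *m Xi0 G + Y z *m Theta0 *m V z)) /\
  (forall X : C R -> 'M[C R]_(p, m), bezout_solution G X ->
     exists V : C R -> 'M[C R]_(k, m), wiener V /\
       forall z, cdisc z -> X z = Y z *m Xi0 G + Y z *m Theta0 *m V z) /\
  (forall V : C R -> 'M[C R]_(k, m), wiener V -> forall u : 'cV[C R]_m,
     H2norm (fun z => (Y z *m Xi0 G + Y z *m Theta0 *m V z) *m u) ^+ 2 =
       H2norm (fun z => Y z *m Xi0 G *m u) ^+ 2 +
       H2norm (fun z => V z *m u) ^+ 2) /\
  (* least squares solution, unique as a function on the closed disc *)
  (least_squares_solution G (fun z => Y z *m Xi0 G) /\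
   forall X, least_squares_solution G X ->
     forall z, cdisc z -> X z = Y z *m Xi0 G).
Proof.
have [g gG] := (wienerP G).1 G_wiener.
have [[N gN] _] := gG.
have [delta delta_gt0 TTpos] := TG_pos.
have gram_pos x : ell2 x ->
    (((delta * l2norm x ^+ 2)%:C)%C : C R) <= l2dot (gram g x) x.
  by move=> ex; have := TTpos x ex; rewrite (TTadjE gG gN ex).
have T0_def : Theta0 *m Theta0^t* = 1%:M - cornerm g.
  by rewrite Theta0_def (corner_projE gG gN delta_gt0 gram_pos).
have gE : taylor G = g := wiener_coef_taylor_eq gG.
have XiE : Xi0 G = Xi0m g := Xi0E gG gN delta_gt0 gram_pos.
have wY : wiener_coef (Ycoef g) (Yfun G) := Yfun_wiener_coef gG gN delta_gt0 gram_pos.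
pose Z z := vsum (psterm (Zcoef g) z).
have wZ : wiener_coef (Zcoef g) Z := wiener_coef_vsum (asum_Zcoef gN delta_gt0 gram_pos).
have YZ z : cdisc z -> Yfun G z *m Z z = 1%:M.
  exact: (Ycoef_Zcoef gN delta_gt0 gram_pos wY wZ).
have Yu z : cdisc z -> Yfun G z \in unitmx.
  by move=> z1; have [] := mulmx1_unit (YZ z z1).
have YV z : cdisc z -> invmx (Yfun G z) = Z z.
  by move=> z1; rewrite -[RHS]mul1mx -(mulVmx (Yu z z1)) -mulmxA YZ // mulmx1.
have wV : wiener_coef (Zcoef g) (fun z => invmx (Yfun G z)).
  by apply: eq_wiener_coef wZ => z z1; rewrite YV.
have GY z : cdisc z -> G z *m Yfun G z = g 0%N.
  have w1 := wiener_coef_convol gG wY; have w2 := wiener_coef_const (g 0%N).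
  have E : convol g (Ycoef g) = fun n => if n is 0%N then g 0%N else 0.
    by apply/funext => n; rewrite (convol_Ycoef gN delta_gt0 gram_pos).
  rewrite E in w1 => z1; exact: has_sum_uniq (w1.2 z z1) (w2.2 z z1).
pose T0i := T0inv Theta0.
have T0iK : T0i *m Theta0 = 1%:M := T0invK Theta0_ker.
have g0Xi : g 0%N *m Xi0m g = 1%:M := g0_Xi0 gN delta_gt0 gram_pos.
have g0T0 : g 0%N *m Theta0 = 0.
  exact: (g0_T0 gN delta_gt0 gram_pos T0_def Theta0_ker).
have compl : Theta0 *m (T0i *m (1%:M - Xi0m g *m g 0%N)) = 1%:M - Xi0m g *m g 0%N.
  exact: (g0_compl gN delta_gt0 gram_pos T0_def Theta0_ker).
pose H0 := T0i *m (1%:M - Xi0m g *m g 0%N).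
have complH : Theta0 *m H0 = 1%:M - Xi0m g *m g 0%N := compl.
have H0Xi : H0 *m Xi0m g = 0.
  by rewrite /H0 -(mulmxA T0i) mulmxBl mul1mx -(mulmxA (Xi0m g)) g0Xi mulmx1 subrr mulmx0.
have H0T0 : H0 *m Theta0 = 1%:M.
  by rewrite /H0 -(mulmxA T0i) mulmxBl mul1mx -(mulmxA (Xi0m g)) g0T0 mulmx0 subr0.
(* [g 0; H0] and [Xi0m g, Theta0] are inverse to each other on both sides,
   which forces the rectangular blocks to be square. *)
have dim : (m + k)%N = p.
  apply: (@rect_inverse_dim _ _ _ (col_mx (g 0%N) H0) (row_mx (Xi0m g) Theta0)).
    by rewrite mul_col_row g0Xi g0T0 H0Xi H0T0 -scalar_mx_block.
  by rewrite mul_row_col compl addrC subrK.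
move=> Y G0 Theta H.
have wTheta : wiener_coef (Thcoef g Theta0) Theta := wiener_coefMr Theta0 wY.
have ThE : taylor Theta = Thcoef g Theta0 := wiener_coef_taylor_eq wTheta.
have HE : H = fun z => H0 *m invmx (Y z).
  by rewrite /H /G0 gE XiE.
have wH : wiener_coef (fun n => H0 *m Zcoef g n) H.
  by rewrite HE; exact: (wiener_coefMl H0 wV).
have iso := convol_Th_isometry gN delta_gt0 gram_pos T0_def Theta0_ker.
have wX V v : wiener_coef v V -> wiener_coef (fun n => Ycoef g n *m Xi0 G +
     convol (Thcoef g Theta0) v n) (fun z => Y z *m Xi0 G + Y z *m Theta0 *m V z).
  move=> wVv.
  exact: (wiener_coefD (wiener_coefMr (Xi0 G) wY) (wiener_coef_convol wTheta wVv)).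
have sol V : wiener V ->
     bezout_solution G (fun z => Y z *m Xi0 G + Y z *m Theta0 *m V z).
  move=> /wienerP[v wVv]; split; first by apply/wienerP; eexists; exact: wX wVv.
  move=> z /disc_cdisc z1; rewrite mulmxDr !mulmxA (GY z z1) XiE; rewrite g0Xi g0T0.
  by rewrite mul0mx addr0.
(* The first block of [G; H] X is the identity, so the inverse of [G; H] gives
   back X from V = H X. *)
have all X : bezout_solution G X -> exists V, wiener V /\
       forall z, cdisc z -> X z = Y z *m Xi0 G + Y z *m Theta0 *m V z.
  move=> [/wienerP[x wXx] GX]; exists (fun z => H z *m X z); split.
    by apply/wienerP; eexists; exact: wiener_coef_convol wH wXx.
  have GX1 z : cdisc z -> G z *m X z = 1%:M.
    exact: (wiener_coef_disc_eq (wiener_coef_convol gG wXx) (wiener_coef_const 1%:M) GX).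
  move=> z z1; pose W := invmx (Y z) *m X z.
  have YW : Y z *m W = X z by rewrite mulKVmx //; exact: Yu.
  have g0W : g 0%N *m W = 1%:M by rewrite -(GY z z1) -mulmxA YW GX1.
  have HX : H z *m X z = H0 *m W by rewrite HE -(mulmxA H0).
  rewrite HX -(mulmxA (Y z)) -mulmxDr (mulmxA Theta0) complH.
  by rewrite mulmxBl mul1mx -(mulmxA (Xi0m g)) g0W mulmx1 XiE addrC subrK YW.
have pyth V : wiener V -> forall u : 'cV[C R]_m,
     H2norm (fun z => (Y z *m Xi0 G + Y z *m Theta0 *m V z) *m u) ^+ 2 =
       H2norm (fun z => Y z *m Xi0 G *m u) ^+ 2 +
       H2norm (fun z => V z *m u) ^+ 2.
  move=> /wienerP[v wVv] u; rewrite /H2norm.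
  rewrite (wiener_coef_taylor_eq (wiener_coefMr u (wX _ _ wVv))).
  rewrite (wiener_coef_taylor_eq (wiener_coefMr u (wiener_coefMr (Xi0 G) wY))).
  rewrite (wiener_coef_taylor_eq (wiener_coefMr u wVv)).
  have eu := @ell2_embed R m u.
  have ed := ell2_dagger gN delta_gt0 gram_pos eu.
  have XE : (fun n => Ycoef g n *m Xi0 G *m u) = dagger g (embed u).
    apply/funext => n; rewrite XiE -mulmxA.
    exact: (Ycoef_Xi0m gN delta_gt0 gram_pos).
  have ev : ell2 (fun n => v n *m u) := asum_ell2 (asumMr u wVv.1).
  have [eTv Tv] := iso _ ev.
  have orth : l2dot (convol (Thcoef g Theta0) (fun n => v n *m u))
      (dagger g (embed u)) = 0.
    apply: (l2dot_dagger gN delta_gt0 gram_pos eTv eu).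
    exact: (convol_g_Th gN delta_gt0 gram_pos T0_def Theta0_ker).
  have -> : (fun n => (Ycoef g n *m Xi0 G + convol (Thcoef g Theta0) v n) *m u) =
     fun n => convol (Thcoef g Theta0) (fun n => v n *m u) n + dagger g (embed u) n.
    by apply/funext => n; rewrite mulmxDl convolMr -XE addrC.
  by rewrite (l2normD_orth eTv ed orth) XE Tv addrC.
split; [|split; [|split; [|split; [|split; [|split; [|split]]]]]].
- split; first exact: (wiener_coef_is_wiener wY).
  split; first by move=> z z1; have := Yu z z1; rewrite unitmxE unitfE.
  split.
    move=> z z1; rewrite (Zcoef_formula gG gN delta_gt0 gram_pos wZ z1).
    exact: YV (disc_cdisc z1).
  split; first exact: (wiener_coef_is_wiener wV).
  split; first exact: (wiener_coef_Hinf wY).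
    by move=> z /disc_cdisc; exact: Yu.
  exact: (wiener_coef_Hinf wV).
- by move=> z z1; rewrite /G0 gE; exact: GY.
- split; first exact: (wiener_coef_is_wiener wTheta).
  split; first exact: dim.
  split.
    split; first exact: (wiener_coef_Hinf wTheta).
    by move=> x ex; rewrite toeplitzE ThE; exact: iso.
  apply/seteqP; split=> [_ [v ev <-]|x [ex gx]].
    rewrite /= !toeplitzE ThE gE; split; first by have [] := iso _ ev.
    exact: (convol_g_Th gN delta_gt0 gram_pos T0_def Theta0_ker).
  rewrite /= toeplitzE gE in gx.
  have [v ev vx] := ker_Th gN delta_gt0 gram_pos T0_def Theta0_ker ex gx.
  by exists v; [exact: ev|rewrite toeplitzE ThE].
- split; first exact: (wiener_coef_is_wiener wH).
  exists dim => z z1.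
  have HY : H z *m Y z = H0.
    by rewrite HE -(mulmxA H0) mulVmx ?mulmx1 //; exact: Yu.
  apply: block_inverse; first by rewrite (GY z z1) XiE.
  - by rewrite (GY z z1).
  - by rewrite HY XiE.
  - by rewrite HY.
- exact: sol.
- exact: all.
- exact: pyth.
- have wXi : wiener_coef (fun n => Ycoef g n *m Xi0 G) (fun z => Y z *m Xi0 G).
    exact: (wiener_coefMr (Xi0 G) wY).
  have Xisol : bezout_solution G (fun z => Y z *m Xi0 G).
    split; first exact: (wiener_coef_is_wiener wXi).
    by move=> z /disc_cdisc z1; rewrite mulmxA (GY z z1) XiE.
  have split_norm X V : bezout_solution G X -> wiener V ->
      (forall z, cdisc z -> X z = Y z *m Xi0 G + Y z *m Theta0 *m V z) ->
      forall u, H2norm (fun z => X z *m u) ^+ 2 =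
      H2norm (fun z => Y z *m Xi0 G *m u) ^+ 2 + H2norm (fun z => V z *m u) ^+ 2.
    move=> [/wienerP[x wx] _] hV XV u.
    have E : H2norm (fun z => X z *m u) =
        H2norm (fun z => (Y z *m Xi0 G + Y z *m Theta0 *m V z) *m u).
      by apply: (H2norm_ext (wiener_coefMr u wx)) => z z1; rewrite (XV z z1).
    exact: (etrans (congr1 (fun t => t ^+ 2) E) (pyth V hV u)).
  have norm0 n (f : C R -> 'cV[C R]_n) : 0 <= H2norm f by exact: sqrtr_ge0.
  split.
    split; first exact: Xisol.
    move=> X sX u; have [V [hV XV]] := all X sX.
    exact: (leg_le_hypotenuse (norm0 _ _) (split_norm X V sX hV XV u)).
  move=> X [sX lsX]; have [V [hV XV]] := all X sX.
  have [v wv] := (wienerP V).1 hV.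
  have v0 n : v n = 0.
    apply: eq_mulmx_cV => u; rewrite mul0mx.
    have ev : ell2 (fun n => v n *m u) := asum_ell2 (asumMr u wv.1).
    have := leg_eq0 (norm0 _ _) (lsX _ Xisol u) (split_norm X V sX hV XV u).
    rewrite /H2norm (wiener_coef_taylor_eq (wiener_coefMr u wv)) => h0.
    by have := congr1 (fun f => f n) (l2norm_eq0 ev h0).
  move=> z z1; rewrite (XV z z1) (wiener_coef_eq0 wv v0 z1).
  by rewrite mulmx0 addr0.
Qed.
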